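(* Let $K^*\in\mathcal{K}$ denote the global optimum of $\min_{K\in\mathcal{K}}\mathcal{J}(K)$ of the form $K^*=(R+B^\top\tilde P_{K^*}B)^{-1}B^\top\tilde P_{K^*}A$. Suppose $K_0\in\mathcal{K}$, $\|K_0\|<\infty$, and $DD^\top>0$. Let $\{K_n\}_{n\ge0}$ be generated from $K_0$, with a constant stepsize $\eta>0$, by either (a) the natural policy gradient iteration $K_{n+1}=K_n-2\eta E_{K_n}$ with $\eta\le \dfrac{1}{2\|R+B^\top\tilde P_{K_0}B\|}$, or (b) the Gauss–Newton iteration $K_{n+1}=K_n-2\eta(R+B^\top\tilde P_{K_n}B)^{-1}E_{K_n}$ with $\eta\le\dfrac12$. Then the iterates converge to the optimal gain $K^*$ with locally linear rate, in the sense that $\{\mathcal{J}(K_n)\}$ converges to $\mathcal{J}(K^* )$ with a linear rate locally: there exist $n_0$ and $\varrho\in(0,1)$ such that $\mathcal{J}(K_{n+1})-\mathcal{J}(K^* )\le\varrho\,[\mathcal{J}(K_n)-\mathcal{J}(K^* )]$ for all $n\ge n_0$. In addition, if $\eta=1/2$, the Gauss–Newton iteration converges to $K^*$ with a locally Q-quadratic rate: there exist $n_0$ and $c>0$ such that $\mathcal{J}(K_{n+1})-\mathcal{J}(K^* )\le c\,[\mathcal{J}(K_n)-\mathcal{J}(K^* )]^2$ for all $n\ge n_0$.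
   Context: Setting (discrete-time mixed $\mathcal{H}_2/\mathcal{H}_\infty$ design). $A\in\mathbb{R}^{m\times m}$, $B\in\mathbb{R}^{m\times d}$, $C\in\mathbb{R}^{l\times m}$, $D\in\mathbb{R}^{m\times n}$, $E\in\mathbb{R}^{l\times d}$ are real matrices satisfying $E^\top[C\ \ E]=[0\ \ R]$ for some $R>0$, and $\gamma>0$. Gains are $K\in\mathbb{R}^{d\times m}$. $\rho(\cdot)$ is the spectral radius, $\|\cdot\|$ the operator norm, $X>0$ ($X\ge0$) denotes (symmetric) positive definite (semidefinite), $X^{-\top}=(X^{-1})^\top$. A square matrix is stable if its spectral radius is $<1$. Transfer function: $\mathcal{T}(K)(z)=(C^\top C+K^\top RK)^{1/2}\,(zI-(A-BK))^{-1}D$, with $\|\mathcal{T}(K)\|_\infty=\sup_{\theta\in[0,2\pi)}\lambda_{\max}^{1/2}\big[\mathcal{T}(K)(e^{-j\theta})^\top \mathcal{T}(K)(e^{j\theta})\big]$. Feasible set: $\mathcal{K}=\{K:\rho(A-BK)<1,\ \|\mathcal{T}(K)\|_\infty<\gamma\}$. For $K\in\mathcal{K}$, $P_K$ denotes the unique stabilizing solution (it exists by the discrete-time Bounded Real Lemma) of the Riccati equation $(A-BK)^\top\tilde P_K(A-BK)+C^\top C+K^\top RK-P_K=0$, where $\tilde P_K:=P_K+P_KD(\gamma^2I-D^\top P_KD)^{-1}D^\top P_K$; i.e., the unique solution $P_K\ge0$ with $I-\gamma^{-2}D^\top P_KD>0$ and $(I-\gamma^{-2}P_KDD^\top)^{-\top}(A-BK)$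 stable. Also $E_K:=(R+B^\top\tilde P_KB)K-B^\top\tilde P_KA$. Cost: $\mathcal{J}(K)=-\gamma^2\log\det(I-\gamma^{-2}P_KDD^\top)$ for $K\in\mathcal{K}$. *)

(* Defs.v *)
From HB Require Import structures.
From mathcomp Require Import all_boot all_order all_algebra.
From mathcomp Require Import complex.
From mathcomp Require Import all_classical all_reals all_analysis.

Set Implicit Arguments.
Unset Strict Implicit.
Unset Printing Implicit Defensive.

Import Order.TTheory GRing.Theory Num.Theory.
Import numFieldNormedType.Exports.

Local Open Scope classical_set_scope.
Local Open Scope ring_scope.

Section Matrices.
Variable F : realType.

Definition cmx m n (M : 'M[F]_(m, n)) : 'M[F[i]]_(m, n) :=
  map_mx (real_complex F) M.

Definition posdefmx n (M : 'M[F]_n) : Prop :=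
  M^T = M /\ forall x : 'cV[F]_n, x != 0 -> 0 < (x^T *m M *m x) 0 0.

Definition possemidefmx n (M : 'M[F]_n) : Prop :=
  M^T = M /\ forall x : 'cV[F]_n, 0 <= (x^T *m M *m x) 0 0.

Definition sqrtmx n (M : 'M[F]_n) : 'M[F]_n :=
  xget 0 [set S : 'M[F]_n | possemidefmx S /\ S *m S = M].

Definition norm2 n (x : 'cV[F]_n) : F := Num.sqrt (\sum_i x i 0 ^+ 2).

Definition opnorm m n (M : 'M[F]_(m, n)) : F :=
  sup [set norm2 (M *m x) | x in [set x : 'cV[F]_n | norm2 x <= 1]].

(* [eigenvalue] is about row eigenvectors; the spectrum is the same. *)
Definition spectral_radius n (M : 'M[F]_n) : F :=
  sup [set Normc.normc z | z in [set z : F[i] | eigenvalue (cmx M) z]].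

Definition stablemat n (M : 'M[F]_n) : Prop := spectral_radius M < 1.

(* Only meaningful for matrices with real spectrum, e.g. Hermitian ones. *)
Definition lambda_max n (M : 'M[F[i]]_n) : F :=
  sup [set x : F | eigenvalue M (real_complex F x)].

Definition expj (theta : F) : F[i] := Complex (cos theta) (sin theta).

End Matrices.

Section Design.
Variables (F : realType) (m d l n : nat).
Variables (A : 'M[F]_m) (B : 'M[F]_(m, d)) (C : 'M[F]_(l, m)).
Variables (D : 'M[F]_(m, n)) (R : 'M[F]_d) (gamma : F).

Definition stage_cost (K : 'M[F]_(d, m)) : 'M[F]_m :=
  C^T *m C + K^T *m R *m K.

Definition transfer (K : 'M[F]_(d, m)) (z : F[i]) : 'M[F[i]]_(m, n) :=
  cmx (sqrtmx (stage_cost K)) *m invmx (z%:M - cmx (A - B *m K)) *m cmx D.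

(* Extended-real supremum, so that an unbounded transfer function has norm
   +oo; the transpose is not conjugated, the conjugation being carried by the
   argument expj (- theta). *)
Definition hinf_norm (K : 'M[F]_(d, m)) : \bar F :=
  ereal_sup [set (Num.sqrt (lambda_max
      ((transfer K (expj (- theta)))^T *m transfer K (expj theta))))%:E
    | theta in [set theta : F | 0 <= theta < 2 * pi]].

Definition feasible : set 'M[F]_(d, m) :=
  [set K | spectral_radius (A - B *m K) < 1 /\ (hinf_norm K < gamma%:E)%E].

Definition tildeP (P : 'M[F]_m) : 'M[F]_m :=
  P + P *m D *m invmx ((gamma ^+ 2)%:M - D^T *m P *m D) *m D^T *m P.

Definition stabilizing_solution (K : 'M[F]_(d, m)) (P : 'M[F]_m) : Prop :=
  [/\ possemidefmx P,
      (A - B *m K)^T *m tildeP P *m (A - B *m K) + stage_cost K - P = 0,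
      posdefmx (1%:M - gamma ^- 2 *: (D^T *m P *m D)) &
      stablemat ((invmx (1%:M - gamma ^- 2 *: (P *m D *m D^T)))^T
                 *m (A - B *m K))].

(* The value 0 is a default, used only if there is no stabilizing solution. *)
Definition riccati (K : 'M[F]_(d, m)) : 'M[F]_m :=
  xget 0 [set P | stabilizing_solution K P].

Definition gain_weight (K : 'M[F]_(d, m)) : 'M[F]_d :=
  R + B^T *m tildeP (riccati K) *m B.

(* E_K: the gradient of the cost is 2 E_K times a positive semidefinite matrix. *)
Definition grad_factor (K : 'M[F]_(d, m)) : 'M[F]_(d, m) :=
  gain_weight K *m K - B^T *m tildeP (riccati K) *m A.

Definition cost (K : 'M[F]_(d, m)) : F :=
  - gamma ^+ 2 * ln (\det (1%:M - gamma ^- 2 *: (riccati K *m D *m D^T))).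

Definition npg_step (eta : F) (K : 'M[F]_(d, m)) : 'M[F]_(d, m) :=
  K - (2 * eta) *: grad_factor K.

Definition gn_step (eta : F) (K : 'M[F]_(d, m)) : 'M[F]_(d, m) :=
  K - (2 * eta) *: (invmx (gain_weight K) *m grad_factor K).

End Design.

Section Rates.
Variable F : realType.

Definition locally_linear (u : nat -> F) (u_opt : F) : Prop :=
  exists (n0 : nat) (rho : F), 0 < rho < 1 /\
    forall k : nat, (n0 <= k)%N -> u k.+1 - u_opt <= rho * (u k - u_opt).

Definition locally_quadratic (u : nat -> F) (u_opt : F) : Prop :=
  exists (n0 : nat) (c : F), 0 < c /\
    forall k : nat, (n0 <= k)%N -> u k.+1 - u_opt <= c * (u k - u_opt) ^+ 2.

End Rates.

(* Main.v *)
(* Let V = gamma^2 (D D^T)^-1, which exists because D D^T > 0. The Riccati map of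
   a gain K is P |-> A_K^T tp(P) A_K + C^T C + K^T R K with A_K = A - B K and
   tp(P) = V (V - P)^-1 V - V, which is increasing and convex on {P < V}.

   Bounded real lemma. Feasibility of K gives a frequency inequality on the unit
   circle; a discrete Fourier transform turns it into the bound
   sum x^T Q x <= (1 - e) sum w^T V w for trajectories x+ = A_K x + w from 0.
   Hence value iteration from 0 stays below (1 - e) V and converges. Doing this
   for Q + d I yields a strict supersolution; conversely a strict supersolution
   implies feasibility and the existence of the stabilizing solution.

   Iteration. Completing the square, both steps satisfy
   Ric_{K'}(P_K) + c E_K^T E_K <= P_K, and P_K + t X, with X a Lyapunov function of
   the closed loop, is a strict supersolution for K' when t is small: K' is
   feasible and P_{K'} + c E_K^T E_K <= P_K. So P_n decreases, E_n -> 0 and (K_n, P_n)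
   converges to a stationary pair whose closed loop L has spectral radius at most
   one. The conserved symplectic form of the game gives
   P* - P = L^T (P* - P) L* with L* stable, hence P = P*.

   Rates. By concavity of log det the cost gaps are comparable to traces. Near the
   optimum, linearizing tp gives tr(P_n - P* ) <= c |E_n|^2 (linear rate) and
   tr(P_{n+1} - P* ) <= c |K_{n+1} - K*|^2, while the Gauss-Newton step with eta = 1/2
   satisfies K_{n+1} - K* = F_n (P_n - P* ) L* with F_n bounded (quadratic rate). *)
Require Import Defs.
From HB Require Import structures.
From mathcomp Require Import all_boot all_order all_algebra.
From mathcomp Require Import complex.
From mathcomp Require Import all_classical all_reals all_analysis.
From mathcomp Require Import ring lra.
Import Order.TTheory GRing.Theory Num.Theory.
Import numFieldNormedType.Exports.
Local Open Scope classical_set_scope.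
Local Open Scope ring_scope.
Set Implicit Arguments.
Unset Strict Implicit.
Unset Printing Implicit Defensive.

(** * Quadratic forms *)

(** Feasibility is defined through frequencies, which does not suit an induction on gains;
    [feasibleP] trades it for a strict algebraic inequality that survives small changes. Strictness
    is the obstacle: the old value matrix is only a weak supersolution for the new gain, with slack
    only where the two gains act differently. A Lyapunov function of the old closed loop supplies
    slack in the other directions, and the slack [c |(K' - K) x|^2] pays for the change of closed
    loop. The other obstacle is the limit: stability is an open condition and may be lost there, so
    the limit is not known to be a stabilizing solution. The Stein equation between limit and
    optimum needs only one strictly stable loop, since a scalar can be moved from one factor to the
    other. Order relations are inequalities between quadratic forms at every vector, and stability
    is used through a form contracted at an explicit rate; both tolerate perturbations with explicit
    constants. The gains converge because each is a continuous function of value matrix and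
    gradient. *)

Section QuadraticForms.
Variable F : realType.

Definition dot n (x y : 'cV[F]_n) : F := (x^T *m y) 0 0.

Definition qf n (M : 'M[F]_n) (x : 'cV[F]_n) : F := dot x (M *m x).

(** Squared Frobenius norm: it dominates the squared operator norm ([dot_frob]) and is polynomial in
    the entries, so it passes to limits. *)
Definition frob m n (M : 'M[F]_(m, n)) : F := \sum_i \sum_j M i j ^+ 2.

Lemma dotE n (x y : 'cV[F]_n) : dot x y = \sum_i x i 0 * y i 0.
Proof. by rewrite /dot mxE; apply: eq_bigr => i _; rewrite mxE. Qed.

Lemma dotC n (x y : 'cV[F]_n) : dot x y = dot y x.
Proof. by rewrite !dotE; apply: eq_bigr => i _; rewrite mulrC. Qed.

Lemma dotDr n (x y z : 'cV[F]_n) : dot x (y + z) = dot x y + dot x z.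
Proof. by rewrite /dot mulmxDr mxE. Qed.

Lemma dotNr n (x y : 'cV[F]_n) : dot x (- y) = - dot x y.
Proof. by rewrite /dot mulmxN mxE. Qed.

Lemma dotZr n a (x y : 'cV[F]_n) : dot x (a *: y) = a * dot x y.
Proof. by rewrite /dot -scalemxAr mxE. Qed.

Lemma dot0r n (x : 'cV[F]_n) : dot x 0 = 0.
Proof. by rewrite /dot mulmx0 mxE. Qed.

Lemma dotDl n (x y z : 'cV[F]_n) : dot (x + y) z = dot x z + dot y z.
Proof. by rewrite dotC dotDr !(dotC z). Qed.

Lemma dotNl n (x y : 'cV[F]_n) : dot (- x) y = - dot x y.
Proof. by rewrite dotC dotNr dotC. Qed.

Lemma dotZl n a (x y : 'cV[F]_n) : dot (a *: x) y = a * dot x y.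
Proof. by rewrite dotC dotZr dotC. Qed.

Lemma dot0l n (x : 'cV[F]_n) : dot 0 x = 0.
Proof. by rewrite dotC dot0r. Qed.

Definition dotL := (dotDr, dotDl, dotNr, dotNl, dotZr, dotZl, dot0l, dot0r).

Lemma dot_mul m n (M : 'M[F]_(m, n)) x y : dot x (M *m y) = dot (M^T *m x) y.
Proof. by rewrite /dot trmx_mul trmxK mulmxA. Qed.

Lemma dot_sym n (M : 'M[F]_n) x y : M^T = M -> dot x (M *m y) = dot y (M *m x).
Proof. by move=> sM; rewrite dot_mul sM dotC. Qed.

Lemma dot_ge0 n (x : 'cV[F]_n) : 0 <= dot x x.
Proof. by rewrite dotE; apply: sumr_ge0 => i _; rewrite -expr2 sqr_ge0. Qed.

Lemma dot_eq0 n (x : 'cV[F]_n) : dot x x = 0 -> x = 0.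
Proof.
rewrite dotE => /eqP; rewrite psumr_eq0; last first.
  by move=> i _; rewrite -expr2 sqr_ge0.
move=> /allP x0; apply/matrixP => i j; rewrite (ord1 j) mxE.
by have := x0 i (mem_index_enum i); rewrite mulf_eq0 orbb => /eqP.
Qed.

Lemma dot_gt0 n (x : 'cV[F]_n) : x != 0 -> 0 < dot x x.
Proof.
move=> x0; rewrite lt_def dot_ge0 andbT.
by apply: contra_neq x0; exact: dot_eq0.
Qed.

Lemma qfE n (M : 'M[F]_n) x : (x^T *m M *m x) 0 0 = qf M x.
Proof. by rewrite /qf /dot mulmxA. Qed.

Lemma posdefP n (M : 'M[F]_n) :
  posdefmx M <-> M^T = M /\ forall x, x != 0 -> 0 < qf M x.
Proof. by split=> -[? H]; split => // x /H; rewrite qfE. Qed.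

Lemma possemidefP n (M : 'M[F]_n) :
  possemidefmx M <-> M^T = M /\ forall x, 0 <= qf M x.
Proof. by split=> -[? H]; split => // x; have := H x; rewrite qfE. Qed.

Lemma posdef_sym n (M : 'M[F]_n) : posdefmx M -> M^T = M.
Proof. by case. Qed.

Lemma possemidef_sym n (M : 'M[F]_n) : possemidefmx M -> M^T = M.
Proof. by case. Qed.

Lemma posdef_gt0 n (M : 'M[F]_n) x : posdefmx M -> x != 0 -> 0 < qf M x.
Proof. by move=> /posdefP[_]; apply. Qed.

Lemma possemidef_ge0 n (M : 'M[F]_n) x : possemidefmx M -> 0 <= qf M x.
Proof. by move=> /possemidefP[_]; apply. Qed.

Lemma qf0 n (M : 'M[F]_n) : qf M 0 = 0.
Proof. by rewrite /qf dot0l. Qed.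

Lemma qfD n (M N : 'M[F]_n) x : qf (M + N) x = qf M x + qf N x.
Proof. by rewrite /qf mulmxDl dotDr. Qed.

Lemma qfN n (M : 'M[F]_n) x : qf (- M) x = - qf M x.
Proof. by rewrite /qf mulNmx dotNr. Qed.

Lemma qfZ n a (M : 'M[F]_n) x : qf (a *: M) x = a * qf M x.
Proof. by rewrite /qf -scalemxAl dotZr. Qed.

Lemma qf0m n (x : 'cV[F]_n) : qf 0 x = 0.
Proof. by rewrite /qf mul0mx dot0r. Qed.

Lemma qf1 n (x : 'cV[F]_n) : qf 1%:M x = dot x x.
Proof. by rewrite /qf mul1mx. Qed.

Lemma qf_congr m n (M : 'M[F]_m) (T : 'M[F]_(m, n)) x :
  qf (T^T *m M *m T) x = qf M (T *m x).
Proof. by rewrite /qf -!mulmxA dot_mul trmxK. Qed.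

Lemma qf_gram m n (T : 'M[F]_(m, n)) x :
  qf (T^T *m T) x = dot (T *m x) (T *m x).
Proof. by rewrite -[T^T]mulmx1 qf_congr qf1. Qed.

Definition qfL := (qfD, qfN, qfZ, qf0m, qf1).

Lemma qfs n (M : 'M[F]_n) a x : qf M (a *: x) = a ^+ 2 * qf M x.
Proof. by rewrite /qf -scalemxAr !dotL mulrA. Qed.

Lemma qf_opp n (M : 'M[F]_n) x : qf M (- x) = qf M x.
Proof. by rewrite -scaleN1r qfs sqrrN expr1n mul1r. Qed.

Lemma qf_add n (M : 'M[F]_n) x y : M^T = M ->
  qf M (x + y) = qf M x + 2 * dot x (M *m y) + qf M y.
Proof.
by move=> sM; rewrite /qf mulmxDr !dotL (dot_sym y x sM); ring.
Qed.

Lemma qf_sub n (M : 'M[F]_n) x y : M^T = M ->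
  qf M (x - y) = qf M x - 2 * dot x (M *m y) + qf M y.
Proof.
by move=> sM; rewrite qf_add // qf_opp mulmxN dotNr; ring.
Qed.

Lemma possemidef_trsym m n (M : 'M[F]_m) (T : 'M[F]_(m, n)) :
  M^T = M -> (T^T *m M *m T)^T = T^T *m M *m T.
Proof. by move=> sM; rewrite !trmx_mul trmxK sM mulmxA. Qed.

(** Young's inequality with weight [b]: the form is nonnegative at [b *: x - y]. *)
Lemma qf_addle n (M : 'M[F]_n) b x y : possemidefmx M -> 0 < b ->
  qf M (x + y) <= (1 + b) * qf M x + (1 + b^-1) * qf M y.
Proof.
move=> pM b0; have sM := possemidef_sym pM.
have := possemidef_ge0 (b *: x - y) pM.
rewrite qf_sub // qfs dotZl qf_add // => H.
have {}H : 0 <= b^-1 * (b ^+ 2 * qf M x - 2 * (b * dot x (M *m y)) + qf M y).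
  by rewrite mulr_ge0 // invr_ge0 ltW.
have -> : (1 + b) * qf M x + (1 + b^-1) * qf M y
  = b^-1 * (b ^+ 2 * qf M x - 2 * (b * dot x (M *m y)) + qf M y)
    + (qf M x + 2 * dot x (M *m y) + qf M y).
  by field; rewrite gt_eqF.
lra.
Qed.

Lemma posdef_possemidef n (M : 'M[F]_n) : posdefmx M -> possemidefmx M.
Proof.
move=> pM; apply/possemidefP; split; first exact: posdef_sym.
move=> x; have [->|x0] := eqVneq x 0; first by rewrite qf0.
by apply/ltW/posdef_gt0.
Qed.

Lemma posdef_ge0 n (M : 'M[F]_n) x : posdefmx M -> 0 <= qf M x.
Proof. by move=> /posdef_possemidef /possemidef_ge0. Qed.

Lemma posdef1 n : posdefmx (1%:M : 'M[F]_n).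
Proof.
by apply/posdefP; rewrite trmx1; split => // x x0; rewrite qf1 dot_gt0.
Qed.

Lemma posdef_unit n (M : 'M[F]_n) : posdefmx M -> M \in unitmx.
Proof.
move=> pM; rewrite -row_free_unit -kermx_eq0; apply/eqP/row_matrixP => i.
rewrite row0; apply/eqP; apply: contraT => r0.
have h : (row i (kermx M))^T != 0 by rewrite trmx_eq0.
have := posdef_gt0 pM h.
by rewrite -qfE trmxK -row_mul mulmx_ker row0 mul0mx mxE ltxx.
Qed.

Lemma qf_invmx n (M : 'M[F]_n) x : posdefmx M ->
  qf (invmx M) x = qf M (invmx M *m x).
Proof.
move=> pM; rewrite /qf mulmxA mulmxV ?posdef_unit // mul1mx; exact: dotC.
Qed.

Lemma posdef_inv n (M : 'M[F]_n) : posdefmx M -> posdefmx (invmx M).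
Proof.
move=> pM; apply/posdefP; split; first by rewrite trmx_inv posdef_sym.
move=> x x0; rewrite qf_invmx //; apply: posdef_gt0 => //.
apply: contra_neq x0 => H.
by rewrite -[x]mul1mx -(mulmxV (posdef_unit pM)) -mulmxA H mulmx0.
Qed.

Lemma posdefD n (M N : 'M[F]_n) :
  posdefmx M -> possemidefmx N -> posdefmx (M + N).
Proof.
move=> pM pN; apply/posdefP; split.
  by rewrite linearD /= (posdef_sym pM) (possemidef_sym pN).
move=> x x0; rewrite qfD; apply: ltr_pwDl; first exact: posdef_gt0.
exact: possemidef_ge0.
Qed.

Lemma possemidefD n (M N : 'M[F]_n) :
  possemidefmx M -> possemidefmx N -> possemidefmx (M + N).
Proof.
move=> pM pN; apply/possemidefP; split.
  by rewrite linearD /= (possemidef_sym pM) (possemidef_sym pN).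
by move=> x; rewrite qfD addr_ge0 // possemidef_ge0.
Qed.

Lemma possemidefZ n a (M : 'M[F]_n) : 0 <= a ->
  possemidefmx M -> possemidefmx (a *: M).
Proof.
move=> a0 pM; apply/possemidefP; split; first by rewrite linearZ /= possemidef_sym.
by move=> x; rewrite qfZ mulr_ge0 // possemidef_ge0.
Qed.

Lemma posdefZ n a (M : 'M[F]_n) : 0 < a -> posdefmx M -> posdefmx (a *: M).
Proof.
move=> a0 pM; apply/posdefP; split; first by rewrite linearZ /= posdef_sym.
by move=> x x0; rewrite qfZ mulr_gt0 // posdef_gt0.
Qed.

Lemma possemidef_congr m n (M : 'M[F]_m) (T : 'M[F]_(m, n)) :
  possemidefmx M -> possemidefmx (T^T *m M *m T).
Proof.
move=> pM; apply/possemidefP; split.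
  exact/possemidef_trsym/possemidef_sym.
by move=> x; rewrite qf_congr possemidef_ge0.
Qed.

Lemma possemidef_gram m n (T : 'M[F]_(m, n)) : possemidefmx (T^T *m T).
Proof.
by rewrite -[T^T]mulmx1; apply/possemidef_congr/posdef_possemidef/posdef1.
Qed.

Lemma frob_ge0 m n (M : 'M[F]_(m, n)) : 0 <= frob M.
Proof. by apply: sumr_ge0 => i _; apply: sumr_ge0 => j _; rewrite sqr_ge0. Qed.

Lemma cauchy_schwarz n (x y : 'cV[F]_n) : dot x y ^+ 2 <= dot x x * dot y y.
Proof.
have [->|y0] := eqVneq y 0; first by rewrite !dotL expr0n /= mulr0.
have yy := dot_gt0 y0.
have := dot_ge0 (dot y y *: x - dot x y *: y).
rewrite !dotL (dotC y x) => H.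
have {}H : 0 <= dot y y * (dot x x * dot y y - dot x y ^+ 2).
  by apply: le_trans H _; rewrite le_eqVlt; apply/orP; left; apply/eqP; ring.
by rewrite pmulr_rge0 // subr_ge0 in H.
Qed.

Lemma dot_frob m n (M : 'M[F]_(m, n)) x :
  dot (M *m x) (M *m x) <= frob M * dot x x.
Proof.
rewrite [leLHS]dotE /frob mulr_suml; apply: ler_sum => i _.
have -> : \sum_j M i j ^+ 2 = dot (row i M)^T (row i M)^T.
  by rewrite dotE; apply: eq_bigr => j _; rewrite !mxE expr2.
have -> : (M *m x) i 0 = dot (row i M)^T x.
  by rewrite dotE mxE; apply: eq_bigr => j _; rewrite !mxE.
by rewrite -expr2 cauchy_schwarz.
Qed.

(** Nonnegativity of [|x - M x|^2]. The factor [1 + frob M] needs no square root and is positive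
    even for [M = 0], so it can serve as a divisor. *)
Lemma qf_frob n (M : 'M[F]_n) x : qf M x <= (1 + frob M) * dot x x.
Proof.
have := dot_ge0 (x - M *m x); rewrite !dotL (dotC (M *m x) x) -/(qf M x).
have := dot_frob M x; have := dot_ge0 x; have := dot_ge0 (M *m x); nra.
Qed.

(** With [c] an upper bound of the inverse form, nonnegativity at [x - c^-1 *: (invmx M *m x)]
    yields the explicit constant [c^-1]. *)
Lemma posdef_lb n (M : 'M[F]_n) : posdefmx M ->
  exists2 c : F, 0 < c & forall x, c * dot x x <= qf M x.
Proof.
move=> pM; set c := 1 + frob (invmx M).
have c0 : 0 < c by rewrite ltr_wpDr ?frob_ge0.
exists c^-1; first by rewrite invr_gt0.
move=> x; have := posdef_ge0 (x - c^-1 *: (invmx M *m x)) pM.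
rewrite qf_sub ?(posdef_sym pM) // qfs -(qf_invmx _ pM) -scalemxAr mulmxA.
rewrite mulmxV ?posdef_unit // mul1mx dotZr.
have := qf_frob (invmx M) x; rewrite -/c.
set q := qf _ x; set d := dot x x; set e := qf M x => h1 h2.
have : c^-1 ^+ 2 * q <= c^-1 * d.
  have -> : c^-1 * d = c^-1 ^+ 2 * (c * d) by field; rewrite gt_eqF.
  by rewrite ler_wpM2l // sqr_ge0.
lra.
Qed.

Lemma qf_lb_posdef n (M : 'M[F]_n) c : M^T = M -> 0 < c ->
  (forall x, c * dot x x <= qf M x) -> posdefmx M.
Proof.
move=> sM c0 h; apply/posdefP; split => // x x0.
by rewrite (lt_le_trans _ (h x)) // mulr_gt0 // dot_gt0.
Qed.

Lemma posdef_compare m n (M : 'M[F]_n) (N : 'M[F]_m) (T : 'M[F]_(m, n)) :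
  posdefmx M -> exists2 c : F, 0 < c & forall x, qf N (T *m x) <= c * qf M x.
Proof.
move=> /posdef_lb[c c0 hc]; set a := 1 + frob N; set b := 1 + frob T.
have a0 : 0 < a by rewrite ltr_wpDr ?frob_ge0.
have b0 : 0 < b by rewrite ltr_wpDr ?frob_ge0.
exists (a * b / c); first by rewrite divr_gt0 // mulr_gt0.
move=> x; rewrite (le_trans (qf_frob _ _)) // -/a -!mulrA ler_pM2l //.
have h : dot (T *m x) (T *m x) <= b * dot x x.
  by rewrite (le_trans (dot_frob _ _)) // ler_wpM2r ?dot_ge0 // lerDr.
by rewrite (le_trans h) // ler_pM2l // mulrC ler_pdivlMr // mulrC.
Qed.

End QuadraticForms.

Arguments posdef_ge0 {F n M} x.
Arguments possemidef_ge0 {F n M} x.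
Arguments posdef_gt0 {F n M x}.

(** * Entrywise convergence of matrices *)

Section Convergence.
Variable F : realType.

Lemma cvg_bigsum I (r : seq I) (P : pred I) (f : I -> nat -> F) (a : I -> F) :
  (forall i, P i -> f i @ \oo --> a i) ->
  (fun k => \sum_(i <- r | P i) f i k) @ \oo --> \sum_(i <- r | P i) a i.
Proof.
move=> h; elim: r => [|i r IH].
  rewrite big_nil; under eq_fun do rewrite big_nil; exact: cvg_cst.
rewrite big_cons; under eq_fun do rewrite big_cons.
by case: ifP => // Pi; apply: cvgD => //; apply: h.
Qed.

Lemma cvg_bigprod I (r : seq I) (f : I -> nat -> F) (a : I -> F) :
  (forall i, f i @ \oo --> a i) ->
  (fun k => \prod_(i <- r) f i k) @ \oo --> \prod_(i <- r) a i.
Proof.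
move=> h; elim: r => [|i r IH].
  rewrite big_nil; under eq_fun do rewrite big_nil; exact: cvg_cst.
by rewrite big_cons; under eq_fun do rewrite big_cons; apply: cvgM.
Qed.

Lemma cvg_le (u v : nat -> F) a b :
  u @ \oo --> a -> v @ \oo --> b -> (forall k, u k <= v k) -> a <= b.
Proof. by move=> ua vb h; apply: ler_cvg_to ua vb _; apply: nearW. Qed.

Lemma cvg_squeeze0 (u v : nat -> F) : (forall k, 0 <= u k <= v k) ->
  v @ \oo --> 0 -> u @ \oo --> 0.
Proof.
by move=> h v0; apply: (squeeze_cvgr _ (cvg_cst 0) v0); apply: nearW.
Qed.

Lemma cvg_sqr0 (u : nat -> F) : (fun k => u k ^+ 2) @ \oo --> 0 -> u @ \oo --> 0.
Proof.
move=> /cvgrPdist_lt h; apply/cvgrPdist_lt => e e0.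
near=> k; have : `|0 - u k ^+ 2| < e ^+ 2 by near: k; apply: h; rewrite exprn_gt0.
by rewrite !sub0r !normrN normrX ltr_pXn2r // nnegrE ?ltW.
Unshelve. all: by end_near. Qed.

Lemma cvg_contract (a b : nat -> F) r : 0 <= r < 1 ->
  (forall k, 0 <= a k) -> (forall k, a k.+1 <= r * a k + b k) ->
  b @ \oo --> 0 -> a @ \oo --> 0.
Proof.
move=> /andP[r0 r1] a0 ab /cvgrPdist_lt b0; apply/cvgrPdist_lt => e e0.
(* Once [b] is below this value, [e / 2] is invariant under the recursion:
   [r * (e / 2) + (1 - r) * (e / 2) = e / 2]. *)
have d0 : 0 < (1 - r) * (e / 2) by rewrite mulr_gt0 ?divr_gt0 // subr_gt0.
have [N _ hN] := b0 _ d0.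
have key k : a (N + k)%N <= r ^+ k * a N + e / 2.
  elim: k => [|k IH]; first by rewrite addn0 expr0 mul1r lerDl ltW // divr_gt0.
  have hb : b (N + k)%N <= (1 - r) * (e / 2).
    have := hN (N + k)%N (leq_addr _ _); rewrite /= sub0r normrN => /ltW.
    exact/le_trans/ler_norm.
  have := ler_wpM2l r0 IH; have := ab (N + k)%N; rewrite addnS exprS.
  set x := r ^+ k; lra.
have h : (fun k => r ^+ k * a N) @ \oo --> 0.
  rewrite -[X in _ --> X](mul0r (a N)); apply: cvgMl; apply: cvg_expr.
  by rewrite ger0_norm.
move/cvgrPdist_lt: h => /(_ (e / 2)) [|M _ hM]; first by rewrite divr_gt0.
exists (N + M)%N => // k /= NMk.
have Nk : (N <= k)%N by rewrite (leq_trans _ NMk) ?leq_addr.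
have := hM (k - N)%N; rewrite /= leq_subRL // => /(_ NMk).
rewrite sub0r normrN => /(le_lt_trans (ler_norm _)) => h.
have := key (k - N)%N; rewrite subnKC // => h'.
rewrite sub0r normrN ger0_norm //; lra.
Qed.

(** Entrywise limits reduce products, determinants and inverses to limits in [F]; [mcvg_cvg] gives
    back convergence in the matrix topology. *)
Definition mcvg m n (U : nat -> 'M[F]_(m, n)) (L : 'M[F]_(m, n)) : Prop :=
  forall i j, (fun k => U k i j) @ \oo --> L i j.

Lemma mcvg_cst m n (L : 'M[F]_(m, n)) : mcvg (fun=> L) L.
Proof. by move=> i j; apply: cvg_cst. Qed.

Lemma mcvg_ext m n (U U' : nat -> 'M[F]_(m, n)) L :
  U =1 U' -> mcvg U L -> mcvg U' L.
Proof. by move=> /funext ->. Qed.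

Lemma mcvg_uniq m n (U : nat -> 'M[F]_(m, n)) L L' :
  mcvg U L -> mcvg U L' -> L = L'.
Proof.
by move=> h h'; apply/matrixP => i j; apply: cvg_unique (h i j) (h' i j).
Qed.

Lemma mcvgD m n (U U' : nat -> 'M[F]_(m, n)) L L' :
  mcvg U L -> mcvg U' L' -> mcvg (fun k => U k + U' k) (L + L').
Proof.
by move=> h h' i j; rewrite mxE; under eq_fun do rewrite mxE; apply: cvgD.
Qed.

Lemma mcvgN m n (U : nat -> 'M[F]_(m, n)) L :
  mcvg U L -> mcvg (fun k => - U k) (- L).
Proof.
by move=> h i j; rewrite mxE; under eq_fun do rewrite mxE; apply: cvgN.
Qed.

Lemma mcvgB m n (U U' : nat -> 'M[F]_(m, n)) L L' :
  mcvg U L -> mcvg U' L' -> mcvg (fun k => U k - U' k) (L - L').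
Proof. by move=> h h'; apply/mcvgD => //; apply: mcvgN. Qed.

Lemma mcvgT m n (U : nat -> 'M[F]_(m, n)) L :
  mcvg U L -> mcvg (fun k => (U k)^T) L^T.
Proof. by move=> h i j; rewrite mxE; under eq_fun do rewrite mxE; apply: h. Qed.

Lemma mcvgM m n p (U : nat -> 'M[F]_(m, n)) (U' : nat -> 'M[F]_(n, p)) L L' :
  mcvg U L -> mcvg U' L' -> mcvg (fun k => U k *m U' k) (L *m L').
Proof.
move=> h h' i j; rewrite mxE; under eq_fun do rewrite mxE.
by apply: cvg_bigsum => l _; apply: cvgM.
Qed.

Lemma mcvgZ m n (a : nat -> F) (b : F) (U : nat -> 'M[F]_(m, n)) L :
  a @ \oo --> b -> mcvg U L -> mcvg (fun k => a k *: U k) (b *: L).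
Proof.
by move=> h h' i j; rewrite mxE; under eq_fun do rewrite mxE; apply: cvgM.
Qed.

Lemma mcvg_det n (U : nat -> 'M[F]_n) L :
  mcvg U L -> (fun k => \det (U k)) @ \oo --> \det L.
Proof.
move=> h; rewrite /determinant; apply: cvg_bigsum => s _.
by apply: cvgM; [exact: cvg_cst|exact: cvg_bigprod].
Qed.

Lemma mcvg_adj n (U : nat -> 'M[F]_n) L :
  mcvg U L -> mcvg (fun k => \adj (U k)) (\adj L).
Proof.
move=> h i j; rewrite mxE; under eq_fun do rewrite mxE.
rewrite /cofactor; apply: cvgM; first exact: cvg_cst.
by apply: mcvg_det => a b; rewrite !mxE; under eq_fun do rewrite !mxE; apply: h.
Qed.

(** Cramer's rule, rational in the entries. Every term is required to be a unit, since [invmx]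
    returns its argument at a singular matrix. *)
Lemma mcvg_inv n (U : nat -> 'M[F]_n) L : L \in unitmx ->
  (forall k, U k \in unitmx) -> mcvg U L ->
  mcvg (fun k => invmx (U k)) (invmx L).
Proof.
move=> uL uU h; apply: (@mcvg_ext _ _ (fun k => (\det (U k))^-1 *: \adj (U k))).
  by move=> k; rewrite /invmx uU.
rewrite /invmx uL; apply: mcvgZ; last exact: mcvg_adj.
by apply: cvgV; [rewrite -unitfE -unitmxE|exact: mcvg_det].
Qed.

Lemma mcvg_dot n (U U' : nat -> 'cV[F]_n) L L' : mcvg U L -> mcvg U' L' ->
  (fun k => dot (U k) (U' k)) @ \oo --> dot L L'.
Proof. by move=> h h'; apply: mcvgM => //; apply: mcvgT. Qed.

Lemma mcvg_qf n (U : nat -> 'M[F]_n) L x : mcvg U L ->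
  (fun k => qf (U k) x) @ \oo --> qf L x.
Proof.
move=> h; apply: mcvg_dot; first exact: mcvg_cst.
by apply: mcvgM => //; apply: mcvg_cst.
Qed.

Lemma mcvg_shift m n (U : nat -> 'M[F]_(m, n)) L :
  mcvg U L -> mcvg (fun k => U k.+1) L.
Proof. by move=> h i j; have := h i j; rewrite -cvg_shiftS. Qed.

Lemma mcvg_frob m n (U : nat -> 'M[F]_(m, n)) L :
  mcvg U L -> (fun k => frob (U k)) @ \oo --> frob L.
Proof.
move=> h; rewrite /frob; apply: cvg_bigsum => i _; apply: cvg_bigsum => j _.
by rewrite expr2; under eq_fun do rewrite expr2; apply: cvgM.
Qed.

Lemma mcvg_frob0 m n (U : nat -> 'M[F]_(m, n)) L :
  mcvg U L -> (fun k => frob (U k - L)) @ \oo --> 0.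
Proof.
have -> : 0 = frob (0 : 'M[F]_(m, n)).
  by rewrite /frob big1 // => i _; rewrite big1 // => j _; rewrite mxE expr0n.
by rewrite -(subrr L) => h; apply: mcvg_frob; apply: mcvgB => //; apply: mcvg_cst.
Qed.

Lemma mcvg_sym n (U : nat -> 'M[F]_n) L :
  mcvg U L -> (forall k, (U k)^T = U k) -> L^T = L.
Proof.
move=> h sU; apply: (mcvg_uniq (U := U)) => //.
by apply: mcvg_ext (mcvgT h).
Qed.

Lemma mcvg_cvg m n (U : nat -> 'M[F]_(m, n)) L : mcvg U L -> U @ \oo --> L.
Proof.
move=> h; apply/cvg_ballP => e e0.
have : \forall k \near \oo, forall i j, ball (L i j) e (U k i j).
  apply: filter_forall => i; apply: filter_forall => j.
  by move/cvg_ballP: (h i j); apply.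
by apply: filterS => k hk; split.
Qed.

Lemma qf_delta2 n (M : 'M[F]_n) i j : M^T = M ->
  M i j = (qf M (delta_mx i 0 + delta_mx j 0)
           - qf M (delta_mx i 0) - qf M (delta_mx j 0)) / 2.
Proof.
move=> sM; rewrite qf_add //.
have -> : dot (delta_mx i 0) (M *m delta_mx j 0) = M i j.
  by rewrite /dot trmx_delta -rowE -colE !mxE.
by field.
Qed.

Lemma qf_cvg_mcvg n (U : nat -> 'M[F]_n) (f : 'cV[F]_n -> F) :
  (forall k, (U k)^T = U k) ->
  (forall x, (fun k => qf (U k) x) @ \oo --> f x) -> exists L, mcvg U L.
Proof.
move=> sU h; exists (\matrix_(i, j)
  ((f (delta_mx i 0 + delta_mx j 0) - f (delta_mx i 0) - f (delta_mx j 0)) / 2)).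
move=> i j; rewrite mxE; under eq_fun do rewrite (qf_delta2 _ _ (sU _)).
by apply: cvgMl; apply: cvgB => //; apply: cvgB.
Qed.

(** Each [qf (U k) x] is monotone and bounded, hence converges; polarisation ([qf_delta2]) turns
    this into convergence of the entries. *)
Lemma mcvg_nondecreasing n (U : nat -> 'M[F]_n) (M : 'M[F]_n) :
  (forall k, (U k)^T = U k) ->
  (forall k x, qf (U k) x <= qf (U k.+1) x) ->
  (forall k x, qf (U k) x <= qf M x) ->
  exists L, [/\ mcvg U L, L^T = L,
     forall k x, qf (U k) x <= qf L x & forall x, qf L x <= qf M x].
Proof.
move=> sU incU leU.
have homo x : {homo (fun k => qf (U k) x) : a b / (a <= b)%N >-> a <= b}.
  by apply: homo_leq => [y|a b c|k]; [exact: lexx|exact: le_trans|exact: incU].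
have cv x : cvgn (fun k => qf (U k) x).
  apply: nondecreasing_is_cvgn => //.
  by exists (qf M x) => _ [k _ <-].
have [L hL] : exists L, mcvg U L.
  by apply: (@qf_cvg_mcvg _ _ (fun x => limn (fun k => qf (U k) x))).
exists L; split => //; first exact: mcvg_sym hL sU.
- move=> k x; have <- : limn (fun k => qf (U k) x) = qf L x.
    by apply/cvg_lim => //; apply: mcvg_qf.
  exact: nondecreasing_cvgn_le.
- move=> x; apply: (@cvg_le (fun k => qf (U k) x) (fun=> qf M x)) => //.
    exact: mcvg_qf.
  exact: cvg_cst.
Qed.

Lemma mcvg_nonincreasing n (U : nat -> 'M[F]_n) (M : 'M[F]_n) :
  (forall k, (U k)^T = U k) ->
  (forall k x, qf (U k.+1) x <= qf (U k) x) ->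
  (forall k x, qf M x <= qf (U k) x) ->
  exists L, [/\ mcvg U L, L^T = L,
     forall k x, qf L x <= qf (U k) x & forall x, qf M x <= qf L x].
Proof.
move=> sU decU geU.
have [||k x|L [hL sL h1 h2]] := @mcvg_nondecreasing _ (fun k => - U k) (- M).
- by move=> k; rewrite linearN /= sU.
- by move=> k x; rewrite !qfN lerN2.
- by rewrite !qfN lerN2.
exists (- L); split.
- by apply: mcvg_ext (mcvgN hL) => k; rewrite opprK.
- by rewrite linearN /= sL.
- by move=> k x; have := h1 k x; rewrite !qfN lerNl.
- by move=> x; have := h2 x; rewrite !qfN lerNr.
Qed.

End Convergence.

(** * Stability and Lyapunov functions *)

Section Stability.
Variable F : realType.
Local Notation C := F[i].
Local Notation normc := (@Normc.normc F).
Local Notation CRe := (@complex.Re F).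
Local Notation CIm := (@complex.Im F).

Definition stab n (M : 'M[F]_n) : Prop :=
  forall z, eigenvalue (cmx M) z -> normc z < 1.

Lemma normc_ge0 (z : C) : 0 <= normc z.
Proof. by case: z => a b /=; exact: sqrtr_ge0. Qed.

Lemma normc_sqr (z : C) : normc z ^+ 2 = CRe z ^+ 2 + CIm z ^+ 2.
Proof. by case: z => a b /=; rewrite sqr_sqrtr // addr_ge0 ?sqr_ge0. Qed.

Lemma normc_real (a : F) : normc (real_complex F a) = `|a|.
Proof. by rewrite /= expr0n /= addr0 sqrtr_sqr. Qed.

Lemma roots_char_poly n (M : 'M[C]_n) :
  {r : seq C | char_poly M = \prod_(z <- r) ('X - z%:P)}.
Proof.
have [r ->] := closed_field_poly_normal (char_poly M).
by exists r; rewrite (monicP (char_poly_monic M)) scale1r.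
Qed.

Lemma eigenvalue_roots n (M : 'M[C]_n) r z :
  char_poly M = \prod_(z <- r) ('X - z%:P) -> eigenvalue M z = (z \in r).
Proof. by move=> Mr; rewrite eigenvalue_root_char Mr root_prod_XsubC. Qed.

(** The spectrum is finite, so the supremum stays below 1 when all moduli do; for an empty spectrum
    [sup] returns 0. *)
Lemma spectral_radius_lt1 n (M : 'M[F]_n) : spectral_radius M < 1 <-> stab M.
Proof.
have [r Mr] := roots_char_poly (cmx M).
set E := [set normc z | z in [set z : C | eigenvalue (cmx M) z]].
pose b := \big[Num.max/0]_(z <- r) normc z.
have ubE x : E x -> x <= b.
  move=> [z /= zE <-]; rewrite (eigenvalue_roots _ Mr) in zE.
  exact: le_bigmax_seq.
split=> [h z zE|h].
  apply: le_lt_trans h; apply: ub_le_sup; last by exists z.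
  by exists b => x /ubE.
have b1 : b < 1.
  rewrite /b big_seq; apply: bigmax_lt => // z zr.
  by apply: h; rewrite (eigenvalue_roots _ Mr).
have [E0|nE] := pselect (E !=set0).
  by apply: le_lt_trans b1; apply: ge_sup => // x /ubE.
rewrite /spectral_radius -/E; have -> : E = set0.
  by apply/seteqP; split => // x Ex; case: nE; exists x.
by rewrite sup0.
Qed.

Lemma real_cplx_mulmx n p q (A : 'M[F]_(n, p)) (B : 'M[F]_(p, q)) :
  cmx (A *m B) = cmx A *m cmx B.
Proof. exact: map_mxM. Qed.

Definition czero n (u : nat -> 'cV[C]_n) : Prop :=
  forall i, (fun k => normc (u k i 0)) @ \oo --> (0 : F).

Lemma czero_eigen n (u v : nat -> 'cV[C]_n) z : normc z < 1 ->
  (forall k, u k.+1 = z *: u k + v k) -> czero v -> czero u.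
Proof.
move=> z1 uv v0 i; apply: (@cvg_contract _ _ (fun k => normc (v k i 0)) (normc z)) => //.
- by rewrite normc_ge0.
- by move=> k; apply: normc_ge0.
- by move=> k; rewrite uv !mxE (le_trans (le_normcD _ _)) // lerD2r Normc.normcM.
Qed.

(** One linear factor is removed at a time: the orbit [u] of [x] satisfies
    [u k.+1 = z *: u k + v k], where [v] is the orbit of [(M - z) x], which the remaining factors
    annihilate. Cayley-Hamilton then covers every [x]. *)
Lemma czero_orbit n (M : 'M[C]_n.+1) (r : seq C) (x : 'cV[C]_n.+1) :
  {in r, forall z, normc z < 1} ->
  horner_mx M (\prod_(z <- r) ('X - z%:P)) *m x = 0 ->
  czero (fun k => iter k (mulmx M) x).
Proof.
elim: r x => [|z r IH] x hr.
  rewrite big_nil rmorph1 mul1mx => -> i.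
  have e k : iter k (mulmx M) (0 : 'cV[C]_n.+1) = 0.
    by elim: k => //= k ->; rewrite mulmx0.
  under eq_fun do rewrite e mxE Normc.normc0; exact: cvg_cst.
rewrite big_cons mulrC rmorphM rmorphB /= horner_mx_X horner_mx_C -mulmxA => h.
have hr' : {in r, forall z, normc z < 1}.
  by move=> y yr; apply: hr; rewrite inE yr orbT.
have z1 : normc z < 1 by apply: hr; rewrite mem_head.
apply: (czero_eigen z1) (IH _ hr' h) => k.
have -> : iter k (mulmx M) ((M - z%:M) *m x)
          = iter k.+1 (mulmx M) x - z *: iter k (mulmx M) x.
  elim: k => [|k IHk]; first by rewrite mulmxBl mul_scalar_mx.
  by rewrite iterS IHk mulmxBr -scalemxAr.
by rewrite addrC subrK.
Qed.

Lemma stab_orbit n (M : 'M[F]_n) (x : 'cV[F]_n) : stab M ->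
  mcvg (fun k => iter k (mulmx M) x) 0.
Proof.
case: n M x => [|n] M x sM i j; first by case: i.
have [r Mr] := roots_char_poly (cmx M).
have h : czero (fun k => iter k (mulmx (cmx M)) (cmx x)).
  apply: (@czero_orbit _ _ r).
    by move=> z zr; apply: sM; rewrite (eigenvalue_roots _ Mr).
  by rewrite -Mr Cayley_Hamilton mul0mx.
have := h i; rewrite mxE (ord1 j).
have e k : iter k (mulmx (cmx M)) (cmx x) = cmx (iter k (mulmx M) x).
  by elim: k => //= k ->; rewrite real_cplx_mulmx.
under eq_fun do rewrite e mxE normc_real.
by move/norm_cvg0P.
Qed.

Definition lyap n (M X : 'M[F]_n) (k : F) : Prop :=
  [/\ posdefmx X, 0 < k <= 1 & forall x, qf X (M *m x) <= (1 - k) * qf X x].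

(** A finite sum suffices: with [X] the sum of [(M^t)^T M^t] over [t <= N], one step changes
    [qf X x] by [|M^(N+1) x|^2 - |x|^2]. [N] makes the first term at most half the second, and
    [X <= c] turns the loss into the rate [1 / (2 c)]. *)
Lemma stab_lyap n (M : 'M[F]_n) : stab M -> exists X k, lyap M X k.
Proof.
move=> sM; pose pw k := iter k (mulmx M) (1%:M : 'M[F]_n).
have pwx k x : iter k (mulmx M) x = pw k *m x :> 'cV[F]_n.
  by elim: k => [|k IH]; rewrite /pw /= ?mul1mx // IH mulmxA.
have pwS k x : pw k.+1 *m x = pw k *m (M *m x) :> 'cV[F]_n.
  by rewrite -!pwx iterSr.
have pw0 : mcvg pw 0.
  move=> i j; have := @stab_orbit _ M (delta_mx j 0) sM; move=> /(_ i 0).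
  by rewrite !mxE; under eq_fun do rewrite pwx -colE mxE.
have : (fun k => frob (pw k)) @ \oo --> frob (0 : 'M[F]_n) by apply: mcvg_frob.
have -> : frob (0 : 'M[F]_n) = 0.
  by rewrite /frob big1 // => i _; rewrite big1 // => j _; rewrite mxE expr0n.
move=> /cvgr_lt /(_ (1 / 2)) [|N _ hN]; first by rewrite divr_gt0.
have {hN} hN : frob (pw N.+1) < 1 / 2 by apply: hN => /=.
pose X := \sum_(t < N.+1) (pw t)^T *m pw t.
have qX x : qf X x = \sum_(t < N.+1) dot (pw t *m x) (pw t *m x).
  rewrite /X; elim/big_ind2: _ => [|A a B b <- <-|t _].
  - exact: qf0m.
  - exact: qfD.
  - exact: qf_gram.
have sX : X^T = X.
  by rewrite linear_sum; apply: eq_bigr => t _; rewrite /= trmx_mul trmxK.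
have X1 x : dot x x <= qf X x.
  rewrite qX big_ord_recl /= /pw /= mul1mx lerDl sumr_ge0 // => t _.
  exact: dot_ge0.
pose c := 1 + frob X.
have c0 : 1 <= c by rewrite lerDl frob_ge0.
have c1 : 0 < c by rewrite (lt_le_trans _ c0).
exists X, (2 * c)^-1; split.
- by apply: (@qf_lb_posdef _ _ _ 1) => // x; rewrite mul1r.
- rewrite invr_gt0 mulr_gt0 //= invf_le1 ?mulr_gt0 //; lra.
move=> x.
have e : qf X (M *m x) = qf X x - dot x x
         + dot (pw N.+1 *m x) (pw N.+1 *m x).
  rewrite !qX big_ord_recr [in RHS]big_ord_recl /= pwS.
  rewrite {3 4}/pw /= mul1mx [X in _ = X - _ + _]addrC addrK; congr (_ + _).
  by apply: eq_bigr => t _; rewrite pwS.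
have h1 : dot (pw N.+1 *m x) (pw N.+1 *m x) <= 1 / 2 * dot x x.
  by rewrite (le_trans (dot_frob _ _)) // ler_wpM2r ?dot_ge0 // ltW.
have h2 : (2 * c)^-1 * qf X x <= 1 / 2 * dot x x.
  have -> : 1 / 2 * dot x x = (2 * c)^-1 * (c * dot x x).
    by field; rewrite gt_eqF.
  by rewrite ler_wpM2l ?invr_ge0 ?mulr_ge0 ?(ltW c1) // qf_frob.
rewrite e; lra.
Qed.

Lemma Re_sum I (r : seq I) (f : I -> C) :
  CRe (\sum_(i <- r) f i) = \sum_(i <- r) CRe (f i).
Proof. by apply: big_morph => // -[a b] [c d]. Qed.

Lemma Im_sum I (r : seq I) (f : I -> C) :
  CIm (\sum_(i <- r) f i) = \sum_(i <- r) CIm (f i).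
Proof. by apply: big_morph => // -[a b] [c d]. Qed.

Lemma Re_cmx_mul n p (M : 'M[F]_(n, p)) (v : 'cV[C]_p) :
  map_mx CRe (cmx M *m v) = M *m map_mx CRe v.
Proof.
apply/matrixP => i j; rewrite !mxE Re_sum; apply: eq_bigr => k _.
by rewrite !mxE; case: (v k j) => a b /=; rewrite mul0r subr0.
Qed.

Lemma Im_cmx_mul n p (M : 'M[F]_(n, p)) (v : 'cV[C]_p) :
  map_mx CIm (cmx M *m v) = M *m map_mx CIm v.
Proof.
apply/matrixP => i j; rewrite !mxE Im_sum; apply: eq_bigr => k _.
by rewrite !mxE; case: (v k j) => a b /=; rewrite mul0r addr0.
Qed.

Lemma Re_scale n (z : C) (v : 'cV[C]_n) :
  map_mx CRe (z *: v) = CRe z *: map_mx CRe v - CIm z *: map_mx CIm v.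
Proof. by apply/matrixP => i j; rewrite !mxE; case: z; case: (v i j). Qed.

Lemma Im_scale n (z : C) (v : 'cV[C]_n) :
  map_mx CIm (z *: v) = CIm z *: map_mx CRe v + CRe z *: map_mx CIm v.
Proof.
by apply/matrixP => i j; rewrite !mxE; case: z; case: (v i j) => * /=; rewrite addrC.
Qed.

Lemma eigenvalue_tr (K : fieldType) n (M : 'M[K]_n) z :
  eigenvalue M^T z = eigenvalue M z.
Proof.
rewrite !eigenvalue_root_char; congr (root _ _).
rewrite /char_poly -det_tr; congr (\det _); apply/matrixP => i j.
by rewrite !mxE eq_sym.
Qed.

Lemma eigenvalue_real n (M : 'M[F]_n) (z : C) : eigenvalue (cmx M) z ->
  exists a b : 'cV[F]_n, [/\ 0 < dot a a + dot b b,
    M *m a = CRe z *: a - CIm z *: b & M *m b = CIm z *: a + CRe z *: b].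
Proof.
rewrite -eigenvalue_tr => /eigenvalueP[v vM v0].
have e : cmx M *m v^T = z *: v^T.
  by rewrite -[cmx M]trmxK -trmx_mul vM linearZ.
exists (map_mx CRe v^T), (map_mx CIm v^T); split; last 2 first.
- by rewrite -Re_cmx_mul e Re_scale.
- by rewrite -Im_cmx_mul e Im_scale.
rewrite lt_def addr_ge0 ?dot_ge0 // andbT paddr_eq0 ?dot_ge0 //.
apply: contra_neqN v0 => /andP[/eqP/dot_eq0 a0 /eqP/dot_eq0 b0].
apply/matrixP => i j; have := congr1 (fun w : 'cV[F]_n => w j 0) a0.
have := congr1 (fun w : 'cV[F]_n => w j 0) b0; rewrite !mxE (ord1 i).
by case: (v 0 j) => a b /= -> ->.
Qed.

Lemma qf_rot n (X : 'M[F]_n) (c s : F) a b :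
  qf X (c *: a - s *: b) + qf X (s *: a + c *: b)
  = (c ^+ 2 + s ^+ 2) * (qf X a + qf X b).
Proof. by rewrite /qf mulmxBr mulmxDr -!scalemxAr !dotL; ring. Qed.

(** Summed over the real and imaginary parts of an eigenvector, [qf_rot] turns the hypothesis into
    [|z|^2 q + d |v|^2 <= q], impossible for [|z| >= 1]. *)
Lemma lyap_stab n (X M : 'M[F]_n) d : possemidefmx X -> 0 < d ->
  (forall x, qf X (M *m x) + d * dot x x <= qf X x) -> stab M.
Proof.
move=> pX d0 h z /eigenvalue_real[a [b [ab Ma Mb]]].
have := lerD (h a) (h b); rewrite Ma Mb addrACA qf_rot -normc_sqr -mulrDr.
set q := qf X a + qf X b => H.
have q0 : 0 <= q by rewrite addr_ge0 // possemidef_ge0.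
have dab : 0 < d * (dot a a + dot b b) by rewrite mulr_gt0.
rewrite -(@expr_lt1 _ 2) ?normc_ge0 //; set t := _ ^+ 2 in H *.
rewrite ltNge; apply/negP => t1; have : 1 * q <= t * q by rewrite ler_wpM2r.
lra.
Qed.

Lemma lyap_iter n (M X : 'M[F]_n) k x : lyap M X k ->
  (fun t => qf X (iter t (mulmx M) x)) @ \oo --> 0.
Proof.
case=> pX /andP[k0 k1] h; apply: (@cvg_contract _ _ (fun=> 0) (1 - k)).
- by rewrite subr_ge0 k1 /=; lra.
- by move=> t; apply: posdef_ge0.
- by move=> t; rewrite addr0 /= h.
- exact: cvg_cst.
Qed.

(* [qf D x >= qf D (M^t x)] for all [t], and [qf D] is dominated by [qf X] up to
   sign, which tends to 0 along the orbit. *)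
Lemma lyap_ge0 n (M X D : 'M[F]_n) k : lyap M X k ->
  (forall x, qf D (M *m x) <= qf D x) -> forall x, 0 <= qf D x.
Proof.
move=> lM h x; have [pX _ _] := lM.
have [c c0 hc] := @posdef_compare _ _ _ X (- D) 1%:M pX.
have hx t : qf D (iter t (mulmx M) x) <= qf D x.
  by elim: t => //= t IH; rewrite (le_trans (h _)).
have : (fun t => c * qf X (iter t (mulmx M) x)) @ \oo --> c * 0.
  by apply: cvgMr; apply: lyap_iter lM.
rewrite mulr0 => l0; rewrite -oppr_le0.
apply: (@cvg_le _ (fun=> - qf D x) _ _ _ _ l0); first exact: cvg_cst.
move=> t; have := hc (iter t (mulmx M) x); rewrite mul1mx qfN.
by apply: le_trans; rewrite lerN2.
Qed.

End Stability.

(** * Real symmetric matrices, traces and determinants *)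

Section Spectral.
Variable F : realType.

Lemma cmx_inj m n : injective (@cmx F m n).
Proof. by apply: map_mx_inj; exact: complexI. Qed.

(** The complex spectral decomposition has real eigenvalues, so [real_similar] replaces the complex
    change of basis by a real one. The resulting [T] is invertible but not known to be orthogonal,
    hence the argument in [diagfun_sym]. *)
Lemma sym_diag n (M : 'M[F]_n) : M^T = M ->
  exists (T : 'M[F]_n) (d : 'rV[F]_n),
    T \in unitmx /\ T *m M = diag_mx d *m T.
Proof.
move=> sM.
have realc p q (N : 'M[F]_(p, q)) : cmx N \is a mxOver Num.real.
  apply/mxOverP => i j; rewrite mxE; apply/complex_realP; by exists (N i j).
have real_cmx p q (N : 'M[F[i]]_(p, q)) : N \is a mxOver Num.real ->
    exists N', N = cmx N'.
  move=> /mxOverP h; exists (map_mx (@complex.Re F) N).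
  by apply/matrixP => i j; rewrite !mxE; rewrite RRe_real.
have symM : cmx M \is symmetricmx.
  apply/is_hermitianmxP; rewrite expr0 scale1r map_mx_id //.
  by rewrite -[in LHS]sM map_trmx.
have hM := realsym_hermsym symM (realc _ _ M).
have uP := spectral_unit (cmx M).
have /hermitian_normalmx/orthomx_spectralP eM := hM.
have rd := hermitian_spectral_diag_real hM.
have [d ed] := real_cmx _ _ _ rd.
have [||P] := @real_similar _ _ (cmx M) (diag_mx (spectral_diag (cmx M))) _
   (realc _ _ M).
- exists (spectralmx (cmx M)) => //; apply/similarP => //.
  by rewrite {2}eM !mulmxA mulmxV // mul1mx.
- apply/mxOverP => i j; rewrite mxE; apply: rpredMn.
  exact: (mxOverP rd).
rewrite inE => /andP[rP uP'] /(similarP uP') e.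
have [T eT] := real_cmx _ _ _ rP.
exists T, d; split.
  by move: uP'; rewrite eT map_unitmx.
apply: cmx_inj; rewrite !real_cplx_mulmx -eT e; congr (_ *m _).
by rewrite ed /cmx map_diag_mx.
Qed.

Section DiagonalCalculus.
Variables (n : nat) (M T : 'M[F]_n) (d : 'rV[F]_n).
Hypotheses (sM : M^T = M) (uT : T \in unitmx).
Hypothesis TM : T *m M = diag_mx d *m T.

Definition diagfun (f : F -> F) : 'M[F]_n :=
  invmx T *m diag_mx (map_mx f d) *m T.

Lemma diagfun_id : diagfun id = M.
Proof.
rewrite /diagfun map_mx_id //.
by rewrite -mulmxA -TM mulmxA mulVmx // mul1mx.
Qed.

Lemma diagfunM f g : diagfun f *m diagfun g = diagfun (fun x => f x * g x).
Proof.
rewrite /diagfun -!mulmxA; congr (_ *m _).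
rewrite [T *m _]mulmxA mulmxV // mul1mx mulmxA; congr (_ *m _).
rewrite mulmx_diag; congr diag_mx.
by apply/rowP => j; rewrite !mxE.
Qed.

(* [T *m T^T] commutes with the diagonal, hence with any function of it. *)
Lemma diagfun_sym f : (diagfun f)^T = diagfun f.
Proof.
set G := T *m T^T.
have DG : diag_mx d *m G = G *m diag_mx d.
  have e : diag_mx d *m G = T *m M *m T^T by rewrite TM mulmxA.
  have : (diag_mx d *m G)^T = diag_mx d *m G.
    by rewrite e !trmx_mul trmxK sM mulmxA.
  by rewrite trmx_mul tr_diag_mx /G trmx_mul trmxK => <-.
have fG : diag_mx (map_mx f d) *m G = G *m diag_mx (map_mx f d).
  apply/matrixP => i j; have := congr1 (fun A : 'M[F]_n => A i j) DG.
  rewrite /= !mul_diag_mx !mul_mx_diag !mxE.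
  have [-> _|g0] := eqVneq (\sum_k T i k * T^T k j) 0; first by rewrite mulr0 mul0r.
  by rewrite [RHS]mulrC => /(mulIf g0) ->; rewrite mulrC.
have uTt : T^T \in unitmx by rewrite unitmx_tr.
rewrite /diagfun !trmx_mul tr_diag_mx trmx_inv.
apply: (can_inj (mulmxK uTt)); rewrite !mulmxA mulmxKV //.
apply: (can_inj (mulKmx uT)).
by rewrite !mulmxA mulmxV // mul1mx -/G -fG mulmxA.
Qed.

Lemma diag_qf i : exists x : 'cV[F]_n, x != 0 /\ qf M x = d 0 i * dot x x.
Proof.
exists (row i T)^T; split.
  rewrite trmx_eq0; apply/eqP => r0.
  have := congr1 (row i) (mulmxV uT); rewrite row_mul r0 mul0mx row1.
  by move/rowP => /(_ i); rewrite !mxE !eqxx => /eqP; rewrite eq_sym oner_eq0.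
rewrite -qfE trmxK -row_mul TM row_mul row_diag_mx -scalemxAl -rowE.
by rewrite -scalemxAl mxE /dot trmxK.
Qed.

Lemma det_diagE : \det M = \prod_i d 0 i.
Proof.
rewrite -det_diag; apply: (mulfI (x := \det T)).
  by rewrite -unitfE -unitmxE.
by rewrite -det_mulmx TM det_mulmx mulrC.
Qed.

Lemma tr_diagE : \tr M = \sum_i d 0 i.
Proof.
rewrite -mxtrace_diag -diagfun_id /diagfun map_mx_id // mxtrace_mulC mulmxA.
by rewrite mulmxV // mul1mx.
Qed.

Lemma diag_ge0 i : possemidefmx M -> 0 <= d 0 i.
Proof.
move=> pM; have [x [x0 e]] := diag_qf i; have := possemidef_ge0 x pM.
by rewrite e pmulr_lge0 // dot_gt0.
Qed.

Lemma diag_gt0 i : posdefmx M -> 0 < d 0 i.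
Proof.
move=> pM; have [x [x0 e]] := diag_qf i; have := posdef_gt0 pM x0.
by rewrite e pmulr_lgt0 // dot_gt0.
Qed.

End DiagonalCalculus.

Lemma sqrtmx_exists n (M : 'M[F]_n) : possemidefmx M ->
  exists S : 'M[F]_n, possemidefmx S /\ S *m S = M.
Proof.
move=> pM; have sM := possemidef_sym pM; have [T [d [uT TM]]] := sym_diag sM.
have d0 i := diag_ge0 uT TM i pM.
exists (diagfun T d Num.sqrt); split; last first.
  rewrite diagfunM // -[RHS](diagfun_id uT TM) /diagfun; congr (_ *m diag_mx _ *m _).
  by apply/rowP => j; rewrite !mxE -expr2 sqr_sqrtr.
(* Positivity of the root: it is the Gram matrix of the fourth root, which is symmetric by
   [diagfun_sym]. *)
pose R := diagfun T d (Num.sqrt \o Num.sqrt).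
have -> : diagfun T d Num.sqrt = R^T *m R.
  rewrite (diagfun_sym sM uT TM) diagfunM //; congr (_ *m diag_mx _ *m _).
  by apply/rowP => j; rewrite !mxE /= -expr2 sqr_sqrtr // sqrtr_ge0.
exact: possemidef_gram.
Qed.

Lemma sqrtmxP n (M : 'M[F]_n) : possemidefmx M ->
  possemidefmx (sqrtmx M) /\ sqrtmx M *m sqrtmx M = M.
Proof.
move=> /sqrtmx_exists[S hS]; rewrite /sqrtmx.
by case: xgetP => [X _ //|/(_ S)].
Qed.

Lemma posdef_det_gt0 n (M : 'M[F]_n) : posdefmx M -> 0 < \det M.
Proof.
move=> pM; have [T [d [uT TM]]] := sym_diag (posdef_sym pM).
by rewrite (det_diagE uT TM) prodr_gt0 // => i _; apply: diag_gt0 TM _ _.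
Qed.

Lemma ln_det_le_tr n (M : 'M[F]_n) : posdefmx M ->
  ln (\det M) <= \tr (M - 1%:M).
Proof.
move=> pM; have [T [d [uT TM]]] := sym_diag (posdef_sym pM).
have d0 i := diag_gt0 uT TM i pM.
rewrite raddfB /= mxtrace1 (tr_diagE uT TM) (det_diagE uT TM).
have -> : \sum_i d 0 i - n%:R = \sum_i (d 0 i - 1).
  by rewrite sumrB sumr_const card_ord.
suff : \prod_i d 0 i <= expR (\sum_i (d 0 i - 1)).
  by move=> h; rewrite -ler_expR lnK // posrE prodr_gt0.
rewrite expR_sum; apply: ler_prod => i _; rewrite ltW //=.
by rewrite -[leLHS](subrK 1) addrC expR_ge1Dx.
Qed.

(** Tangent-plane form of concavity: congruence by the inverse square root of [M] moves the base
    point to the identity, where it is [ln_det_le_tr]. *)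
Lemma ln_det_concave n (M N : 'M[F]_n) : posdefmx M -> posdefmx N ->
  ln (\det N) - ln (\det M) <= \tr (invmx M *m (N - M)).
Proof.
move=> pM pN; have [S [pS SS]] := sqrtmx_exists (posdef_possemidef pM).
have uM := posdef_unit pM.
have uS : S \in unitmx.
  by move: uM; rewrite -SS unitmx_mul => /andP[].
have sS := possemidef_sym pS.
pose Y := (invmx S)^T *m N *m invmx S.
have pY : posdefmx Y.
  apply/posdefP; split; first exact/possemidef_trsym/posdef_sym.
  move=> x x0; rewrite qf_congr posdef_gt0 //.
  by apply: contra_neq x0 => e; rewrite -[x](mulKVmx uS) e mulmx0.
have := ln_det_le_tr pY.
have siS : (invmx S)^T = invmx S by rewrite trmx_inv sS.
have -> : \tr (Y - 1%:M) = \tr (invmx M *m (N - M)).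
  rewrite mulmxBr mulVmx // !raddfB /=; congr (_ - _).
  rewrite /Y siS mxtrace_mulC mulmxA; congr (\tr (_ *m _)).
  apply: (can_inj (mulKmx uM)); rewrite mulmxV // -SS !mulmxA.
  by rewrite mulmxK // mulmxV.
have dM : \det M != 0 by rewrite gt_eqF // posdef_det_gt0.
have -> : \det Y = \det N / \det M.
  rewrite /Y siS !det_mulmx !det_inv -SS det_mulmx invfM; ring.
by rewrite ln_div // posrE posdef_det_gt0.
Qed.

Lemma qf_delta n (M : 'M[F]_n) i : qf M (delta_mx i 0) = M i i.
Proof. by rewrite -qfE trmx_delta -rowE -colE !mxE. Qed.

Lemma le_tr n (M N : 'M[F]_n) : (forall x, qf M x <= qf N x) -> \tr M <= \tr N.
Proof. by move=> h; apply: ler_sum => i _; rewrite -!qf_delta. Qed.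

Lemma frob_tr m n (M : 'M[F]_(m, n)) : frob M = \tr (M^T *m M).
Proof.
rewrite /frob exchange_big; apply: eq_bigr => j _; rewrite mxE.
by apply: eq_bigr => i _; rewrite !mxE expr2.
Qed.

Lemma frob_mul m n p (M : 'M[F]_(m, n)) (N : 'M[F]_(n, p)) :
  frob (M *m N) <= frob M * frob N.
Proof.
rewrite (frob_tr N) -mxtraceZ frob_tr; apply: le_tr => x.
by rewrite qfZ !qf_gram -mulmxA dot_frob.
Qed.

Lemma tr_mul_le n (M N D : 'M[F]_n) : possemidefmx D ->
  (forall x, qf M x <= qf N x) -> \tr (M *m D) <= \tr (N *m D).
Proof.
move=> /sqrtmx_exists[S [pS <-]] h; have sS := possemidef_sym pS.
have e (Q : 'M[F]_n) : \tr (Q *m (S *m S)) = \tr (S^T *m Q *m S).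
  by rewrite mulmxA mxtrace_mulC mulmxA sS.
by rewrite !e; apply: le_tr => x; rewrite !qf_congr.
Qed.

(** [D] is at most [\tr D] times the identity, because [D = S^2] with [frob S = \tr D]; multiply by
    [D] and take traces. *)
Lemma frob_le_tr n (D : 'M[F]_n) : possemidefmx D -> frob D <= \tr D ^+ 2.
Proof.
move=> pD; have sD := possemidef_sym pD.
have [S [pS SS]] := sqrtmx_exists pD; have sS := possemidef_sym pS.
have tS : frob S = \tr D by rewrite frob_tr sS SS.
rewrite frob_tr sD expr2 -mxtraceZ -mul_scalar_mx; apply: tr_mul_le => // x.
rewrite -scalemx1 qfZ qf1 -tS (le_trans _ (dot_frob S x)) //.
by rewrite -qf_gram sS SS.
Qed.

End Spectral.

(** * The Riccati map *)

Section Riccati.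
Variables (F : realType) (m : nat) (V : 'M[F]_m).
Hypothesis pV : posdefmx V.

Let sV : V^T = V := posdef_sym pV.
Let uV : V \in unitmx := posdef_unit pV.

(* With [V = gamma^2 (D D^T)^-1], the paper's [tilde P] is [V (V - P)^-1 V - V],
   and [I - gamma^-2 D^T P D > 0] reads [V - P > 0]. *)
Definition tp (P : 'M[F]_m) : 'M[F]_m := V *m invmx (V - P) *m V - V.

(* The loop [x -> a x + w] closed with the maximising disturbance [w]; it equals
   [(I - gamma^-2 P D D^T)^-T a]. *)
Definition lc (P a : 'M[F]_m) : 'M[F]_m := invmx (V - P) *m V *m a.

Definition Ric (a q P : 'M[F]_m) : 'M[F]_m := a^T *m tp P *m a + q.

(** Convexity of inversion with its tangent at [N2]: expand [qf N1] at the difference [y2 - y1] of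
    the two solutions. *)
Lemma invmx_lin n (N1 N2 : 'M[F]_n) v : posdefmx N1 -> posdefmx N2 ->
  qf (invmx N2) v - qf (N1 - N2) (invmx N2 *m v) <= qf (invmx N1) v.
Proof.
move=> p1 p2; set y1 := invmx N1 *m v; set y2 := invmx N2 *m v.
have e1 : N1 *m y1 = v by rewrite /y1 mulKVmx ?posdef_unit.
have e2 : N2 *m y2 = v by rewrite /y2 mulKVmx ?posdef_unit.
have := posdef_ge0 (y2 - y1) p1; rewrite qf_sub ?posdef_sym // e1 qfD qfN.
have -> : qf (invmx N1) v = qf N1 y1 by rewrite qf_invmx.
have -> : qf (invmx N2) v = qf N2 y2 by rewrite qf_invmx.
have : qf N2 y2 = dot y2 v by rewrite /qf e2.
lra.
Qed.

(** The first Neumann term, with [t / (1 - t * b)] as the sum of the geometric tail allowed by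
    [X <= b N]. The proof estimates the error [e = y - u], which solves [N e = t X y]. In
    [improve_strict] this controls [tp] at [P + t X]. *)
Lemma invmx_perturb n (N X : 'M[F]_n) b t v : posdefmx N -> possemidefmx X ->
  (forall x, qf X x <= b * qf N x) -> 0 < b -> 0 < t -> t * b < 1 ->
  posdefmx (N - t *: X) /\
  qf (invmx (N - t *: X)) v <= qf (invmx N) v
    + t / (1 - t * b) * qf X (invmx N *m v).
Proof.
move=> pN pX hb b0 t0 tb; have sN := posdef_sym pN; have sX := possemidef_sym pX.
have pN' : posdefmx (N - t *: X).
  apply/posdefP; split; first by rewrite linearB linearZ /= sN sX.
  move=> x x0; rewrite qfD qfN qfZ subr_gt0.
  apply: (@le_lt_trans _ _ (t * (b * qf N x))); first by rewrite ler_pM2l.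
  by rewrite mulrA gtr_pMl // posdef_gt0.
split=> //; set y := invmx (N - t *: X) *m v; set u := invmx N *m v.
have eu : N *m u = v by rewrite /u mulKVmx ?posdef_unit.
have ey : N *m y = v + t *: (X *m y).
  have : (N - t *: X) *m y = v by rewrite /y mulKVmx ?posdef_unit.
  by rewrite mulmxBl -scalemxAl => <-; rewrite subrK.
pose e := y - u; have ye : y = u + e by rewrite /e addrC subrK.
have Ne : N *m e = t *: (X *m y) by rewrite /e mulmxBr ey eu addrC addKr.
have -> : qf (invmx (N - t *: X)) v = dot v y by [].
have -> : qf (invmx N) v = dot v u by [].
set al := dot e (X *m u).
have hye : dot v y = dot v u + t * (qf X u + al).
  rewrite {1}ye dotDr; congr (_ + _); rewrite -eu dotC (dot_sym _ _ sN) Ne.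
  by rewrite dotZr ye mulmxDr dotDr -/(qf X u) (dot_sym u e sX).
have hNe : qf N e = t * (al + qf X e).
  by rewrite /qf Ne dotZr ye mulmxDr dotDr.
have tb0 : 0 < 1 - t * b by rewrite subr_gt0.
have hXe : (1 - t * b) * qf X e <= t * b * al.
  have := hb e; rewrite hNe; nra.
pose th := t * b / (1 - t * b).
have th0 : 0 < th by rewrite divr_gt0 // mulr_gt0.
have hXe' : qf X e <= th * al.
  by rewrite /th mulrAC ler_pdivlMr // mulrC.
have hal : al <= th * qf X u.
  have := possemidef_ge0 (e - th *: u) pX.
  rewrite qf_sub // -scalemxAr dotZr qfs -/al => h.
  have : 0 <= th * (th * qf X u - al) by lra.
  by rewrite pmulr_rge0 // subr_ge0.
rewrite hye; have -> : t / (1 - t * b) = t * (1 + th).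
  by rewrite /th; field; rewrite gt_eqF.
by rewrite lerD2l -mulrA ler_pM2l // mulrDl mul1r lerD2l.
Qed.

Lemma gap_le P U : P^T = P -> (forall x, qf P x <= qf U x) ->
  posdefmx (V - U) -> posdefmx (V - P).
Proof.
move=> sP h pU; apply/posdefP; split; first by rewrite linearB /= sP sV.
move=> x x0; have := posdef_gt0 pU x0; rewrite !qfD !qfN; have := h x; lra.
Qed.

Lemma mul_gap_inv P : posdefmx (V - P) ->
  P *m invmx (V - P) = V *m invmx (V - P) - 1%:M.
Proof.
move=> /posdef_unit uN; apply: (can_inj (mulmxK uN)).
by rewrite mulmxKV // mulmxBl mulmxKV // mul1mx opprB addrC subrK.
Qed.

Lemma tp_sym P : P^T = P -> (tp P)^T = tp P.
Proof.
by move=> sP; rewrite /tp linearB /= !trmx_mul trmx_inv linearB /= sP sV mulmxA.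
Qed.

Lemma qf_tp P x : qf (tp P) x = qf (invmx (V - P)) (V *m x) - qf V x.
Proof. by rewrite /tp qfD qfN; congr (_ - _); rewrite -{1}sV qf_congr. Qed.

(* [tp] is convex; this is the supporting hyperplane at [P2]. *)
Lemma tp_lin P1 P2 x : posdefmx (V - P1) -> posdefmx (V - P2) ->
  qf (tp P2) x + qf (P1 - P2) (invmx (V - P2) *m V *m x) <= qf (tp P1) x.
Proof.
move=> p1 p2; have := invmx_lin (V *m x) p1 p2; rewrite !qf_tp -mulmxA.
have -> : V - P1 - (V - P2) = - (P1 - P2) by rewrite opprB [LHS]addrC addrA subrK opprB.
rewrite qfN; lra.
Qed.

Lemma tp_mono P1 P2 x : posdefmx (V - P1) -> posdefmx (V - P2) ->
  (forall x, qf P2 x <= qf P1 x) -> qf (tp P2) x <= qf (tp P1) x.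
Proof.
move=> p1 p2 h; apply: le_trans (tp_lin x p1 p2).
by rewrite lerDl qfD qfN subr_ge0.
Qed.

Lemma tp0 : tp 0 = 0.
Proof. by rewrite /tp subr0 mulmxV // mul1mx subrr. Qed.

Lemma tp_ge P x : posdefmx (V - P) -> qf P x <= qf (tp P) x.
Proof.
move=> p; have := @tp_lin P 0 x p; rewrite !subr0 tp0 qf0m add0r.
by rewrite mulVmx // mul1mx; apply.
Qed.

(** The maximum in [tp_sup] is attained: [y] is the state reached under the worst disturbance
    [y - x]. *)
Lemma tp_opt P x (y := invmx (V - P) *m V *m x) : posdefmx (V - P) ->
  qf (tp P) x = qf P y - qf V (y - x).
Proof.
move=> p; have ey : (V - P) *m y = V *m x.
  by rewrite /y -mulmxA mulKVmx // posdef_unit.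
have -> : qf (tp P) x = dot (V *m x) y - qf V x by rewrite qf_tp /qf mulmxA.
have e : dot (V *m x) y = qf V y - qf P y.
  by rewrite -ey dotC /qf mulmxBl dotDr dotNr.
have e' : dot (V *m x) y = dot y (V *m x) by rewrite dotC.
rewrite qf_sub // -e' e; lra.
Qed.

(* [tp P] is the value of the inner maximisation over the disturbance [w]. *)
Lemma tp_sup P x w : posdefmx (V - P) ->
  qf P (x + w) - qf V w <= qf (tp P) x.
Proof.
move=> p; have sp := posdef_sym p; set y := invmx (V - P) *m V *m x.
have ey : (V - P) *m y = V *m x by rewrite /y -mulmxA mulKVmx // posdef_unit.
have := posdef_ge0 (x + w - y) p.
rewrite qf_sub // ey; set z := x + w; have -> : w = z - x by rewrite /z addrC addKr.
rewrite (@qf_sub _ _ V z x) //.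
have -> : qf (tp P) x = qf (V - P) y - qf V x.
  by rewrite qf_tp /y -mulmxA -qf_invmx // mulmxA.
rewrite qfD qfN; lra.
Qed.

Lemma Ric_sym a q P : q^T = q -> P^T = P -> (Ric a q P)^T = Ric a q P.
Proof.
by move=> sq sP; rewrite /Ric linearD /= sq possemidef_trsym // tp_sym.
Qed.

Lemma qf_Ric a q P x : qf (Ric a q P) x = qf (tp P) (a *m x) + qf q x.
Proof. by rewrite /Ric qfD qf_congr. Qed.

Lemma mcvg_tp (P : nat -> 'M[F]_m) L : posdefmx (V - L) ->
  (forall k, posdefmx (V - P k)) -> mcvg P L -> mcvg (fun k => tp (P k)) (tp L).
Proof.
move=> pL pP h; apply: mcvgB; last exact: mcvg_cst.
apply: mcvgM; last exact: mcvg_cst.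
apply: mcvgM; first exact: mcvg_cst.
apply: mcvg_inv; [exact: posdef_unit|by move=> k; apply: posdef_unit|].
by apply: mcvgB => //; apply: mcvg_cst.
Qed.

Section ValueIteration.
Variables (a q U : 'M[F]_m).
Hypothesis pq : possemidefmx q.

Definition vi k := iter k (Ric a q) 0.

Lemma vi_sym k : (vi k)^T = vi k.
Proof.
elim: k => [|k IH]; first exact: trmx0.
by rewrite /vi iterS Ric_sym // possemidef_sym.
Qed.

(** The iterates increase because [tp] is monotone; a bound [U] strictly below [V] keeps every gap
    [V - vi k] and the limit gap invertible, so the limit is a fixed point. *)
Lemma vi_lim : posdefmx (V - U) -> (forall k x, qf (vi k) x <= qf U x) ->
  exists P, [/\ possemidefmx P, forall x, qf P x <= qf U x & Ric a q P = P].
Proof.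
move=> pU h; have pk k : posdefmx (V - vi k) by apply: gap_le pU; rewrite ?vi_sym.
have inc k x : qf (vi k) x <= qf (vi k.+1) x.
  elim: k x => [|k IH] x.
    by rewrite /vi /= qf0m qf_Ric tp0 qf0m add0r possemidef_ge0.
  by rewrite /vi !iterS !qf_Ric lerD2r; exact: (tp_mono _ (pk k.+1) (pk k) IH).
have [P [cP sP geP leP]] := mcvg_nondecreasing vi_sym inc h.
exists P; split => //.
  apply/possemidefP; split => // x; apply: le_trans (geP 0%N x).
  by rewrite /vi /= qf0m.
apply: mcvg_uniq (mcvg_shift cP).
apply: (@mcvg_ext _ _ _ (fun k => Ric a q (vi k))) => //.
apply: mcvgD; last exact: mcvg_cst.
apply: mcvgM; last exact: mcvg_cst.
apply: mcvgM; first exact: mcvg_cst.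
by apply: mcvg_tp => //; apply: gap_le pU.
Qed.

Lemma vi_supersolution : possemidefmx U -> posdefmx (V - U) ->
  (forall x, qf (Ric a q U) x <= qf U x) ->
  exists P, [/\ possemidefmx P, forall x, qf P x <= qf U x & Ric a q P = P].
Proof.
move=> psU pU h; apply: vi_lim => // k; elim: k => [|k IH] x.
  by rewrite /vi /= qf0m possemidef_ge0.
apply: le_trans (h x); rewrite /vi iterS !qf_Ric lerD2r; apply: tp_mono => //.
by apply: gap_le pU => //; apply: vi_sym.
Qed.

End ValueIteration.

Definition strict_super a q U : Prop :=
  [/\ possemidefmx U, posdefmx (V - U) & exists2 d : F, 0 < d &
     forall x, qf (Ric a q U) x + d * dot x x <= qf U x].

(** [stabilizing_solution] in terms of [V]; see [stabilizing_solutionP]. *)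
Definition stabsol a q P : Prop :=
  [/\ possemidefmx P, posdefmx (V - P), Ric a q P = P & stab (lc P a)].

Lemma strict_super_stab a q U : possemidefmx q -> strict_super a q U -> stab a.
Proof.
move=> pq [pU gU [d d0 h]]; apply: lyap_stab pU d0 _ => x.
apply: le_trans (h x); rewrite lerD2r qf_Ric.
by rewrite (le_trans (tp_ge (a *m x) gU)) // lerDl possemidef_ge0.
Qed.

(** [U - P] is a Lyapunov function of the closed loop of [P]: the tangent of [tp] at [P] compares
    the two Riccati maps, and the slack [d] of [U] is left over. *)
Lemma strict_super_stabsol a q U : possemidefmx q -> strict_super a q U ->
  exists P, stabsol a q P.
Proof.
move=> pq [pU gU [d d0 h]].
have [x|P [pP lePU eP]] := @vi_supersolution a q U pq pU gU.
  by apply: le_trans (h x); rewrite lerDl mulr_ge0 ?dot_ge0 // ltW.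
have gP : posdefmx (V - P) by apply: gap_le gU => //; apply: possemidef_sym.
exists P; split => //; apply: (@lyap_stab _ _ (U - P) _ d) => //.
  apply/possemidefP; split; last by move=> x; rewrite qfD qfN subr_ge0.
  by rewrite linearB /= !possemidef_sym.
move=> x; have := tp_lin (a *m x) gU gP; have := h x.
have : qf P x = qf (Ric a q P) x by rewrite eP.
rewrite !qf_Ric !(qfD U) !qfN /lc !mulmxA; lra.
Qed.

End Riccati.

(** * The frequency inequality in the time domain *)

Section Frequency.
Variable F : realType.

(** Multiplication by [sin (th / 2)], nonzero for [0 < j < M], makes the sum telescope. *)
Lemma sum_cos0 (M j : nat) : (0 < j < M)%N ->
  \sum_(k < M) cos (k%:R * (2 * pi / M%:R * j%:R)) = 0 :> F.
Proof.
move=> /andP[j0 jM]; set th := _ * j%:R.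
have M0 : M%:R != 0 :> F by rewrite pnatr_eq0 -lt0n (leq_trans _ jM).
have hth : th / 2 = pi * (j%:R / M%:R) by rewrite /th; field.
have sth : sin (th / 2) != 0.
  rewrite gt_eqF // sin_gt0_pi // hth mulr_gt0 ?pi_gt0 //=; last first.
    by rewrite divr_gt0 // ltr0n // (leq_trans _ jM).
  by rewrite gtr_pMr ?pi_gt0 // ltr_pdivrMr ?mul1r ?ltr_nat // ltr0n (leq_trans _ jM).
apply: (mulfI sth); rewrite mulr0.
pose f k := sin (k%:R * th - th / 2) / 2.
have e k : sin (th / 2) * cos (k%:R * th) = f k.+1 - f k.
  rewrite /f -mulrBl.
  have -> : k.+1%:R * th - th / 2 = k%:R * th + th / 2 by rewrite -natr1; field.
  by rewrite sinD sinB; field.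
rewrite mulr_sumr (eq_bigr (fun k : 'I_M => f k.+1 - f k)) => [|k _]; last exact: e.
rewrite -(big_mkord xpredT (fun k => f k.+1 - f k)) telescope_sumr // /f.
have -> : M%:R * th - th / 2 = - (th / 2) + (pi *+ 2) *+ j.
  by rewrite /th -mulr_natr -(mulr_natr pi); field.
by rewrite (periodicn (@sinD2pi F)) mul0r add0r subrr.
Qed.

Lemma dot_suml n I (r : seq I) (P : pred I) (f : I -> 'cV[F]_n) y :
  dot (\sum_(i <- r | P i) f i) y = \sum_(i <- r | P i) dot (f i) y.
Proof. by apply: (big_morph (fun x => dot x y)) => [x z|]; rewrite !dotL. Qed.

Lemma dot_sumr n I (r : seq I) (P : pred I) (f : I -> 'cV[F]_n) y :
  dot y (\sum_(i <- r | P i) f i) = \sum_(i <- r | P i) dot y (f i).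
Proof. by apply: (big_morph (dot y)) => [x z|]; rewrite !dotL. Qed.

(** Discrete Parseval identity in real coordinates: the cosine and sine sums are the two parts of
    the Fourier transform at node [k], and [cosB] merges them into the orthogonality sums [G]. *)
Lemma parseval m (Q : 'M[F]_m) (M : nat) (w : nat -> 'cV[F]_m) (ph := 2 * pi / M%:R) :
  \sum_(k < M) (qf Q (\sum_(t < M) cos (k%:R * (ph * t%:R)) *: w t)
              + qf Q (\sum_(t < M) sin (k%:R * (ph * t%:R)) *: w t))
  = M%:R * \sum_(t < M) qf Q (w t).
Proof.
have bil (f : nat -> F) : qf Q (\sum_(t < M) f t *: w t)
    = \sum_(t < M) \sum_(u < M) f t * f u * dot (w t) (Q *m w u).
  rewrite /qf mulmx_sumr dot_suml; apply: eq_bigr => t _.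
  rewrite dot_sumr; apply: eq_bigr => u _.
  by rewrite -scalemxAr dotZl dotZr mulrA.
under eq_bigr => k _ do rewrite (bil (fun t => cos (k%:R * (ph * t%:R))))
  (bil (fun t => sin (k%:R * (ph * t%:R)))).
pose G (t u : 'I_M) : F := \sum_(k < M) cos (k%:R * (ph * t%:R) - k%:R * (ph * u%:R)).
have -> : \sum_(k < M)
   (\sum_(t < M) \sum_(u < M) cos (k%:R * (ph * t%:R)) * cos (k%:R * (ph * u%:R)) *
        dot (w t) (Q *m w u) +
    \sum_(t < M) \sum_(u < M) sin (k%:R * (ph * t%:R)) * sin (k%:R * (ph * u%:R)) *
        dot (w t) (Q *m w u))
  = \sum_(t < M) \sum_(u < M) G t u * dot (w t) (Q *m w u).
  under eq_bigr => k _.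
    rewrite -big_split /=; under eq_bigr => t _.
      rewrite -big_split /=; under eq_bigr => u _ do rewrite -mulrDl -cosB.
      over.
    over.
  rewrite exchange_big; apply: eq_bigr => t _; rewrite exchange_big /=.
  by apply: eq_bigr => u _; rewrite mulr_suml.
have G0 t u : G t u = (t == u)%:R * M%:R.
  rewrite /G; have [<-|tu] := eqVneq t u.
    under eq_bigr do rewrite subrr cos0.
    by rewrite sumr_const card_ord mul1r.
  rewrite mul0r; wlog lt : t u tu / (u < t)%N => [hw|].
    have [|ut|/val_inj ut] := ltngtP u t; last by rewrite ut eqxx in tu.
      exact: hw.
    rewrite -[RHS](hw u t) 1?eq_sym //; apply: eq_bigr => k _.
    by rewrite -[in RHS]cosN opprB.
  rewrite -[RHS](@sum_cos0 M (t - u)); last first.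
    by rewrite subn_gt0 lt /= (leq_ltn_trans (leq_subr _ _)).
  by apply: eq_bigr => k _; rewrite natrB ?(ltnW lt) // -/ph; congr cos; ring.
rewrite mulr_sumr; apply: eq_bigr => t _.
rewrite (bigD1 t) //= big1 ?addr0 => [|u ut].
  by rewrite G0 eqxx mul1r.
by rewrite G0 eq_sym (negPf ut) !mul0r.
Qed.

End Frequency.

Section FrequencyInequality.
Variables (F : realType) (m : nat) (V : 'M[F]_m).
Hypothesis pV : posdefmx V.

(* With [z = c + i s] on the unit circle, [xi = x + i y] and
   [w = (z - a) xi], this says [xi^* q xi <= (1 - e) w^* V w]. *)
Definition fdi (a q : 'M[F]_m) (e : F) : Prop :=
  forall c s x y, c ^+ 2 + s ^+ 2 = 1 ->
    qf q x + qf q y <= (1 - e) *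
      (qf V (c *: x - s *: y - a *m x) + qf V (s *: x + c *: y - a *m y)).

Lemma fdi_periodic a q e M (x : nat -> 'cV[F]_m) : fdi a q e ->
  (0 < M)%N -> x 0%N = 0 -> x M = 0 ->
  \sum_(t < M) qf q (x t) <= (1 - e) * \sum_(t < M) qf V (x t.+1 - a *m x t).
Proof.
case: M => // N hf _ x0 xM; set M := N.+1.
have M0 : 0 < M%:R :> F by rewrite ltr0n.
rewrite -(ler_pM2l M0) mulrCA -(parseval q).
rewrite -(parseval V M (fun t => x t.+1 - a *m x t)).
rewrite mulr_sumr; apply: ler_sum => k _.
set ph := 2 * pi / M%:R; set b := k%:R * ph.
pose X := \sum_(t < M) cos (k%:R * (ph * t%:R)) *: x t.
pose Y := \sum_(t < M) sin (k%:R * (ph * t%:R)) *: x t.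
have shift (f : F -> F) :
   \sum_(t < M) f (k%:R * (ph * t%:R)) *: x t.+1
   = \sum_(t < M) f (k%:R * (ph * t%:R) - b) *: x t.
  rewrite big_ord_recr [RHS]big_ord_recl /= x0 xM !scaler0 addr0 add0r.
  apply: eq_bigr => t _; congr (f _ *: _).
  by rewrite /bump /= add1n -natr1 /b; ring.
have lin (f : F -> F) :
   \sum_(t < M) f (k%:R * (ph * t%:R)) *: (x t.+1 - a *m x t)
   = \sum_(t < M) f (k%:R * (ph * t%:R) - b) *: x t
     - a *m \sum_(t < M) f (k%:R * (ph * t%:R)) *: x t.
  rewrite -shift mulmx_sumr -sumrB; apply: eq_bigr => t _.
  by rewrite scalerBr -scalemxAr.
rewrite !lin -/X -/Y.
(* With the kernel [exp (- i b t)] the transform is [X - i Y] and a time shift multiplies it by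
   [expj b]; hence the sign of [Y]. *)
have := hf (cos b) (sin b) X (- Y) (cos2Dsin2 b); rewrite qf_opp => /le_trans; apply.
rewrite le_eqVlt; apply/orP; left; apply/eqP; congr (_ * (_ + _)).
  congr (qf V (_ - _)); rewrite scalerN opprK /X /Y !scaler_sumr -big_split /=.
  apply: eq_bigr => t _; rewrite !scalerA -scalerDl cosB; congr (_ *: _); ring.
rewrite -qf_opp; congr (qf V _); rewrite mulmxN opprD !opprK scalerN opprD opprK addrC.
rewrite [in RHS]addrC; congr (_ + _).
rewrite /X /Y !scaler_sumr -sumrN -big_split /=; apply: eq_bigr => t _.
rewrite !scalerA -scaleNr -scalerDl sinB; congr (_ *: _); ring.
Qed.

End FrequencyInequality.

(** * Equivalence of the frequency inequality with a strict Riccati supersolution *)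

Section BoundedReal.
Variables (F : realType) (m : nat) (V : 'M[F]_m).
Hypothesis pV : posdefmx V.

(* The trajectory is continued freely for [S] steps and then driven to [0] in a
   single step, which makes it periodic; the price vanishes as [S] grows. *)
Lemma fdi_trajectory a q (e : F) k (x : nat -> 'cV[F]_m) :
  possemidefmx q -> stab a -> fdi V a q e -> x 0%N = 0 ->
  \sum_(t < k) qf q (x t) <= (1 - e) * \sum_(t < k) qf V (x t.+1 - a *m x t).
Proof.
move=> pq sa hf x0; pose W := \sum_(t < k) qf V (x t.+1 - a *m x t).
have key S : \sum_(t < k) qf q (x t)
    <= (1 - e) * (W + qf V (iter S.+1 (mulmx a) (x k))).
  pose y t := if (t <= k)%N then x t else
    if (t <= k + S)%N then iter (t - k) (mulmx a) (x k) else 0.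
  have yk t : (k <= t <= k + S)%N -> y t = iter (t - k) (mulmx a) (x k).
    move=> /andP[kt tS]; rewrite /y tS; case: leqP => // tk.
    by have -> : t = k by [apply/eqP; rewrite eqn_leq tk]; rewrite subnn.
  have yM : y (k + S).+1 = 0.
    by rewrite /y ltnn leqNgt ltnS leq_addr.
  have y0 : y 0%N = 0 by rewrite /y leq0n.
  have := @fdi_periodic _ _ _ _ _ _ (k + S).+1 y hf isT y0 yM.
  rewrite -!(big_mkord xpredT (fun t => qf q (y t))).
  rewrite -!(big_mkord xpredT (fun t => qf V (y t.+1 - a *m y t))).
  rewrite [X in _ <= (1 - e) * X]big_nat_recr //= yM sub0r qf_opp yk ?leqnn ?leq_addr //.
  rewrite addKn -iterS => h.
  have hq : \sum_(t < k) qf q (x t) <= \sum_(0 <= t < (k + S).+1) qf q (y t).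
    rewrite [leRHS](big_cat_nat (n := k)) ?leqW ?leq_addr //=.
    apply: (@le_trans _ _ (\sum_(0 <= t < k) qf q (y t))).
      rewrite big_mkord le_eqVlt; apply/orP; left; apply/eqP.
      by apply: eq_bigr => t _; rewrite /y ltnW.
    by rewrite lerDl sumr_ge0 // => t _; apply: possemidef_ge0.
  apply: le_trans hq (le_trans h _); rewrite le_eqVlt; apply/orP; left; apply/eqP.
  congr (_ * (_ + _)); rewrite (big_cat_nat (n := k)) ?leq_addr //=.
  have -> : \sum_(k <= t < k + S) qf V (y t.+1 - a *m y t) = 0.
    rewrite big_nat; apply: big1 => t /andP[kt tS].
    by rewrite !yk ?kt ?(ltnW tS) ?(leqW kt) ?tS // subSn // iterS subrr qf0.
  rewrite addr0 big_mkord; apply: eq_bigr => t _.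
  by rewrite /y ltn_ord ltnW.
have [X [kp lX]] := stab_lyap sa; have [pX _ _] := lX.
have [c c0 hc] := @posdef_compare _ _ _ X V 1%:M pX.
have h0 : (fun S => qf V (iter S.+1 (mulmx a) (x k))) @ \oo --> 0.
  apply: (@cvg_squeeze0 _ _ (fun S => c * qf X (iter S.+1 (mulmx a) (x k)))).
    move=> S; rewrite posdef_ge0 //=.
    by have := hc (iter S.+1 (mulmx a) (x k)); rewrite mul1mx.
  rewrite -[X in _ --> X](mulr0 c); apply: cvgMr.
  rewrite (cvg_shiftS (fun S => qf X (iter S (mulmx a) (x k)))).
  exact: lyap_iter lX.
have h1 : (fun S => (1 - e) * (W + qf V (iter S.+1 (mulmx a) (x k))))
            @ \oo --> (1 - e) * (W + 0).
  by apply: cvgMr; apply: cvgD => //; apply: cvg_cst.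
rewrite addr0 in h1.
by apply: (@cvg_le _ (fun=> \sum_(t < k) qf q (x t)) _ _ _ _ h1 key); apply: cvg_cst.
Qed.

(** [vi k] is the value of the game over [k] steps; playing the maximiser of [tp_opt] at each step
    yields a trajectory that attains it. *)
Lemma vi_trajectory a q k xi : (forall j, (j < k)%N -> posdefmx (V - vi V a q j)) ->
  exists2 x : nat -> 'cV[F]_m, x 0%N = xi &
    qf (vi V a q k) xi = \sum_(t < k) qf q (x t)
                         - \sum_(t < k) qf V (x t.+1 - a *m x t).
Proof.
elim: k xi => [|k IH] xi pk.
  by exists (fun=> xi); rewrite // !big_ord0 /vi /= qf0m subrr.
have pvk := pk k (leqnn _).
set P := vi V a q k in pvk.
have [|x x0 hx] := IH (invmx (V - P) *m V *m (a *m xi)).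
  by move=> j jk; apply: pk; rewrite ltnS ltnW.
exists (fun t => if t is t'.+1 then x t' else xi) => //.
have -> : vi V a q k.+1 = Ric V a q P by [].
rewrite !big_ord_recl /= qf_Ric // (tp_opt pV _ pvk) hx x0; lra.
Qed.

Lemma vi_bound a q (e : F) k : possemidefmx q -> stab a -> 0 < e -> fdi V a q e ->
  forall x, qf (vi V a q k) x <= qf ((1 - e) *: V) x.
Proof.
move=> pq sa e0 hf; elim/ltn_ind: k => k IH xi.
have pk j : (j < k)%N -> posdefmx (V - vi V a q j).
  move=> jk; apply: (@gap_le _ _ _ pV _ ((1 - e) *: V)); rewrite ?vi_sym //.
    exact: IH.
  have -> : V - (1 - e) *: V = e *: V by rewrite scalerBl scale1r opprB addrC subrK.
  exact: posdefZ.
have [x x0 ->] := @vi_trajectory a q k xi pk.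
(* A zero state is put in front: reaching [xi] from 0 takes the disturbance [xi] itself, whose
   price, scaled by [1 - e], is the bound sought. *)
have := @fdi_trajectory a q e k.+1 (fun t => if t is t'.+1 then x t' else 0) pq sa hf erefl.
rewrite !big_ord_recl /= qf0 add0r mulmx0 subr0 x0 qfZ mulrDr.
set S := \sum_(t < k) qf V _ => h.
have S0 : 0 <= S by apply: sumr_ge0 => t _; apply: posdef_ge0.
have := mulr_ge0 (ltW e0) S0; lra.
Qed.

(** A Lyapunov function [X] of [a] bounds the state by the disturbance: rotation preserves [X] while
    [a] contracts it, so the difference is due to [u] and [v]. Half of the margin [e] then pays for
    the added [d |x|^2]. *)
Lemma fdi_strengthen a q (e : F) : stab a -> 0 < e -> fdi V a q e ->
  exists2 d : F, 0 < d & fdi V a (q + d%:M) (e / 2).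
Proof.
move=> /stab_lyap[X [kp [pX /andP[k0 k1] hX]]] e0 hf.
have psX := posdef_possemidef pX.
have [c1 c10 hc1] := @posdef_compare _ _ _ V X 1%:M pV.
have [c2 c20 hc2] := @posdef_compare _ _ _ X 1%:M 1%:M pX.
pose cc := (1 + (kp / 2)^-1) * c1 * c2.
have cc0 : 0 < cc.
  by rewrite !mulr_gt0 // addr_gt0 // invr_gt0 divr_gt0.
pose d := e / 2 * (kp / 2) / cc.
have d0 : 0 < d by rewrite divr_gt0 // mulr_gt0 // divr_gt0.
exists d => // c s x y cs; have := hf c s x y cs.
set x' := c *: x - s *: y; set y' := s *: x + c *: y.
set u := x' - a *m x; set v := y' - a *m y.
have hrot : qf X x' + qf X y' = qf X x + qf X y by rewrite qf_rot cs mul1r.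
have h2 : 0 < kp / 2 by rewrite divr_gt0.
have hx : qf X x' <= (1 + kp / 2) * ((1 - kp) * qf X x) + (1 + (kp / 2)^-1) * qf X u.
  have -> : x' = a *m x + u by rewrite /u addrC subrK.
  apply: le_trans (qf_addle _ _ psX h2) _.
  by rewrite lerD2r ler_wpM2l // addr_ge0 // ltW.
have hy : qf X y' <= (1 + kp / 2) * ((1 - kp) * qf X y) + (1 + (kp / 2)^-1) * qf X v.
  have -> : y' = a *m y + v by rewrite /v addrC subrK.
  apply: le_trans (qf_addle _ _ psX h2) _.
  by rewrite lerD2r ler_wpM2l // addr_ge0 // ltW.
set qX := qf X x + qf X y.
have qX0 : 0 <= qX by rewrite addr_ge0 // posdef_ge0.
set VV := qf V u + qf V v.
have hV : (kp / 2) * qX <= (1 + (kp / 2)^-1) * (c1 * VV).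
  have hXV : (1 + (kp / 2)^-1) * (qf X u + qf X v) <= (1 + (kp / 2)^-1) * (c1 * VV).
    rewrite ler_wpM2l ?addr_ge0 ?invr_ge0 ?(ltW h2) //.
    by have := hc1 u; have := hc1 v; rewrite !mul1mx /VV mulrDr; lra.
  have : (1 + kp / 2) * (1 - kp) * qX <= (1 - kp / 2) * qX.
    by rewrite ler_wpM2r //; nra.
  rewrite /qX in hXV qX0 *; move: hrot hx hy hXV; lra.
have hdot : dot x x + dot y y <= c2 * qX.
  by have := hc2 x; have := hc2 y; rewrite !mul1mx !qf1 /qX mulrDr; lra.
have hd : d * (dot x x + dot y y) <= e / 2 * VV.
  have : d * (dot x x + dot y y) <= d * (c2 * qX) by rewrite ler_pM2l.
  have -> : d * (c2 * qX) = e / 2 / ((1 + (kp / 2)^-1) * c1) * (kp / 2 * qX).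
    rewrite /d /cc; field.
    by rewrite !gt_eqF //= addr_gt0.
  have hpos : 0 < e / 2 / ((1 + (kp / 2)^-1) * c1).
    by rewrite !divr_gt0 // mulr_gt0 // addr_gt0 // invr_gt0.
  move/le_trans; apply; apply: (@le_trans _ _ (e / 2 / ((1 + (kp / 2)^-1) * c1) * ((1 + (kp / 2)^-1) * (c1 * VV)))).
    by rewrite ler_pM2l.
  rewrite le_eqVlt; apply/orP; left; apply/eqP; field.
  by rewrite !gt_eqF //= addr_gt0.
by rewrite -scalemx1 !qfL; rewrite mulrDr in hd; lra.
Qed.

Lemma fdi_strict_super a q (e : F) : possemidefmx q -> stab a -> 0 < e -> fdi V a q e ->
  exists U, strict_super V a q U.
Proof.
move=> pq sa e0 hf; have [d d0 hd] := fdi_strengthen sa e0 hf.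
have e20 : 0 < e / 2 by rewrite divr_gt0.
have pqd : possemidefmx (q + d%:M).
  apply: possemidefD => //; rewrite -scalemx1; apply: possemidefZ; first exact: ltW.
  exact/posdef_possemidef/posdef1.
have gV : posdefmx (V - (1 - e / 2) *: V).
  have -> : V - (1 - e / 2) *: V = (e / 2) *: V by rewrite scalerBl scale1r opprB addrC subrK.
  exact: posdefZ.
have [k x|P [pP leP eP]] := @vi_lim _ _ _ pV a (q + d%:M) ((1 - e / 2) *: V) pqd gV.
  exact: vi_bound.
exists P; split => //; first exact: (gap_le pV (possemidef_sym pP) leP gV).
exists d => // x; rewrite -[in leRHS]eP !qf_Ric // -scalemx1 !qfL; lra.
Qed.

(** Rotation preserves the summed form of [U], so its terms cancel, and [tp_sup] at the actual
    disturbance leaves the slack [d |x|^2]. Since [cc] bounds the price of the disturbance by the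
    state, the margin is [d / cc]. *)
Lemma strict_super_fdi a q U : strict_super V a q U ->
  exists2 e : F, 0 < e & fdi V a q e.
Proof.
move=> [pU gU [d d0 h]]; have psV := posdef_possemidef pV.
have [c1 c10 hc1] := @posdef_compare _ _ _ 1%:M V 1%:M (posdef1 F m).
have [c2 c20 hc2] := @posdef_compare _ _ _ 1%:M V a (posdef1 F m).
pose cc := 2 * (c1 + c2); have cc0 : 0 < cc by rewrite mulr_gt0 // addr_gt0.
exists (d / cc); first by rewrite divr_gt0.
move=> c s x y cs; set x' := c *: x - s *: y; set y' := s *: x + c *: y.
set u := x' - a *m x; set v := y' - a *m y.
have hrot (M : 'M[F]_m) : qf M x' + qf M y' = qf M x + qf M y.
  by rewrite qf_rot cs mul1r.
have hx : qf U x' - qf V u <= qf (tp V U) (a *m x).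
  by have := tp_sup pV (a *m x) u gU; rewrite /u [a *m x + _]addrC subrK.
have hy : qf U y' - qf V v <= qf (tp V U) (a *m y).
  by have := tp_sup pV (a *m y) v gU; rewrite /v [a *m y + _]addrC subrK.
have := lerD (h x) (h y); rewrite !qf_Ric // => hxy.
have hu (z z' : 'cV[F]_m) : qf V (z' - a *m z) <= 2 * qf V z' + 2 * qf V (a *m z).
  have := qf_addle z' (- (a *m z)) psV (ltr01 : 0 < 1 :> F).
  by rewrite qf_opp invr1; lra.
have hVV : qf V u + qf V v <= cc * (dot x x + dot y y).
  have := hu x x'; have := hu y y'; have := hc1 x; have := hc1 y.
  have := hc2 x; have := hc2 y; have := hrot V.
  rewrite !mul1mx !qf1 -/u -/v /cc; lra.
have hd : d / cc * (qf V u + qf V v) <= d * (dot x x + dot y y).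
  by rewrite mulrAC ler_pdivrMr // -mulrA [_ * cc]mulrC ler_pM2l.
have := hrot U; lra.
Qed.

End BoundedReal.

(** * The transfer function *)

Section ComplexForms.
Variable F : realType.
Local Notation C := F[i].
Local Notation normc := (@Normc.normc F).
Local Notation CRe := (@complex.Re F).
Local Notation CIm := (@complex.Im F).
Local Notation "M ^H" := ((map_mx Num.conj M)^T) (at level 2, format "M ^H").

Definition csq n (v : 'cV[C]_n) : F :=
  dot (map_mx CRe v) (map_mx CRe v) + dot (map_mx CIm v) (map_mx CIm v).

Lemma conj_cmx m n (M : 'M[F]_(m, n)) : map_mx Num.conj (cmx M) = cmx M.
Proof. by apply/matrixP => i j; rewrite !mxE /Num.conj /= oppr0. Qed.

Lemma conj_expj (t : F) : (expj t)^* = expj (- t).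
Proof. by rewrite /expj cosN sinN. Qed.

Lemma csqE n (v : 'cV[C]_n) : (v^H *m v) 0 0 = real_complex F (csq v).
Proof.
rewrite mxE /csq !dotE rmorphD !rmorph_sum -big_split /=; apply: eq_bigr => i _.
rewrite !mxE; case: (v i 0) => a b; rewrite /Num.conj /=.
by apply/eqP; rewrite eq_complex /=; apply/andP; split; apply/eqP; ring.
Qed.

Lemma csq_ge0 n (v : 'cV[C]_n) : 0 <= csq v.
Proof. by rewrite addr_ge0 // dot_ge0. Qed.

Lemma csq_gt0 n (v : 'cV[C]_n) : v != 0 -> 0 < csq v.
Proof.
move=> v0; rewrite lt_def csq_ge0 andbT; apply: contra_neqN v0.
rewrite paddr_eq0 ?dot_ge0 // => /andP[/eqP/dot_eq0 a0 /eqP/dot_eq0 b0].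
apply/matrixP => i j; have := congr1 (fun w : 'cV[F]_n => w i 0) a0.
have := congr1 (fun w : 'cV[F]_n => w i 0) b0; rewrite !mxE (ord1 j).
by case: (v i 0) => a b /= -> ->.
Qed.

Lemma eigenvalue_bounded n (M : 'M[C]_n) :
  exists b : F, forall x : F, eigenvalue M (real_complex F x) -> x <= b.
Proof.
have [r Mr] := roots_char_poly M.
exists (\big[Num.max/0]_(z <- r) normc z) => x; rewrite (eigenvalue_roots _ Mr) => xr.
apply: (@le_trans _ _ (normc (real_complex F x))).
  by rewrite normc_real ler_norm.
exact: le_bigmax_seq.
Qed.

Lemma le_lambda_max n (M : 'M[C]_n) (x : F) :
  eigenvalue M (real_complex F x) -> x <= lambda_max M.
Proof.
move=> Mx; apply: ub_le_sup => //; have [b hb] := eigenvalue_bounded M.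
by exists b => y; apply: hb.
Qed.

(** [0 <= b] covers an empty set of real eigenvalues, where [sup] is 0. *)
Lemma lambda_max_le n (M : 'M[C]_n) (b : F) : 0 <= b ->
  (forall x : F, eigenvalue M (real_complex F x) -> x <= b) -> lambda_max M <= b.
Proof.
move=> b0 h; rewrite /lambda_max; set E := [set x | _].
have [E0|nE] := pselect (E !=set0); first by apply: ge_sup => // x; apply: h.
suff -> : E = set0 by rewrite sup0.
by apply/seteqP; split => // x Ex; case: nE; exists x.
Qed.

Lemma rayleigh_le n (H : 'M[C]_n) (u : 'cV[C]_n) (b : F) : H^H = H ->
  (u^H *m H *m u) 0 0 = real_complex F b -> b <= lambda_max H * csq u.
Proof.
move=> sH hb.
have hH : H \is hermsymmx by apply/is_hermitianmxP; rewrite expr0 scale1r -map_trmx sH.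
have rd := hermitian_spectral_diag_real hH.
have /hermitian_normalmx/orthomx_spectralP := hH.
set P := spectralmx H; set sp := spectral_diag H => eH.
have uP : P \in unitmx := spectral_unit H.
have eP : invmx P = P^H by rewrite invmx_unitary ?spectral_unitarymx // map_trmx.
have reald j : sp 0 j = real_complex F (CRe (sp 0 j)).
  by rewrite RRe_real // (mxOverP rd).
have le_sp j : CRe (sp 0 j) <= lambda_max H.
  apply: le_lambda_max; rewrite -reald; apply/eigenvalueP; exists (row j P).
    by rewrite -row_mul eH !mulmxA mulmxV // mul1mx row_mul row_diag_mx -scalemxAl -rowE.
  by apply: contraTneq uP => r0; rewrite -row_free_unit; apply/row_freeP => -[Q];
    move/(congr1 (row j)); rewrite row_mul r0 mul0mx row1 => /rowP/(_ j);
    rewrite !mxE !eqxx => /eqP; rewrite eq_sym oner_eq0.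
set y := P *m u.
have uy : u^H *m H *m u = y^H *m diag_mx sp *m y.
  by rewrite eH eP /y map_mxM trmx_mul !mulmxA.
have cy : csq y = csq u.
  apply: complexI; rewrite -!csqE /y map_mxM trmx_mul -eP !mulmxA.
  by rewrite mulmxKV.
move: y uy cy => y uy cy.
have sq_csq : csq y = \sum_j normc (y j 0) ^+ 2.
  rewrite /csq !dotE -big_split; apply: eq_bigr => j _ /=.
  by rewrite !mxE normc_sqr !expr2.
have eb : b = \sum_j CRe (sp 0 j) * normc (y j 0) ^+ 2.
  apply: complexI; rewrite -hb uy mul_mx_diag mxE rmorph_sum; apply: eq_bigr => j _.
  rewrite !mxE {1}reald normc_sqr; case: (y j 0) => p q; rewrite /Num.conj /=.
  by apply/eqP; rewrite eq_complex /=; apply/andP; split; apply/eqP; ring. 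
rewrite eb -cy sq_csq mulr_sumr; apply: ler_sum => j _.
by rewrite ler_wpM2r // sqr_ge0.
Qed.

Lemma stab_resolvent n (M : 'M[F]_n) (z : C) : stab M -> normc z = 1 ->
  z%:M - cmx M \in unitmx.
Proof.
move=> sM z1; rewrite -row_free_unit -kermx_eq0; apply/rowV0P => v /sub_kermxP.
rewrite mulmxBr mul_mx_scalar => /eqP; rewrite subr_eq0 => /eqP e.
apply/eqP; apply: contraT => v0.
have /sM : eigenvalue (cmx M) z by apply/eigenvalueP; exists v.
by rewrite z1 ltxx.
Qed.

Lemma circle_expj (c s : F) : c ^+ 2 + s ^+ 2 = 1 ->
  exists2 t : F, 0 <= t < 2 * pi & cos t = c /\ sin t = s.
Proof.
move=> cs; have c1 : -1 <= c <= 1.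
  have : c ^+ 2 <= 1 by have := sqr_ge0 s; lra.
  by rewrite -ler_norml -{1}(expr1n _ 2) -real_normK ?num_real // ler_pXn2r ?nnegrE.
have sa := sin_acos c1; have e : 1 - c ^+ 2 = s ^+ 2 by lra.
rewrite e sqrtr_sqr in sa.
have p0 := @pi_gt0 F; have a0 := acos_ge0 c1; have api := acos_lepi c1.
have [s0|s0] := leP 0 s.
  exists (acos c); first by rewrite a0 /=; lra.
  by rewrite acosK // sa ger0_norm.
exists (2 * pi - acos c).
  have a1 : acos c != 0.
    apply: contraTneq s0 => a1; rewrite a1 sin0 in sa.
    by move/esym/eqP: sa; rewrite normr_eq0 => /eqP ->; rewrite ltxx.
  have : 0 < acos c by rewrite lt_def a1.
  by move=> ?; apply/andP; split; lra.
have -> : 2 * pi - acos c = - acos c + pi *+ 2 by rewrite mulr2n; ring.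
by rewrite cosD2pi sinD2pi cosN sinN acosK // sa ltr0_norm // opprK.
Qed.

End ComplexForms.

(** * Dictionary between the design data and the weight [V] *)

Section Design.
Variables (F : realType) (m d l n : nat).
Variables (A : 'M[F]_m) (B : 'M[F]_(m, d)) (C : 'M[F]_(l, m)).
Variables (D : 'M[F]_(m, n)) (R : 'M[F]_d) (gamma : F).
Hypothesis pR : posdefmx R.
Hypothesis g0 : 0 < gamma.
Hypothesis pDD : posdefmx (D *m D^T).

Local Notation "M ^H" := ((map_mx Num.conj M)^T) (at level 2, format "M ^H").

(** [qf V v] is the least [gamma^2 |w|^2] among the inputs [w] with [D *m w = v] (see [dot_lift] and
    [qf_dweight_le]): [V] prices disturbances directly in state space. *)
Definition dweight : 'M[F]_m := gamma ^+ 2 *: invmx (D *m D^T).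
Local Notation V := dweight.

Let g2 : 0 < gamma ^+ 2. Proof. by rewrite exprn_gt0. Qed.
Let g2n : gamma ^+ 2 != 0. Proof. by rewrite gt_eqF. Qed.
Let uDD : D *m D^T \in unitmx := posdef_unit pDD.

Lemma posdef_dweight : posdefmx V.
Proof. by apply: posdefZ => //; apply: posdef_inv. Qed.

Let sV := posdef_sym posdef_dweight.

Definition lift_dist : 'M[F]_(n, m) := D^T *m invmx (D *m D^T).
Local Notation G := lift_dist.

Lemma mul_lift p (x : 'M[F]_(m, p)) : D *m (G *m x) = x.
Proof. by rewrite /G !mulmxA mulmxV // mul1mx. Qed.

Lemma dot_lift x : dot (G *m x) (G *m x) = gamma ^- 2 * qf V x.
Proof.
rewrite -qf_gram /V qfZ mulrA mulVf // mul1r; congr (qf _ x).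
by rewrite /G trmx_mul trmxK trmx_inv (posdef_sym pDD) -!mulmxA
  [D *m (_ *m _)]mulmxA mulmxV // mulmx1.
Qed.

Lemma qf_dweight_le u : qf V (D *m u) <= gamma ^+ 2 * dot u u.
Proof.
have e : dot u (G *m (D *m u)) = gamma ^- 2 * qf V (D *m u).
  by rewrite /G -mulmxA dot_mul trmxK /V qfZ mulrA mulVf // mul1r.
have := dot_ge0 (u - G *m (D *m u)).
rewrite !dotL (dotC _ u) e dot_lift => h.
have : gamma ^- 2 * qf V (D *m u) <= dot u u by lra.
by rewrite ler_pdivrMl.
Qed.

Lemma gapP P : P^T = P ->
  posdefmx (1%:M - gamma ^- 2 *: (D^T *m P *m D)) <-> posdefmx (V - P).
Proof.
move=> sP; have sQ : (1%:M - gamma ^- 2 *: (D^T *m P *m D))^T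
    = 1%:M - gamma ^- 2 *: (D^T *m P *m D).
  by rewrite linearB linearZ /= trmx1 possemidef_trsym.
have sN : (V - P)^T = V - P by rewrite linearB /= sV sP.
have q1 x : qf (1%:M - gamma ^- 2 *: (D^T *m P *m D)) x
    = dot x x - gamma ^- 2 * qf P (D *m x).
  by rewrite qfD qfN qfZ qf1 qf_congr.
split=> h; apply/posdefP; split => // x x0.
  have Gx0 : G *m x != 0.
    by apply: contra_neq x0 => e; rewrite -[x]mul_lift e mulmx0.
  have := posdef_gt0 h Gx0; rewrite q1 mul_lift dot_lift -mulrBr.
  by rewrite pmulr_rgt0 ?invr_gt0 // qfD qfN.
have [e|y0] := eqVneq (D *m x) 0; rewrite q1.
  by rewrite e qf0 mulr0 subr0 dot_gt0.
have := posdef_gt0 h y0; rewrite qfD qfN => hy.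
have := qf_dweight_le x => hx; rewrite subr_gt0 ltr_pdivrMl //; lra.
Qed.

Lemma one_sub_gap P :
  1%:M - gamma ^- 2 *: (P *m D *m D^T) = (V - P) *m (gamma ^- 2 *: (D *m D^T)).
Proof.
rewrite mulmxBl -!scalemxAr -scalemxAl scalerA mulVf // scale1r mulVmx //.
by rewrite mulmxA.
Qed.

Lemma dweightK : V *m (gamma ^- 2 *: (D *m D^T)) = 1%:M.
Proof. by rewrite -scalemxAr -scalemxAl scalerA mulVf // scale1r mulVmx. Qed.

(** Push-through identity: multiplied by [1 - W P], with [W] the inverse of [V], both expressions
    give [P], and [1 - W P = W (V - P)] is invertible. *)
Lemma tildeP_tp P : P^T = P -> posdefmx (V - P) -> tildeP D gamma P = tp V P.
Proof.
move=> sP gP; have uN := posdef_unit gP; have uV := posdef_unit posdef_dweight.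
set Z := (gamma ^+ 2)%:M - D^T *m P *m D.
have uZ : Z \in unitmx.
  have -> : Z = gamma ^+ 2 *: (1%:M - gamma ^- 2 *: (D^T *m P *m D)).
    by rewrite scalerBr scalerA mulfV // scale1r scalemx1.
  by apply/posdef_unit/posdefZ => //; apply/gapP.
set W := gamma ^- 2 *: (D *m D^T).
have key : tildeP D gamma P *m (1%:M - W *m P) = P.
  have e1 : D^T *m P *m (1%:M - W *m P) = gamma ^- 2 *: (Z *m (D^T *m P)).
    rewrite mulmxBr mulmx1 /Z mulmxBl mul_scalar_mx scalerBr scalerA mulVf //.
    by rewrite scale1r /W -scalemxAl -scalemxAr !mulmxA.
  rewrite /tildeP -/Z mulmxDl -[_ *m D^T *m P]mulmxA -[X in _ + X]mulmxA e1.
  rewrite -scalemxAr !mulmxA mulmxKV // mulmxBr mulmx1 /W -scalemxAl -scalemxAr.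
  by rewrite !mulmxA subrK.
have e : 1%:M - W *m P = W *m (V - P).
  rewrite mulmxBr; congr (_ - _).
  by rewrite /W /V -scalemxAl -scalemxAr scalerA mulVf // scale1r mulmxV.
have WV : V *m W = 1%:M := dweightK.
have uW : W \in unitmx by have [] := mulmx1_unit WV.
rewrite e mulmxA in key.
have : tildeP D gamma P *m W = P *m invmx (V - P) 
  by apply: (can_inj (mulmxK uN)); rewrite key mulmxKV.
move/(congr1 (mulmx^~ V)).
have VW : W *m V = 1%:M := mulmx1C WV.
rewrite -mulmxA VW mulmx1 => ->; rewrite /tp.
rewrite mul_gap_inv //.
by rewrite mulmxBl mul1mx.
Qed.

Lemma closed_loopE P a : P^T = P -> posdefmx (V - P) ->
  (invmx (1%:M - gamma ^- 2 *: (P *m D *m D^T)))^T *m a = lc V P a.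
Proof.
move=> sP gP; rewrite one_sub_gap /lc; congr (_ *m _).
have uN := posdef_unit gP; have WV := dweightK.
have uW : gamma ^- 2 *: (D *m D^T) \in unitmx by have [] := mulmx1_unit WV.
rewrite trmx_inv trmx_mul linearZ /= (posdef_sym pDD) (posdef_sym gP).
set W := gamma ^- 2 *: (D *m D^T) in WV uW *.
have uWN : W *m (V - P) \in unitmx by rewrite unitmx_mul uW uN.
apply: (can_inj (mulKmx uWN)); rewrite mulmxV // mulmxA.
by rewrite mulmxK // (mulmx1C WV).
Qed.

Lemma stage_cost_possemidef K : possemidefmx (stage_cost C R K).
Proof.
apply: possemidefD; first exact: possemidef_gram.
exact/possemidef_congr/posdef_possemidef.
Qed.

Lemma stabilizing_solutionP K P :
  stabilizing_solution A B C D R gamma K P <->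
  stabsol V (A - B *m K) (stage_cost C R K) P.
Proof.
split.
  case=> pP eP gP sP; have symP := possemidef_sym pP.
  have {}gP : posdefmx (V - P) by apply/gapP.
  split => //.
    by move: eP => /eqP; rewrite subr_eq0 tildeP_tp // => /eqP.
  by apply/spectral_radius_lt1; rewrite -closed_loopE.
case=> pP gP eP sP; have symP := possemidef_sym pP; split => //.
- by rewrite tildeP_tp // -/(Ric V _ _ P) eP subrr.
- exact/gapP.
- by rewrite /stablemat closed_loopE //; apply/spectral_radius_lt1.
Qed.

(** [one_sub_gap] factors the nonsymmetric matrix under the determinant as [V - P] times the inverse
    of [V]. *)
Lemma cost_gap K P : P = riccati A B C D R gamma K -> posdefmx (V - P) ->
  cost A B C D R gamma K
  = gamma ^+ 2 * (ln (\det V) - ln (\det (V - P))).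
Proof.
move=> -> gP; rewrite /cost one_sub_gap det_mulmx.
have dV := posdef_det_gt0 posdef_dweight.
have -> : \det (gamma ^- 2 *: (D *m D^T)) = (\det V)^-1.
  apply: (mulfI (lt0r_neq0 dV)); rewrite mulfV ?lt0r_neq0 //.
  by rewrite -det_mulmx dweightK det1.
rewrite ln_div ?posrE ?posdef_det_gt0 //; first by ring.
exact: posdef_dweight.
Qed.

(** * Feasibility expressed by the frequency inequality *)

Section TransferFunction.
Variable K : 'M[F]_(d, m).
Local Notation a := (A - B *m K).
Local Notation q := (stage_cost C R K).
Local Notation T := (transfer A B C D R K).
Local Notation CRe := (@complex.Re F).
Local Notation CIm := (@complex.Im F).

Let sqrt_sym : (sqrtmx q)^T = sqrtmx q.
Proof. exact/possemidef_sym/(sqrtmxP (stage_cost_possemidef K)).1. Qed.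

Lemma qf_sqrtmx x : dot (sqrtmx q *m x) (sqrtmx q *m x) = qf q x.
Proof.
by rewrite -qf_gram sqrt_sym (sqrtmxP (stage_cost_possemidef K)).2.
Qed.

(** The data are real, so conjugation only reverses the frequency; the plain transpose at [- t] in
    [hinf_norm] is therefore a Hermitian adjoint. *)
Lemma conj_transfer t : map_mx Num.conj (T (expj t)) = T (expj (- t)).
Proof.
rewrite /transfer !map_mxM !conj_cmx map_invmx; congr (_ *m invmx _ *m _).
by rewrite raddfB /= conj_cmx map_scalar_mx /= conj_expj.
Qed.

Lemma transfer_gram_herm t :
  ((T (expj (- t)))^T *m T (expj t))^H = (T (expj (- t)))^T *m T (expj t).
Proof.
have <- : map_mx Num.conj (T (expj t)) = T (expj (- t)) by exact: conj_transfer.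
by move: (T (expj t)) => M; rewrite map_mxM trmx_mul -map_trmx trmxK map_mxCK.
Qed.

Lemma csq_state (xi : 'cV[F[i]]_m) :
  csq (cmx (sqrtmx q) *m xi) = qf q (map_mx CRe xi) + qf q (map_mx CIm xi).
Proof. by rewrite /csq Re_cmx_mul Im_cmx_mul !qf_sqrtmx. Qed.

Lemma csq_transfer t u :
  (u^H *m ((T (expj (- t)))^T *m T (expj t)) *m u) 0 0
  = real_complex F (csq (T (expj t) *m u)).
Proof.
have <- : map_mx Num.conj (T (expj t)) = T (expj (- t)) by exact: conj_transfer.
move: (T (expj t)) => M; rewrite -csqE; congr (fun_of_matrix _ 0 0).
by rewrite map_mxM trmx_mul !mulmxA.
Qed.

Lemma normc_expj (t : F) : Normc.normc (expj t) = 1.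
Proof. by rewrite /= cos2Dsin2 sqrtr1. Qed.

(** A state [xi] at frequency [z] is excited by [w = (z - a) xi], and [lift_dist] realises [w] by
    the input of least norm; the bound on the transfer function then compares [q] at [xi] with [V]
    at [w]. *)
Lemma feasible_fdi : feasible A B C D R gamma K ->
  stab a /\ exists2 e : F, 0 < e & fdi V a q e.
Proof.
case=> /spectral_radius_lt1 sa hinf; split => //.
have [r r0 [rg hr]] : exists2 r : F, 0 <= r & r < gamma /\
    forall t, 0 <= t < 2 * pi ->
      lambda_max ((T (expj (- t)))^T *m T (expj t)) <= r ^+ 2.
  set h := hinf_norm A B C D R K in hinf *.
  have hub t : 0 <= t < 2 * pi -> ((Num.sqrt (lambda_max
      ((T (expj (- t)))^T *m T (expj t))))%:E <= h)%E.
    by move=> ht; apply: ereal_sup_ubound; exists t.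
  have h00 : (0 <= h)%E.
    apply: le_trans (hub 0 _); first by rewrite lee_fin sqrtr_ge0.
    by rewrite lexx /= mulr_gt0 ?pi_gt0.
  have fh : h \is a fin_num.
    by rewrite ge0_fin_numE // (lt_trans hinf) ?ltry.
  exists (fine h); first exact: fine_ge0.
  split=> [|t ht]; first by rewrite -lte_fin fineK.
  have := hub t ht; rewrite -{1}(fineK fh) lee_fin => hle.
  set L := lambda_max _ in hle *.
  (* [Num.sqrt] vanishes at negative arguments, so the bound on the root controls [L] only when
     [0 <= L]. *)
  have [L0|/ltW L0] := leP 0 L; last by rewrite (le_trans L0) // sqr_ge0.
  by rewrite -(sqr_sqrtr L0) ler_pXn2r // nnegrE ?sqrtr_ge0 // fine_ge0.
exists (1 - r ^+ 2 / gamma ^+ 2).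
  by rewrite subr_gt0 ltr_pdivrMr // mul1r ltr_pXn2r // nnegrE // ltW.
move=> c s x y /circle_expj[t ht [ct st]]; rewrite subKr.
pose xi : 'cV[F[i]]_m := \col_i Complex (x i 0) (y i 0).
have Rxi : map_mx CRe xi = x by apply/matrixP => i j; rewrite !mxE (ord1 j).
have Ixi : map_mx CIm xi = y by apply/matrixP => i j; rewrite !mxE (ord1 j).
pose w := ((expj t)%:M - cmx a) *m xi.
have Rw : map_mx CRe w = c *: x - s *: y - a *m x.
  rewrite /w mulmxBl mul_scalar_mx raddfB /= Re_scale Re_cmx_mul Rxi Ixi.
  by rewrite /= ct st.
have Iw : map_mx CIm w = s *: x + c *: y - a *m y.
  rewrite /w mulmxBl mul_scalar_mx raddfB /= Im_scale Im_cmx_mul Rxi Ixi.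
  by rewrite /= ct st.
pose u := cmx G *m w.
have Tu : T (expj t) *m u = cmx (sqrtmx q) *m xi.
  rewrite /transfer -!mulmxA; congr (_ *m _).
  have -> : cmx D *m u = w.
    by rewrite /u mulmxA -real_cplx_mulmx -[D *m G]mulmx1 -mulmxA mul_lift
      /cmx map_mx1 mul1mx.
  by rewrite /w mulKmx // stab_resolvent // normc_expj.
have := rayleigh_le (transfer_gram_herm t) (csq_transfer t u).
rewrite Tu csq_state Rxi Ixi => /le_trans; apply.
have -> : csq u = gamma ^- 2 * (qf V (map_mx CRe w) + qf V (map_mx CIm w)).
  by rewrite /u /csq Re_cmx_mul Im_cmx_mul !dot_lift mulrDr.
rewrite Rw Iw mulrA ler_wpM2r //.
  by rewrite addr_ge0 // posdef_ge0 //; exact: posdef_dweight.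
by rewrite ler_wpM2r ?invr_ge0 ?(ltW g2) // hr.
Qed.

Lemma fdi_feasible (e : F) : stab a -> 0 < e -> fdi V a q e ->
  feasible A B C D R gamma K.
Proof.
move=> sa e0 hf; split; first exact/spectral_radius_lt1.
(* Truncation at 1 keeps [1 - f] nonnegative, as [lambda_max_le] requires. *)
pose f := Num.min e 1; have f0 : 0 < f by rewrite lt_min e0 ltr01.
have f1 : 0 <= 1 - f by rewrite subr_ge0 ge_min lexx orbT.
have {}hf : fdi V a q f.
  move=> c s x y cs; apply: le_trans (hf c s x y cs) _.
  rewrite ler_wpM2r ?lerD2l ?lerN2 ?ge_min ?lexx //.
  by rewrite addr_ge0 // posdef_ge0 //; exact: posdef_dweight.
have key t : lambda_max ((T (expj (- t)))^T *m T (expj t)) <= (1 - f) * gamma ^+ 2.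
  apply: lambda_max_le => [|lam]; first by rewrite mulr_ge0 // ltW.
  set H := _ *m _; have sH : H^H = H := transfer_gram_herm t.
  move=> /eigenvalueP[v vH v0]; pose u := v^H.
  have u0 : u != 0 by rewrite trmx_eq0 map_mx_eq0.
  have uE : u^H *m H = real_complex F lam *: u^H.
    have -> : u^H = v by rewrite /u -map_trmx trmxK map_mxCK.
    exact: vH.
  have := csq_transfer t u; rewrite uE -scalemxAl mxE csqE -rmorphM => /complexI lamE.
  pose xi := invmx ((expj t)%:M - cmx a) *m (cmx D *m u).
  have Tu : T (expj t) *m u = cmx (sqrtmx q) *m xi by rewrite /transfer !mulmxA.
  have wE : ((expj t)%:M - cmx a) *m xi = cmx D *m u.
    by rewrite /xi mulKVmx // stab_resolvent // normc_expj.
  have := hf (cos t) (sin t) (map_mx CRe xi) (map_mx CIm xi) (cos2Dsin2 t).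
  have <- : map_mx CRe (cmx D *m u) = cos t *: map_mx CRe xi - sin t *: map_mx CIm xi
       - a *m map_mx CRe xi.
    by rewrite -wE mulmxBl mul_scalar_mx raddfB /= Re_scale Re_cmx_mul.
  have <- : map_mx CIm (cmx D *m u) = sin t *: map_mx CRe xi + cos t *: map_mx CIm xi
       - a *m map_mx CIm xi.
    by rewrite -wE mulmxBl mul_scalar_mx raddfB /= Im_scale Im_cmx_mul.
  rewrite -csq_state -Tu -lamE Re_cmx_mul Im_cmx_mul => h.
  rewrite -(ler_pM2r (csq_gt0 u0)); apply: le_trans h _.
  rewrite -mulrA ler_wpM2l // /csq mulrDr lerD //; exact: qf_dweight_le.
have sg : Num.sqrt ((1 - f) * gamma ^+ 2) < gamma.
  rewrite -[ltRHS](ger0_norm (ltW g0)) -sqrtr_sqr ltr_sqrt //.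
  by rewrite gtr_pMl // ltrBlDr ltrDl.
apply: le_lt_trans (_ : _ <= (Num.sqrt ((1 - f) * gamma ^+ 2))%:E)%E _.
  by apply: ge_ereal_sup => _ [t _ <-]; rewrite lee_fin ler_wsqrtr.
by rewrite lte_fin.
Qed.

(** Strict bounded real lemma; the frequency response does not appear beyond this point. *)
Lemma feasibleP : feasible A B C D R gamma K <-> exists U, strict_super V a q U.
Proof.
have pq := stage_cost_possemidef K; have pV := posdef_dweight; split.
  by move=> /feasible_fdi[sa [e e0 hf]]; apply: fdi_strict_super hf.
move=> [U hU]; have [e e0 hf] := strict_super_fdi pV hU.
by apply: fdi_feasible hf => //; apply: strict_super_stab hU.
Qed.

End TransferFunction.

End Design.

(** * Limits of stable matrices and the Stein equation *)

Section StabilityLimits.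
Variable F : realType.
Local Notation C := F[i].
Local Notation normc := (@Normc.normc F).
Local Notation CRe := (@complex.Re F).
Local Notation CIm := (@complex.Im F).

Definition ccvg (u : nat -> C) (l : C) : Prop :=
  (fun k => CRe (u k)) @ \oo --> CRe l /\ (fun k => CIm (u k)) @ \oo --> CIm l.

Lemma ccvg_cst l : ccvg (fun=> l) l.
Proof. by split; apply: cvg_cst. Qed.

Lemma ccvgD u v a b : ccvg u a -> ccvg v b -> ccvg (fun k => u k + v k) (a + b).
Proof.
move=> [ua ua'] [vb vb']; split; rewrite raddfD.
  by under eq_fun do rewrite raddfD; apply: cvgD.
by under eq_fun do rewrite raddfD; apply: cvgD.
Qed.

Lemma ccvgM u v a b : ccvg u a -> ccvg v b -> ccvg (fun k => u k * v k) (a * b).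
Proof.
have eR (x y : C) : CRe (x * y) = CRe x * CRe y - CIm x * CIm y.
  by case: x y => ? ? [].
have eI (x y : C) : CIm (x * y) = CRe x * CIm y + CIm x * CRe y.
  by case: x y => ? ? [].
move=> [ua ua'] [vb vb']; split.
  by rewrite eR; under eq_fun do rewrite eR; apply: cvgB; apply: cvgM.
by rewrite eI; under eq_fun do rewrite eI; apply: cvgD; apply: cvgM.
Qed.

Lemma ccvg_det n (U : nat -> 'M[C]_n) (L : 'M[C]_n) :
  (forall i j, ccvg (fun k => U k i j) (L i j)) ->
  ccvg (fun k => \det (U k)) (\det L).
Proof.
move=> h; rewrite /determinant; elim: (index_enum _) => [|s r IH].
  by rewrite big_nil; under eq_fun do rewrite big_nil; apply: ccvg_cst.
rewrite big_cons; under eq_fun do rewrite big_cons.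
apply: ccvgD => //; apply: ccvgM; first exact: ccvg_cst.
elim: (index_enum _) => [|i r' IH'].
  by rewrite big_nil; under eq_fun do rewrite big_nil; apply: ccvg_cst.
by rewrite big_cons; under eq_fun do rewrite big_cons; apply: ccvgM.
Qed.

Lemma det_sub_char_poly n (M : 'M[C]_n) z : \det (z%:M - M) = (char_poly M).[z].
Proof.
rewrite -horner_evalE /char_poly -det_map_mx; congr (\det _).
apply/matrixP => i j; rewrite !mxE /= /horner_eval !hornerE.
by case: eqP => _; rewrite ?hornerE.
Qed.

(** If [|z| > 1], all factors of the characteristic polynomial of [U k] at [z] have modulus at least
    [|z| - 1], so the limit determinant cannot vanish. *)
Lemma stab_limit n (U : nat -> 'M[F]_n) L : (forall k, stab (U k)) -> mcvg U L ->
  forall z, eigenvalue (cmx L) z -> normc z <= 1.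
Proof.
move=> sU UL z Lz; rewrite leNgt; apply/negP => z1.
have lb k : (normc z - 1) ^+ n <= normc (\det (z%:M - cmx (U k))).
  have [r Ur] := roots_char_poly (cmx (U k)).
  have sr : size r = n.
    have := size_char_poly (cmx (U k)); rewrite Ur size_prod_XsubC.
    by case.
  have hr : {in r, forall y, normc y < 1}.
    by move=> y yr; apply: (sU k); rewrite (eigenvalue_roots _ Ur).
  rewrite det_sub_char_poly Ur horner_prod -{1}sr.
  elim: r hr {sr Ur} => [|y r IH] hr; first by rewrite big_nil expr0 Normc.normc1.
  rewrite big_cons /= exprS Normc.normcM hornerXsubC; apply: ler_pM.
  - by rewrite subr_ge0 ltW.
  - by rewrite exprn_ge0 // subr_ge0 ltW.
  - have := le_normcD (z - y) y; rewrite subrK.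
    by have := hr y (mem_head _ _); lra.
  - by apply: IH => w wr; apply: hr; rewrite inE wr orbT.
have [dR dI] : ccvg (fun k => \det (z%:M - cmx (U k))) (\det (z%:M - cmx L)).
  apply: ccvg_det => i j; rewrite !mxE; under eq_fun do rewrite !mxE.
  apply: ccvgD; first exact: ccvg_cst.
  split; rewrite /=; last by under eq_fun do rewrite /=; apply: cvg_cst.
  by apply: cvgN; apply: UL.
have d0 : \det (z%:M - cmx L) = 0.
  rewrite det_sub_char_poly; apply/eqP.
  by rewrite -/(root _ z) -eigenvalue_root_char.
have h : (fun k => normc (\det (z%:M - cmx (U k))) ^+ 2) @ \oo --> (0 : F).
  under eq_fun do rewrite normc_sqr.
  have -> : 0 = CRe (\det (z%:M - cmx L)) * CRe (\det (z%:M - cmx L))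
     + CIm (\det (z%:M - cmx L)) * CIm (\det (z%:M - cmx L)) :> F.
    by rewrite d0 /= mulr0 addr0.
  by under eq_fun do rewrite !expr2; apply: cvgD; apply: cvgM.
have p0 : 0 < (normc z - 1) ^+ n by rewrite exprn_gt0 // subr_gt0.
have : ((normc z - 1) ^+ n) ^+ 2 <= 0.
  apply: (@cvg_le _ (fun=> ((normc z - 1) ^+ n) ^+ 2) _ _ _ _ h).
    exact: cvg_cst.
  by move=> k; rewrite ler_pXn2r // nnegrE ?normc_ge0 // ltW.
by rewrite leNgt exprn_gt0.
Qed.

Lemma eigenvalue_scale n (M : 'M[C]_n) r z : r != 0 ->
  eigenvalue (r *: M) z -> eigenvalue M (r^-1 * z).
Proof.
move=> r0 /eigenvalueP[v vM v0]; apply/eigenvalueP; exists v => //.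
by rewrite -scalerA -vM -scalemxAr scalerA mulVf // scale1r.
Qed.

Lemma stein_unique n (D L1 L2 : 'M[F]_n) :
  (forall z, eigenvalue (cmx L1) z -> normc z <= 1) -> stab L2 ->
  (forall x y, dot x (D *m y) = dot (L1 *m x) (D *m (L2 *m y))) -> D = 0.
Proof.
move=> e1 /stab_lyap[X2 [k [pX2 /andP[k0 k1] hX2]]] hD.
(* The factor [r] is moved from [L1] to [L2], leaving the equation intact: [r^-1 *: L1] becomes
   stable, and [r] is close enough to 1 for [r *: L2] to keep the rate [k / 2]. *)
pose r := Num.sqrt (1 + k / 2).
have r1 : 1 < r by rewrite -sqrtr1 ltr_sqrt // ?ltrDl ?divr_gt0 // addr_gt0 // divr_gt0.
have r0 : 0 < r by rewrite (lt_trans _ r1).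
have rr : r ^+ 2 = 1 + k / 2 by rewrite sqr_sqrtr // addr_ge0 // divr_ge0 // ltW.
have rn : r != 0 by rewrite gt_eqF.
have lX2 : lyap (r *: L2) X2 (k / 2).
  split=> //; first by apply/andP; split; lra.
  move=> x; rewrite -scalemxAl qfs rr.
  have := posdef_ge0 x pX2; have := hX2 x; set q := qf X2 x => h q0.
  apply: (@le_trans _ _ ((1 + k / 2) * ((1 - k) * q))).
    by rewrite ler_wpM2l //; lra.
  rewrite mulrA ler_wpM2r //; nra.
have /stab_lyap[X1 [k' lX1]] : stab (r^-1 *: L1).
  move=> z; have -> : cmx (r^-1 *: L1) = (real_complex F r)^-1 *: cmx L1.
    by apply/matrixP => i j; rewrite !mxE rmorphM fmorphV.
  move=> /eigenvalue_scale; rewrite invrK invr_eq0 => /(_ _) /e1.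
  rewrite Normc.normcM normc_real (ger0_norm (ltW r0)) => h.
  have : r * normc z <= 1.
    by apply: h; apply: contra_neq rn => /complexI.
  by move=> h'; rewrite -(ltr_pM2l r0) (le_lt_trans h') // mulr1.
have hD' x y : dot x (D *m y) = dot (r^-1 *: L1 *m x) (D *m (r *: L2 *m y)).
  by rewrite hD -!scalemxAl -!scalemxAr dotZl dotZr mulrA mulVf // mul1r.
have hit t x y : dot x (D *m y) = dot (iter t (mulmx (r^-1 *: L1)) x)
     (D *m iter t (mulmx (r *: L2)) y).
  by elim: t => //= t ->; rewrite hD'.
have [pX1 _ _] := lX1.
have [c1 c10 hc1] := @posdef_compare _ _ _ X1 1%:M 1%:M pX1.
have [c2 c20 hc2] := @posdef_compare _ _ _ X2 1%:M D pX2.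
have le0 x y : 2 * dot x (D *m y) <= 0.
  have h : (fun t => c1 * qf X1 (iter t (mulmx (r^-1 *: L1)) x)
     + c2 * qf X2 (iter t (mulmx (r *: L2)) y)) @ \oo --> c1 * 0 + c2 * 0.
    by apply: cvgD; apply: cvgMr; apply: lyap_iter; eassumption.
  rewrite !mulr0 addr0 in h.
  apply: (@cvg_le _ (fun=> 2 * dot x (D *m y)) _ _ _ _ h); first exact: cvg_cst.
  move=> t; rewrite (hit t x y); set u := iter t _ x; set w := iter t _ y.
  have := hc1 u; have := hc2 w; rewrite mul1mx !qf1.
  have := dot_ge0 (u - D *m w); rewrite !dotL (dotC (D *m w) u); lra.
have eq0 x y : dot x (D *m y) = 0.
  by have := le0 x y; have := le0 (- x) y; rewrite dotNl; lra.
apply/matrixP => i j; rewrite mxE -[RHS](eq0 (delta_mx i 0) (delta_mx j 0)).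
by rewrite /dot trmx_delta -rowE -colE !mxE.
Qed.

End StabilityLimits.

(** * Policy improvement *)

Section Improvement.
Variables (F : realType) (m d l : nat) (V A : 'M[F]_m) (B : 'M[F]_(m, d)).
Variables (C : 'M[F]_(l, m)) (R : 'M[F]_d).
Hypothesis pV : posdefmx V.
Hypothesis pR : posdefmx R.

Let sV : V^T = V := posdef_sym pV.
Let uV : V \in unitmx := posdef_unit pV.
Let sR : R^T = R := posdef_sym pR.

Local Notation acl K := (A - B *m K).
Local Notation q K := (stage_cost C R K).

(** [gain_mx], [grad_mx] and [bellman] take a free matrix [P]: policy improvement evaluates a new
    gain at the value matrix of the old one. *)
Definition gain_mx (P : 'M[F]_m) : 'M[F]_d := R + B^T *m tp V P *m B.

Definition grad_mx (P : 'M[F]_m) (K : 'M[F]_(d, m)) : 'M[F]_(d, m) :=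
  gain_mx P *m K - B^T *m tp V P *m A.

Definition bellman (P : 'M[F]_m) (K : 'M[F]_(d, m)) : 'M[F]_m :=
  Ric V (acl K) (q K) P.

Lemma qf_bell P K x :
  qf (bellman P K) x = qf (tp V P) (acl K *m x) + dot (C *m x) (C *m x) + qf R (K *m x).
Proof. by rewrite qf_Ric // /stage_cost (qfD (C^T *m C)) qf_gram qf_congr addrA. Qed.

Lemma tp_possemidef P : possemidefmx P -> posdefmx (V - P) -> possemidefmx (tp V P).
Proof.
move=> pP gP; apply/possemidefP; split; first exact/tp_sym/possemidef_sym.
by move=> x; apply: le_trans (tp_ge pV x gP); apply: possemidef_ge0.
Qed.

Lemma gw_ge P y : possemidefmx P -> posdefmx (V - P) -> qf R y <= qf (gain_mx P) y.
Proof.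
move=> pP gP; rewrite /gain_mx qfD qf_congr lerDl; apply: possemidef_ge0.
exact: tp_possemidef.
Qed.

Lemma gw_posdef P : possemidefmx P -> posdefmx (V - P) -> posdefmx (gain_mx P).
Proof. by move=> pP gP; apply/posdefD/possemidef_congr/tp_possemidef. Qed.

Lemma gw_mono P P' y : posdefmx (V - P) -> posdefmx (V - P') ->
  (forall x, qf P' x <= qf P x) -> qf (gain_mx P') y <= qf (gain_mx P) y.
Proof. by move=> gP gP' h; rewrite /gain_mx !qfD !qf_congr lerD2l tp_mono. Qed.

Lemma gf_state P K : grad_mx P K = R *m K - B^T *m tp V P *m acl K.
Proof.
rewrite /grad_mx /gain_mx; move: (tp V P) => T.
by rewrite mulmxDl mulmxBr opprB addrA !mulmxA.
Qed.

(** Exact expansion, [bellman] being quadratic in the gain: [grad_mx] is half the gradient and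
    [gain_mx] gives the quadratic term. *)
Lemma qf_bell_diff P K K' x : P^T = P ->
  qf (bellman P K') x = qf (bellman P K) x
    + 2 * dot ((K' - K) *m x) (grad_mx P K *m x) + qf (gain_mx P) ((K' - K) *m x).
Proof.
move=> sP; have sT := tp_sym pV sP; rewrite !qf_bell gf_state /gain_mx.
move: (tp V P) sT => T sT.
set y := (K' - K) *m x.
have -> : acl K' *m x = acl K *m x - B *m y.
  rewrite /y mulmxA -mulmxBl mulmxBr; congr (_ *m x).
  by rewrite opprB addrA subrK.
have -> : K' *m x = K *m x + y by rewrite /y -mulmxDl addrC subrK.
rewrite qf_sub // qf_add // qfD qf_congr [(R *m K - _) *m x]mulmxBl dotDr dotNr.
rewrite -[R *m K *m x]mulmxA (dot_sym (K *m x) y sR).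
rewrite -[B^T *m _ *m acl K *m x]mulmxA -[B^T *m T *m _]mulmxA.
rewrite [dot y (B^T *m _)]dot_mul trmxK (dot_sym (acl K *m x) (B *m y) sT).
lra.
Qed.

Lemma lc_diff P K K' (x : 'cV[F]_m) :
  lc V P (acl K') *m x
  = lc V P (acl K) *m x + invmx (V - P) *m V *m (- B) *m ((K' - K) *m x).
Proof.
rewrite /lc -!mulmxA -!mulmxDr; congr (_ *m (_ *m _)).
by rewrite mulmxA -mulmxDl mulNmx mulmxBr opprB addrA subrK.
Qed.

(* The strict supersolution is [P + t X], with [X] a Lyapunov function of the
   closed loop of [K] and [t] small. *)
Lemma improve_strict P K K' (c : F) : stabsol V (acl K) (q K) P -> 0 < c ->
  (forall x, qf (bellman P K') x + c * dot ((K' - K) *m x) ((K' - K) *m x) <= qf P x) ->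
  exists U, strict_super V (acl K') (q K') U.
Proof.
move=> [pP gP eP /stab_lyap[X [k [pX /andP[k0 k1] hX]]]] c0 hc.
have psX := posdef_possemidef pX.
have [b b0 hb] := @posdef_compare _ _ _ (V - P) X 1%:M gP.
have [c1 c10 hc1] :=
  @posdef_compare _ _ _ 1%:M X (invmx (V - P) *m V *m (- B)) (posdef1 F d).
pose c4 := (1 + (k / 2)^-1) * c1.
have k20 : 0 < k / 2 by rewrite divr_gt0.
have c40 : 0 < c4 by rewrite mulr_gt0 // addr_gt0 // invr_gt0.
(* The first bound keeps [V - P - t X] positive and the loss in [invmx_perturb] below the
   contraction rate; the second lets the slack [c] absorb the effect of [K' - K] on the closed
   loop. *)
pose t := Num.min (k / 8 / b) (c / (2 * c4)).
have t0 : 0 < t by rewrite lt_min !divr_gt0 // mulr_gt0.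
have tb : t * b <= k / 8 by rewrite -ler_pdivlMr // ge_min lexx.
have tc : 2 * t * c4 <= c.
  have -> : 2 * t * c4 = t * (2 * c4) by ring.
  rewrite -ler_pdivlMr; first by rewrite /t ge_min lexx orbT.
  by rewrite mulr_gt0.
have tb1 : t * b < 1 by lra.
pose s := t / (1 - t * b).
have s0 : 0 < s by rewrite divr_gt0 // subr_gt0.
have st : s <= 2 * t.
  rewrite ler_pdivrMr ?subr_gt0 // -mulrA mulrCA -[leLHS]mulr1 ler_pM2l //; lra.
have hb' x : qf X x <= b * qf (V - P) x by have := hb x; rewrite mul1mx.
have gU x := @invmx_perturb _ _ _ X b t (V *m x) gP psX hb' b0 t0 tb1.
have eU : V - (P + t *: X) = V - P - t *: X by rewrite opprD addrA.
have [dX dX0 hdX] := posdef_lb pX.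
exists (P + t *: X); split.
- by apply: possemidefD => //; apply: possemidefZ; rewrite ?ltW.
- by rewrite eU; case: (gU 0).
exists (t * (k / 4) * dX); first by rewrite !mulr_gt0 // divr_gt0.
move=> x; set y := (K' - K) *m x.
have hX' : qf X (lc V P (acl K') *m x) <= (1 - k / 2) * qf X x + c4 * dot y y.
  rewrite (lc_diff P K K') -/y; apply: le_trans (qf_addle _ _ psX k20) _.
  have h1 := hX x; have h2 := hc1 y; have h3 := posdef_ge0 x pX.
  rewrite qf1 in h2.
  have i0 : 0 < (k / 2)^-1 by rewrite invr_gt0.
  have h4 : (1 + k / 2) * qf X (lc V P (acl K) *m x) <= (1 - k / 2) * qf X x.
    apply: (@le_trans _ _ ((1 + k / 2) * ((1 - k) * qf X x))).
      by rewrite ler_wpM2l //; lra.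
    by rewrite mulrA ler_wpM2r //; nra.
  have h5 : (1 + (k / 2)^-1) * qf X (invmx (V - P) *m V *m (- B) *m y) <= c4 * dot y y.
    by rewrite /c4 -mulrA ler_wpM2l //; lra.
  lra.
have hR : qf (Ric V (acl K') (q K') (P + t *: X)) x
   <= qf (bellman P K') x + s * qf X (lc V P (acl K') *m x).
  rewrite /bellman !qf_Ric // !qf_tp // eU; have [_] := gU (acl K' *m x).
  rewrite -/s /lc !mulmxA; lra.
have hx := hc x; rewrite -/y in hx.
have := hdX x; have q0 := posdef_ge0 x pX; set qx := qf X x in hX' q0 *.
move=> hlb.
have yy := dot_ge0 y.
have hs : s * (1 - k / 2) <= t * (1 - k / 4).
  rewrite /s mulrAC ler_pdivrMr ?subr_gt0 // -mulrA ler_pM2l //; nra.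
have hs' : s * qf X (lc V P (acl K') *m x) <= t * (1 - k / 4) * qx + c * dot y y.
  apply: (@le_trans _ _ (s * ((1 - k / 2) * qx + c4 * dot y y))).
    by rewrite ler_pM2l.
  rewrite mulrDr lerD // mulrA; first by rewrite ler_wpM2r.
  rewrite ler_wpM2r // (le_trans _ tc) // ler_pM2r //.
have hl : t * (k / 4) * (dX * dot x x) <= t * (k / 4) * qx.
  by rewrite ler_wpM2l // mulr_ge0 ?divr_ge0 // ltW.
by rewrite qfD qfZ -/qx; lra.
Qed.

(** By [tp_lin] at [P'], [P - P'] does not increase along the closed loop of [P'], so [lyap_ge0]
    makes it nonnegative. One more Riccati step sharpens the bound from [P] to [bellman P K], which
    preserves the slack of a policy step. *)
Lemma stabsol_le P P' K : P^T = P -> posdefmx (V - P) ->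
  stabsol V (acl K) (q K) P' -> (forall x, qf (bellman P K) x <= qf P x) ->
  forall x, qf P' x <= qf (bellman P K) x.
Proof.
move=> sP gP [pP' gP' eP' /stab_lyap[X [k lX]]] h.
have le x : qf P' x <= qf P x.
  rewrite -subr_ge0 -qfN -qfD; apply: (lyap_ge0 lX) => {}x.
  have := tp_lin pV (acl K *m x) gP gP'; have := h x.
  have : qf P' x = qf (Ric V (acl K) (q K) P') x by rewrite eP'.
  rewrite /bellman !qf_Ric // !(qfD P) !qfN /lc !mulmxA; lra.
move=> x; have -> : qf P' x = qf (Ric V (acl K) (q K) P') x by rewrite eP'.
by rewrite /bellman !qf_Ric // lerD2r; apply: tp_mono.
Qed.

Lemma tp_lc P a : posdefmx (V - P) -> tp V P *m a = P *m lc V P a.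
Proof.
move=> gP; rewrite /lc /tp !mulmxA; congr (_ *m a).
rewrite mul_gap_inv //.
by rewrite mulmxBl mul1mx.
Qed.

(** [invmx V *m P *m lc V P a] is the worst disturbance as a feedback; subtracting it from the
    closed loop recovers [a]. *)
Lemma lc_split P a : posdefmx (V - P) ->
  a = lc V P a - invmx V *m P *m lc V P a.
Proof.
move=> gP; have uN := posdef_unit gP.
apply: (can_inj (mulKmx uV)); rewrite mulmxBr !mulmxA mulmxV // mul1mx.
by rewrite -!mulmxBl mulmxV // mul1mx.
Qed.

(* Along the closed loop of a stationary pair the costate is [p = P x]; pairing
   it with the state of another pair is symmetric up to the symplectic form. *)
Lemma costate_pairing P1 K1 P2 K2 x y :
  posdefmx (V - P1) -> posdefmx (V - P2) -> grad_mx P2 K2 = 0 -> bellman P2 K2 = P2 ->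
  dot x (P2 *m y) =
    dot (lc V P1 (acl K1) *m x) (P2 *m (lc V P2 (acl K2) *m y))
    + dot (K1 *m x) (R *m (K2 *m y))
    - dot (invmx V *m (P1 *m (lc V P1 (acl K1) *m x))) (P2 *m (lc V P2 (acl K2) *m y))
    + dot (C *m x) (C *m y).
Proof.
move=> gP1 gP2; rewrite gf_state => /eqP; rewrite subr_eq0 -mulmxA tp_lc // => /eqP gf0 e2.
set L1 := lc V P1 _; set L2 := lc V P2 _ in gf0 *.
have eP2 : P2 = A^T *m (P2 *m L2) + C^T *m C.
  rewrite -{1}e2 /bellman /Ric -mulmxA tp_lc // -/L2 /stage_cost -[K2^T *m _ *m _]mulmxA gf0.
  rewrite linearB /= trmx_mul mulmxBl -!mulmxA [C^T *m C + _]addrC addrA; congr (_ + _).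
  by rewrite subrK.
have eA : A = L1 - invmx V *m P1 *m L1 + B *m K1.
  by rewrite -(lc_split (acl K1) gP1) subrK.
clearbody L1 L2; rewrite {1}eP2 mulmxDl dotDr -!mulmxA; congr (_ + _); last by rewrite dot_mul trmxK.
rewrite dot_mul trmxK {1}eA !mulmxDl mulNmx !dotDl dotNl -!mulmxA addrAC; congr (_ + _ - _).
have -> : R *m (K2 *m y) = B^T *m (P2 *m (L2 *m y)) by rewrite mulmxA gf0 !mulmxA.
by rewrite [RHS]dot_mul trmxK.
Qed.

(** Two instances of [costate_pairing] with exchanged roles are subtracted; the terms in [R], [C]
    and [invmx V] are symmetric and cancel. *)
Lemma symplectic_identity P1 K1 P2 K2 x y :
  P1^T = P1 -> P2^T = P2 -> posdefmx (V - P1) -> posdefmx (V - P2) ->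
  grad_mx P1 K1 = 0 -> grad_mx P2 K2 = 0 -> bellman P1 K1 = P1 -> bellman P2 K2 = P2 ->
  dot x ((P2 - P1) *m y) =
  dot (lc V P1 (acl K1) *m x) ((P2 - P1) *m (lc V P2 (acl K2) *m y)).
Proof.
move=> s1 s2 g1 g2 f1 f2 e1 e2; rewrite !mulmxBl !dotDr !dotNr.
have := @costate_pairing P1 K1 P2 K2 x y g1 g2 f2 e2.
have := @costate_pairing P2 K2 P1 K1 y x g2 g1 f1 e1.
set L1x := lc _ P1 _ *m x; set L2y := lc _ P2 _ *m y.
rewrite (dot_sym y x s1) (dot_sym L2y L1x s1) (dot_sym (K2 *m y) (K1 *m x) sR).
rewrite (dotC (C *m y)).
have sW : (invmx V)^T = invmx V by rewrite trmx_inv sV.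
have -> : dot (invmx V *m (P2 *m L2y)) (P1 *m L1x) = dot (invmx V *m (P1 *m L1x)) (P2 *m L2y).
  by rewrite [LHS]dotC [LHS](dot_sym _ _ sW) dotC.
lra.
Qed.

End Improvement.

(** * Convergence and rates of the iteration *)

Section LyapunovPerturbation.
Variable F : realType.

(** One Lyapunov function serves all late closed loops, which makes the constants in the rates
    independent of the iterate. *)
Lemma lyap_eventually m (L X : 'M[F]_m) k (M : nat -> 'M[F]_m) :
  lyap L X k -> mcvg M L ->
  exists N, forall t, (N <= t)%N -> lyap (M t) X (k / 2).
Proof.
move=> [pX /andP[k0 k1] hX] cM; have psX := posdef_possemidef pX.
have [c c0 hc] := posdef_lb pX.
pose b := 1 + frob X; have b0 : 0 < b by rewrite ltr_wpDr ?frob_ge0.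
have k40 : 0 < k / 4 by rewrite divr_gt0.
pose w := (1 + (k / 4)^-1) * b; have w0 : 0 < w by rewrite mulr_gt0 // addr_gt0 // invr_gt0.
have /cvgr_lt/(_ (c * (k / 4) / w)) [|N _ hN] := mcvg_frob0 cM.
  by rewrite divr_gt0 // mulr_gt0.
exists N => t Nt; have {hN} hf : frob (M t - L) < c * (k / 4) / w by apply: hN.
split=> //; first by apply/andP; split; lra.
move=> x; have -> : M t *m x = L *m x + (M t - L) *m x by rewrite -mulmxDl addrC subrK.
apply: le_trans (qf_addle _ _ psX k40) _.
have hx := hX x; have q0 := posdef_ge0 x pX; set qx := qf X x in hx q0 *.
have h1 : (1 + k / 4) * qf X (L *m x) <= (1 - 3 / 4 * k) * qx.
  apply: (@le_trans _ _ ((1 + k / 4) * ((1 - k) * qx))).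
    by rewrite ler_wpM2l //; lra.
  by rewrite mulrA ler_wpM2r //; nra.
have h2 : (1 + (k / 4)^-1) * qf X ((M t - L) *m x) <= k / 4 * qx.
  have i0 : 0 < (k / 4)^-1 by rewrite invr_gt0.
  apply: (@le_trans _ _ (w * (frob (M t - L) * dot x x))).
    rewrite /w -mulrA ler_wpM2l //; first by lra.
    by rewrite (le_trans (qf_frob _ _)) // ler_pM2l // dot_frob.
  apply: (@le_trans _ _ (w * (c * (k / 4) / w * dot x x))).
    by rewrite ler_pM2l // ler_wpM2r ?dot_ge0 // ltW.
  have -> : w * (c * (k / 4) / w * dot x x) = k / 4 * (c * dot x x).
    by field; rewrite gt_eqF.
  by rewrite ler_pM2l // hc.
lra.
Qed.

(** [e / k] is the sum of the geometric series [e (1 - k)^t]; the proof checks that [(e / k) X - D]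
    does not increase along [M]. *)
Lemma lyap_tr_le m (M X D : 'M[F]_m) (k e : F) : lyap M X k -> 0 <= e ->
  (forall x, qf D x <= qf D (M *m x) + e * qf X x) -> \tr D <= e / k * \tr X.
Proof.
move=> lM e0 h; have [pX /andP[k0 k1] hX] := lM.
rewrite -mxtraceZ; apply: le_tr => x; rewrite -subr_ge0 -qfN -qfD.
apply: (lyap_ge0 lM) => {}x; rewrite !qfD !qfN !qfZ.
have ek : 0 <= e / k by rewrite divr_ge0 // ltW.
have := ler_wpM2l ek (hX x); have := h x.
have -> : e / k * ((1 - k) * qf X x) = e / k * qf X x - e * qf X x.
  by field; rewrite gt_eqF.
lra.
Qed.

Lemma qf_invmx_anti n (M N : 'M[F]_n) x : posdefmx M -> posdefmx N ->
  (forall y, qf M y <= qf N y) -> qf (invmx N) x <= qf (invmx M) x.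
Proof.
move=> pM pN h; apply: le_trans (invmx_lin x pM pN).
by rewrite lerDl oppr_ge0 qfD qfN subr_le0.
Qed.

Lemma cvg_eventually_le (u : nat -> F) (a : F) : u @ \oo --> a ->
  exists N, forall k, (N <= k)%N -> u k <= a + 1.
Proof.
move=> /cvgr_lt/(_ (a + 1)) [|N _ hN]; first by rewrite ltrDl.
by exists N => k Nk; apply/ltW/hN.
Qed.

End LyapunovPerturbation.

Section Iteration.
Variables (F : realType) (m d l : nat) (V A : 'M[F]_m) (B : 'M[F]_(m, d)).
Variables (C : 'M[F]_(l, m)) (R : 'M[F]_d).
Variables (K : nat -> 'M[F]_(d, m)) (P : nat -> 'M[F]_m).
Variables (Ks : 'M[F]_(d, m)) (Ps : 'M[F]_m) (c : F).
Hypothesis pV : posdefmx V.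
Hypothesis pR : posdefmx R.

Local Notation acl K := (A - B *m K).
Local Notation q K := (stage_cost C R K).
Local Notation gw := (gain_mx V B R).
Local Notation gf := (grad_mx V A B R).
Local Notation bell := (bellman V A B C R).
Local Notation E k := (gf (P k) (K k)).

Hypothesis hS : forall k, stabsol V (acl (K k)) (q (K k)) (P k).
Hypothesis hs : stabsol V (acl Ks) (q Ks) Ps.
Hypothesis fs : gf Ps Ks = 0.
Hypothesis c0 : 0 < c.
(** Convergence and the linear rate see the update rule only through this inequality, so one
    argument covers both iterations. *)
Hypothesis hdec : forall k x,
  qf (bell (P k) (K k.+1)) x + c * dot (E k *m x) (E k *m x) <= qf (P k) x.

Let pP k : possemidefmx (P k). Proof. by case: (hS k). Qed.
Let gP k : posdefmx (V - P k). Proof. by case: (hS k). Qed.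
Let eP k : bell (P k) (K k) = P k. Proof. by case: (hS k). Qed.
Let sP k : (P k)^T = P k. Proof. exact: possemidef_sym. Qed.
Let pPs : possemidefmx Ps. Proof. by case: hs. Qed.
Let gPs : posdefmx (V - Ps). Proof. by case: hs. Qed.
Let ePs : bell Ps Ks = Ps. Proof. by case: hs. Qed.
Let sPs : Ps^T = Ps. Proof. exact: possemidef_sym. Qed.

Lemma step_gain k x :
  qf (P k.+1) x + c * dot (E k *m x) (E k *m x) <= qf (P k) x.
Proof.
apply: le_trans (hdec k x); rewrite lerD2r.
apply: (stabsol_le pV (sP k) (gP k) (hS k.+1)) => y.
by apply: le_trans (hdec k y); rewrite lerDl mulr_ge0 ?dot_ge0 // ltW.
Qed.

Lemma value_decreasing k x : qf (P k.+1) x <= qf (P k) x.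
Proof.
by apply: le_trans (step_gain k x); rewrite lerDl mulr_ge0 ?dot_ge0 // ltW.
Qed.

Lemma mcvg_gw Q L : posdefmx (V - L) -> (forall k, posdefmx (V - Q k)) ->
  mcvg Q L -> mcvg (fun k => gw (Q k)) (gw L).
Proof.
move=> gL gQ h; apply: mcvgD; first exact: mcvg_cst.
apply: mcvgM; last exact: mcvg_cst.
by apply: mcvgM; [exact: mcvg_cst|exact: mcvg_tp].
Qed.

Lemma mcvg_lc Q L a a' : posdefmx (V - L) -> (forall k, posdefmx (V - Q k)) ->
  mcvg Q L -> mcvg a a' -> mcvg (fun k => lc V (Q k) (a k)) (lc V L a').
Proof.
move=> gL gQ h ha; apply: mcvgM => //; apply: mcvgM; last exact: mcvg_cst.
apply: mcvg_inv; [exact: posdef_unit|by move=> k; apply: posdef_unit|].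
by apply: mcvgB => //; apply: mcvg_cst.
Qed.

(** The definition of [grad_mx] solved for the gain: the limits of [P k] and of the gradient
    determine that of [K k]. *)
Lemma gainE Q K' : possemidefmx Q -> posdefmx (V - Q) ->
  K' = invmx (gw Q) *m (gf Q K' + B^T *m tp V Q *m A).
Proof. by move=> pQ gQ; rewrite /grad_mx subrK mulKmx //; apply/posdef_unit/gw_posdef. Qed.

(* The symplectic identity only needs the limit closed loop to have spectral
   radius at most one, because the optimal closed loop is stable. *)
Lemma iterates_cvg : mcvg P Ps /\ mcvg K Ks.
Proof.
have [Pi [cP sPi lePi gePi]] := mcvg_nonincreasing sP value_decreasing
  (M := 0) (fun k x => ltac:(rewrite qf0m; exact: possemidef_ge0)).
have pPi : possemidefmx Pi.
  by apply/possemidefP; split => // x; have := gePi x; rewrite qf0m.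
have gPi : posdefmx (V - Pi) by apply: (gap_le pV sPi (lePi 0%N) (gP 0%N)).
have cE : mcvg (fun k => E k) 0.
  move=> i j; rewrite mxE; apply: cvg_sqr0; pose x : 'cV[F]_m := delta_mx j 0.
  apply: (@cvg_squeeze0 _ _ (fun k => c^-1 * (qf (P k) x - qf (P k.+1) x))).
    move=> k; rewrite sqr_ge0 /= mulrC ler_pdivlMr //.
    have := step_gain k x; have : (E k i j) ^+ 2 <= dot (E k *m x) (E k *m x).
      have e : (E k *m x) i 0 = E k i j by rewrite -colE [LHS]mxE.
      rewrite dotE (bigD1 i) //= e -expr2 lerDl sumr_ge0 // => t _.
      by rewrite -expr2 sqr_ge0.
    by move=> h; have := ler_wpM2l (ltW c0) h; lra.
  rewrite -[X in _ --> X](mulr0 c^-1) -(subrr (qf Pi x)).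
  apply: cvgMr; apply: cvgB; first exact: mcvg_qf.
  exact/mcvg_qf/mcvg_shift.
pose Ki := invmx (gw Pi) *m (0 + B^T *m tp V Pi *m A).
have cK : mcvg K Ki.
  apply: (@mcvg_ext _ _ _ (fun k => invmx (gw (P k)) *m (E k + B^T *m tp V (P k) *m A))).
    by move=> k; rewrite -gainE.
  apply: mcvgM.
    apply: mcvg_inv; [|move=> k|]; try by apply/posdef_unit/gw_posdef.
    exact: mcvg_gw.
  apply: mcvgD => //; apply: mcvgM; last exact: mcvg_cst.
  by apply: mcvgM; [exact: mcvg_cst|exact: mcvg_tp].
have fi : gf Pi Ki = 0.
  by rewrite /grad_mx /Ki add0r mulKVmx ?subrr //; apply/posdef_unit/gw_posdef.
have cacl : mcvg (fun k => acl (K k)) (acl Ki).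
  by apply: mcvgB; [exact: mcvg_cst|apply: mcvgM => //; exact: mcvg_cst].
have ePi : bell Pi Ki = Pi.
  apply: (mcvg_uniq (U := P)) => //.
  apply: (@mcvg_ext _ _ _ (fun k => bell (P k) (K k))) => //.
  apply: mcvgD.
    by apply: mcvgM => //; apply: mcvgM; [exact: mcvgT|exact: mcvg_tp].
  apply: mcvgD; first exact: mcvg_cst.
  by apply: mcvgM => //; apply: mcvgM; [exact: mcvgT|exact: mcvg_cst].
have Li : forall z, eigenvalue (cmx (lc V Pi (acl Ki))) z -> Normc.normc z <= 1.
  apply: (@stab_limit _ _ (fun k => lc V (P k) (acl (K k)))).
    by move=> k; case: (hS k).
  exact: mcvg_lc.
have [_ _ _ sLs] := hs.
have D0 : Ps - Pi = 0.
  apply: (stein_unique Li sLs) => x y.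
  by apply: (symplectic_identity pV pR _ _ sPi sPs gPi gPs fi fs ePi ePs).
have ePP : Pi = Ps by apply/eqP; rewrite eq_sym -subr_eq0 D0.
rewrite -ePP; split=> //; suff -> : Ks = Ki by [].
by rewrite (gainE Ks pPs gPs) fs /Ki ePP.
Qed.

Lemma value_ge_limit k x : qf Ps x <= qf (P k) x.
Proof.
have [cP _] := iterates_cvg.
have sh j : mcvg (fun t => P (t + j)%N) Ps.
  elim: j => [|j IH]; first by apply: mcvg_ext cP => t; rewrite addn0.
  by apply: mcvg_ext (mcvg_shift IH) => t; rewrite addSnnS.
have h := mcvg_qf (x := x) (sh k).
apply: (@cvg_le _ _ (fun=> qf (P k) x) _ _ h); first exact: cvg_cst.
elim=> [|t IH]; first by rewrite add0n.
by apply: le_trans IH; rewrite addSn value_decreasing.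
Qed.

(** [cost] up to the factor [gamma ^+ 2] and an additive constant; see [cost_sub]. *)
Let J k := - ln (\det (V - P k)).
Let Js := - ln (\det (V - Ps)).

Let weight_lb : exists2 c1 : F, 0 < c1 &
  forall M x, posdefmx M -> (forall y, qf M y <= qf V y) ->
    c1 * dot x x <= qf (invmx M) x.
Proof.
have [c1 c10 h1] := posdef_lb (posdef_inv pV).
exists c1 => // M x pM leM; apply: le_trans (h1 x) _.
exact: qf_invmx_anti.
Qed.

(** Tangent of [ln \det] at [V - Q'], whose inverse dominates that of [V] because [Q'] is
    semidefinite; this makes the constant uniform. *)
Let tr_gap_lb : exists2 c1 : F, 0 < c1 &
  forall Q Q', possemidefmx Q' -> posdefmx (V - Q) -> posdefmx (V - Q') ->
   possemidefmx (Q - Q') ->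
   c1 * \tr (Q - Q') <= ln (\det (V - Q')) - ln (\det (V - Q)).
Proof.
have [c1 c10 h1] := weight_lb; exists c1 => // Q Q' pQ' gQ gQ' pD.
have := ln_det_concave gQ' gQ.
have -> : V - Q - (V - Q') = - (Q - Q') by rewrite !opprB [LHS]addrC addrA subrK.
rewrite mulmxN raddfN /= => h.
have : \tr (c1%:M *m (Q - Q')) <= \tr (invmx (V - Q') *m (Q - Q')).
  apply: tr_mul_le => // x; rewrite -scalemx1 qfZ qf1; apply: h1 => // y.
  by rewrite qfD qfN gerDl oppr_le0 possemidef_ge0.
rewrite mul_scalar_mx mxtraceZ; lra.
Qed.

Let possemidef_sub k : possemidefmx (P k - Ps).
Proof.
apply/possemidefP; split; first by rewrite linearB /= sP sPs.
by move=> x; rewrite qfD qfN subr_ge0 value_ge_limit.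
Qed.

(** Tangent at the other end, [V - P k]; since the values decrease, its inverse is bounded by that
    of [V - P 0%N]. *)
Let tr_gap_le : exists2 c2 : F, 0 < c2 &
  forall k, J k - Js <= c2 * \tr (P k - Ps).
Proof.
pose c2 := 1 + frob (invmx (V - P 0%N)).
exists c2 => [|k]; first by rewrite ltr_wpDr ?frob_ge0.
have := ln_det_concave (gP k) gPs.
have -> : V - Ps - (V - P k) = P k - Ps by rewrite !opprB [LHS]addrC addrA subrK.
rewrite /J /Js opprK addrC => /le_trans; apply.
rewrite -mxtraceZ -mul_scalar_mx; apply: tr_mul_le => // x.
rewrite -scalemx1 qfZ qf1; apply: le_trans (qf_frob _ _).
apply: qf_invmx_anti => // y; rewrite !qfD !qfN lerD2l lerN2.
elim: (k) => [//|j]; exact/le_trans/value_decreasing.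
Qed.

(** Gradient domination. Completing the square in the gain shows that at [P k] no gain, in
    particular [Ks], improves on [P k] by more than the form of [invmx (gw (P k))] at the gradient.
    [tp_lin] at [P k] carries the remaining gap along the mixed loop of value [P k] and gain [Ks],
    eventually contracting. *)
Let tr_le_gradient : exists N, exists2 c3 : F, 0 < c3 &
  forall k, (N <= k)%N -> \tr (P k - Ps) <= c3 * frob (E k).
Proof.
have [_ _ _ /stab_lyap[X [ka lX]]] := hs; have [cP cK] := iterates_cvg.
have cM : mcvg (fun k => lc V (P k) (acl Ks)) (lc V Ps (acl Ks)).
  by apply: mcvg_lc => //; apply: mcvg_cst.
have [N hN] := lyap_eventually lX cM.
have [pX /andP[k0 _] _] := lX.
pose cR := 1 + frob (invmx R); have cR0 : 0 < cR by rewrite ltr_wpDr ?frob_ge0.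
have [cX cX0 hcX] := @posdef_compare _ _ _ X 1%:M 1%:M pX.
have k20 : 0 < ka / 2 by rewrite divr_gt0.
exists N, (cR * cX / (ka / 2) * \tr X + 1).
  rewrite ltr_wpDl // mulr_ge0 //; first by rewrite ltW // divr_gt0 // mulr_gt0.
  apply: sumr_ge0 => i _; rewrite -qf_delta; exact: posdef_ge0.
move=> k Nk; have f0 := frob_ge0 (E k).
have := lyap_tr_le (hN k Nk) (D := P k - Ps) (e := cR * frob (E k) * cX).
have e0 : 0 <= cR * frob (E k) * cX by rewrite !mulr_ge0 // ltW.
move=> /(_ e0) h; apply: (@le_trans _ _ (cR * frob (E k) * cX / (ka / 2) * \tr X)).
  apply: h => x.
  have hG : qf (P k) x - qf (invmx (gw (P k))) (E k *m x) <= qf (bell (P k) Ks) x.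
    have pG := gw_posdef B pV pR (pP k) (gP k).
    rewrite (qf_bell_diff A B C pV pR (K k) Ks x (sP k)) eP.
    set y := (Ks - K k) *m x; set v := E k *m x.
    have := posdef_ge0 (y + invmx (gw (P k)) *m v) pG.
    rewrite qf_add ?(posdef_sym pG) // -qf_invmx // mulKVmx ?posdef_unit //; lra.
  have hI : qf (invmx (gw (P k))) (E k *m x) <= cR * frob (E k) * cX * qf X x.
    apply: (@le_trans _ _ (qf (invmx R) (E k *m x))).
      apply: qf_invmx_anti => //; first exact: gw_posdef.
      by move=> y; apply: gw_ge.
    apply: le_trans (qf_frob _ _) _; rewrite -!mulrA ler_pM2l //.
    apply: le_trans (dot_frob _ _) _; rewrite ler_wpM2l //.
    by have := hcX x; rewrite mul1mx qf1.
  have ht := tp_lin pV (acl Ks *m x) gPs (gP k).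
  have hPs : qf Ps x = qf (bell Ps Ks) x by rewrite ePs.
  have hPk := qf_bell V A B C R (P k) Ks x.
  have hPs' := qf_bell V A B C R Ps Ks x.
  move: ht; rewrite /lc !mulmxA !(qfD (P k)) !(qfD Ps) !qfN; lra.
rewrite [leRHS]mulrDl mul1r -[leLHS]addr0 lerD //.
rewrite le_eqVlt; apply/orP; left; apply/eqP; ring.
Qed.

Lemma values_locally_linear : exists n0 (rho : F), 0 < rho < 1 /\
  forall k, (n0 <= k)%N -> J k.+1 - Js <= rho * (J k - Js).
Proof.
have [c1 c10 h1] := tr_gap_lb; have [c2 c20 h2] := tr_gap_le.
have [N [c3 c30 h3]] := tr_le_gradient.
pose Q := c2 * c3 / (c1 * c); have Q0 : 0 < Q by rewrite divr_gt0 // mulr_gt0.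
(* [Q + 1] in place of [Q] makes the ratio positive. *)
exists N, (1 - (Q + 1)^-1); split.
  have q1 : 0 < Q + 1 by rewrite addr_gt0.
  rewrite subr_gt0 invf_lt1 // ltrDr Q0 /= ltrBlDr ltrDl invr_gt0 //.
move=> k Nk.
have hJ : c1 * (c * frob (E k)) <= J k - J k.+1.
  rewrite /J opprK addrC; apply: le_trans (h1 (P k) (P k.+1) _ _ _ _) => //; last first.
    apply/possemidefP; split; first by rewrite linearB /= !sP.
    by move=> x; rewrite qfD qfN subr_ge0 value_decreasing.
  rewrite ler_pM2l // frob_tr -mxtraceZ; apply: le_tr => x.
  by rewrite qfZ qf_gram qfD qfN; have := step_gain k x; lra.
have hJs : J k - Js <= Q * (J k - J k.+1).
  apply: le_trans (h2 k) _; apply: (@le_trans _ _ (c2 * (c3 * frob (E k)))).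
    by rewrite ler_pM2l // h3.
  have -> : c2 * (c3 * frob (E k)) = Q * (c1 * (c * frob (E k))).
    by rewrite /Q; field; rewrite !gt_eqF.
  by rewrite ler_pM2l.
have hm : 0 <= J k - J k.+1.
  by apply: le_trans hJ; rewrite !mulr_ge0 ?frob_ge0 // ltW.
have q1 : 0 < Q + 1 by rewrite addr_gt0.
have : (Q + 1)^-1 * (J k - Js) <= J k - J k.+1.
  by rewrite ler_pdivrMl // mulrDl mul1r; lra.
lra.
Qed.

Lemma tp_diff Q Q' : posdefmx (V - Q) -> posdefmx (V - Q') ->
  tp V Q - tp V Q' = V *m invmx (V - Q) *m (Q - Q') *m invmx (V - Q') *m V.
Proof.
move=> gQ gQ'; have uQ := posdef_unit gQ; have uQ' := posdef_unit gQ'.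
rewrite /tp opprB addrA subrK -mulmxBl; congr (_ *m V).
rewrite -!mulmxA -mulmxBr; congr (_ *m _).
have -> : Q - Q' = V - Q' - (V - Q) by rewrite !opprB [RHS]addrC addrA subrK.
by rewrite mulmxBl mulmxV // mulmxBr mulmx1 mulKmx.
Qed.

Hypothesis hgn : forall k, gf (P k) (K k.+1) = 0.

(** Difference of the two stationarity equations; [tp_diff] exhibits the factor [P k - Ps], so the
    squared gain error is of second order in the gap. *)
Let gain_diff k : K k.+1 - Ks = invmx (gw (P k)) *m B^T *m V *m invmx (V - P k)
  *m (P k - Ps) *m (invmx (V - Ps) *m V *m acl Ks).
Proof.
have uG : gw (P k) \in unitmx by apply/posdef_unit/gw_posdef.
apply: (can_inj (mulKmx uG)).
have -> : gw (P k) *m (K k.+1 - Ks) = B^T *m (tp V (P k) - tp V Ps) *m acl Ks.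
  have e1 : gw (P k) *m K k.+1 = B^T *m tp V (P k) *m A.
    by apply/eqP; rewrite -subr_eq0; apply/eqP; exact: hgn.
  have e2 : R *m Ks = B^T *m tp V Ps *m acl Ks.
    by apply/eqP; rewrite -subr_eq0; move: fs; rewrite gf_state => ->.
  rewrite mulmxBr e1 /gain_mx; move: e2; move: (tp V (P k)) (tp V Ps) => T T' e2.
  rewrite mulmxDl e2 [B^T *m (T - T')]mulmxBr [RHS]mulmxBl [B^T *m T *m acl Ks]mulmxBr.
  by rewrite !mulmxA opprD addrA [RHS]addrAC.
rewrite tp_diff //.
by rewrite !mulmxA mulmxV // mul1mx.
Qed.

Lemma values_locally_quadratic : exists n0 (a : F), 0 < a /\
  forall k, (n0 <= k)%N -> J k.+1 - Js <= a * (J k - Js) ^+ 2.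
Proof.
have [c1 c10 h1] := tr_gap_lb; have [c2 c20 h2] := tr_gap_le.
have [_ _ _ /stab_lyap[X [ka lX]]] := hs; have [cP cK] := iterates_cvg.
have cL : mcvg (fun k => lc V (P k) (acl (K k))) (lc V Ps (acl Ks)).
  apply: mcvg_lc => //; apply: mcvgB; first exact: mcvg_cst.
  by apply: mcvgM => //; exact: mcvg_cst.
have [N1 hN1] := lyap_eventually lX cL.
have [pX /andP[k0 _] _] := lX.
have k20 : 0 < ka / 2 by rewrite divr_gt0.
pose cG := 1 + frob (gw Ps); have cG0 : 0 < cG by rewrite ltr_wpDr ?frob_ge0.
have [cX cX0 hcX] := @posdef_compare _ _ _ X 1%:M 1%:M pX.
pose Fk k := invmx (gw (P k)) *m B^T *m V *m invmx (V - P k).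
pose Fs := invmx (gw Ps) *m B^T *m V *m invmx (V - Ps).
have cF : mcvg Fk Fs.
  apply: mcvgM; last first.
    apply: mcvg_inv; [exact: posdef_unit|by move=> k; apply: posdef_unit|].
    by apply: mcvgB => //; apply: mcvg_cst.
  apply: mcvgM; last exact: mcvg_cst.
  apply: mcvgM; last exact: mcvg_cst.
  apply: mcvg_inv; [|move=> k|]; try by apply/posdef_unit/gw_posdef.
  exact: mcvg_gw.
have [N2 hN2] := cvg_eventually_le (mcvg_frob cF).
set cF' := frob Fs + 1 in hN2.
have cF'0 : 0 < cF' by rewrite ltr_wpDl ?frob_ge0.
pose Ls := invmx (V - Ps) *m V *m acl Ks.
pose cL' := frob Ls + 1; have cL'0 : 0 < cL' by rewrite ltr_wpDl ?frob_ge0.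
have trX : 0 <= \tr X.
  by apply: sumr_ge0 => i _; rewrite -qf_delta; exact: posdef_ge0.
pose c8 := cG * cX / (ka / 2) * (\tr X + 1).
have c80 : 0 < c8 by rewrite !mulr_gt0 ?invr_gt0 // ltr_wpDl.
have htr k : (N1 <= k)%N -> \tr (P k.+1 - Ps) <= c8 * frob (K k.+1 - Ks).
  move=> Nk; have f0 := frob_ge0 (K k.+1 - Ks).
  pose e := cG * frob (K k.+1 - Ks) * cX.
  have e0 : 0 <= e by rewrite !mulr_ge0 // ltW.
  apply: (@le_trans _ _ (e / (ka / 2) * \tr X)).
    apply: (lyap_tr_le (hN1 k.+1 (leqW Nk)) e0) => x.
    set y := (K k.+1 - Ks) *m x.
    (* The first-order term of the expansion around [Ks] vanishes by stationarity; only [gw Ps] at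
       the gain error remains. *)
    have hb := qf_bell_diff A B C pV pR Ks (K k.+1) x sPs.
    rewrite ePs fs mul0mx dot0r mulr0 addr0 -/y in hb.
    have hy : qf (gw Ps) y <= e * qf X x.
      apply: le_trans (qf_frob _ _) _; rewrite /e -!mulrA ler_pM2l //.
      apply: le_trans (dot_frob _ _) _; rewrite ler_wpM2l //.
      by have := hcX x; rewrite mul1mx qf1.
    have ht := tp_lin pV (acl (K k.+1) *m x) gPs (gP k.+1).
    have hP : qf (P k.+1) x = qf (bell (P k.+1) (K k.+1)) x by rewrite eP.
    have hPk := qf_bell V A B C R (P k.+1) (K k.+1) x.
    have hPs' := qf_bell V A B C R Ps (K k.+1) x.
    move: ht; rewrite /lc !mulmxA !(qfD (P k.+1)) !(qfD Ps) !qfN; lra.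
  have -> : e / (ka / 2) * \tr X = cG * cX / (ka / 2) * \tr X * frob (K k.+1 - Ks).
    by rewrite /e; ring.
  rewrite ler_wpM2r // /c8 ler_pM2l ?lerDl //.
  by rewrite divr_gt0 // mulr_gt0.
pose a := c2 * (c8 * (cF' * (c1 ^- 2) * cL')).
exists (maxn N1 N2), a; split.
  do 2![apply: mulr_gt0 => //]; apply: mulr_gt0 => //.
  by apply: mulr_gt0 => //; rewrite invr_gt0 exprn_gt0.
move=> k; rewrite geq_max => /andP[k1 k2].
apply: le_trans (h2 k.+1) _; rewrite /a -(mulrA c2) ler_pM2l //.
apply: le_trans (htr k k1) _; rewrite -(mulrA c8) ler_pM2l //.
rewrite gain_diff -/(Fk k) -/Ls.
have hj : c1 * \tr (P k - Ps) <= J k - Js.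
  by rewrite /J /Js opprK [leRHS]addrC; apply: h1.
have tr0 : 0 <= \tr (P k - Ps).
  by apply: sumr_ge0 => i _; rewrite -qf_delta; exact: possemidef_ge0.
have hfrob : frob (P k - Ps) <= c1 ^- 2 * (J k - Js) ^+ 2.
  apply: le_trans (frob_le_tr (possemidef_sub k)) _.
  rewrite -ler_pdivrMl ?invr_gt0 ?exprn_gt0 // invrK -exprMn ler_pXn2r //.
    by rewrite nnegrE mulr_ge0 // ltW.
  by rewrite nnegrE (le_trans _ hj) // mulr_ge0 // ltW.
have i0 : 0 <= c1 ^- 2 * (J k - Js) ^+ 2 by apply: le_trans hfrob; apply: frob_ge0.
have -> : cF' * c1 ^- 2 * cL' * (J k - Js) ^+ 2
  = cF' * (c1 ^- 2 * (J k - Js) ^+ 2) * cL' by ring.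
apply: le_trans (frob_mul _ _) _.
apply: ler_pM; rewrite ?frob_ge0 //; last by rewrite lerDl.
apply: le_trans (frob_mul _ _) _.
by apply: ler_pM; rewrite ?frob_ge0 // hN2.
Qed.

End Iteration.

(** * Natural gradient and Gauss-Newton steps *)

Section OperatorNorm.
Variable F : realType.

Lemma norm2E n (x : 'cV[F]_n) : norm2 x = Num.sqrt (dot x x).
Proof. by rewrite /norm2 dotE; under eq_bigr do rewrite expr2. Qed.

Lemma qf_opnorm n (M : 'M[F]_n) y : qf M y <= opnorm M * dot y y.
Proof.
have [->|y0] := eqVneq y 0; first by rewrite qf0 dot0l mulr0.
have yy := dot_gt0 y0; pose t := Num.sqrt (dot y y).
have t0 : 0 < t by rewrite sqrtr_gt0.
have tt : t ^+ 2 = dot y y by rewrite sqr_sqrtr // ltW.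
pose u := t^-1 *: y; have uu : dot u u = 1.
  by rewrite /u !dotL -tt; field; rewrite gt_eqF.
have yu : y = t *: u by rewrite /u scalerA mulfV ?gt_eqF // scale1r.
rewrite {1}yu qfs tt mulrC ler_pM2r //.
have : norm2 (M *m u) <= opnorm M.
  apply: ub_le_sup; last by exists u => //=; rewrite norm2E uu sqrtr1.
  exists (Num.sqrt (frob M)) => _ [x /= x1 <-]; rewrite norm2E ler_wsqrtr //.
  apply: le_trans (dot_frob M x) _; rewrite ler_piMr ?frob_ge0 //.
  move: x1; rewrite norm2E -[in leRHS](sqrtr1 F) ler_sqrt //.
apply: le_trans; rewrite norm2E; apply: le_trans (ler_norm _) _.
rewrite -sqrtr_sqr ler_wsqrtr //; have := cauchy_schwarz u (M *m u).
by rewrite uu mul1r.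
Qed.

End OperatorNorm.

Section Steps.
Variables (F : realType) (m d l : nat) (V A : 'M[F]_m) (B : 'M[F]_(m, d)).
Variables (C : 'M[F]_(l, m)) (R : 'M[F]_d).
Hypothesis pV : posdefmx V.
Hypothesis pR : posdefmx R.
Local Notation gw := (gain_mx V B R).
Local Notation gf := (grad_mx V A B R).
Local Notation bell := (bellman V A B C R).

(** The linear term of [qf_bell_diff] gains [4 eta |y|^2], and [eta * g <= 1 / 2] limits the
    quadratic term to half of that. *)
Lemma npg_decrease P K (eta g : F) x : P^T = P -> 0 < eta ->
  (forall y, qf (gw P) y <= g * dot y y) -> eta * g <= 1 / 2 ->
  qf (bell P (K - (2 * eta) *: gf P K)) x
    + 2 * eta * dot (gf P K *m x) (gf P K *m x) <= qf (bell P K) x.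
Proof.
move=> sP e0 hg eg; rewrite (qf_bell_diff A B C pV pR K _ x sP).
set y := gf P K *m x.
have -> : (K - (2 * eta) *: gf P K - K) *m x = (- (2 * eta)) *: y.
  by rewrite addrAC subrr add0r mulNmx -scalemxAl scaleNr.
rewrite qfs dotZl; have hy := hg y; have y0 := dot_ge0 y.
have : (- (2 * eta)) ^+ 2 * qf (gw P) y <= 2 * eta * dot y y.
  rewrite sqrrN exprMn; apply: (@le_trans _ _ (2 ^+ 2 * eta ^+ 2 * (g * dot y y))).
    by rewrite ler_wpM2l // mulr_ge0 // sqr_ge0.
  have -> : 2 ^+ 2 * eta ^+ 2 * (g * dot y y) = 4 * eta * dot y y * (eta * g) by ring.
  have -> : 2 * eta * dot y y = 4 * eta * dot y y * (1 / 2) by field.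
  by rewrite ler_wpM2l // !mulr_ge0 // ltW.
lra.
Qed.

(** In the form of [invmx (gw P)] the change has coefficient [4 eta^2 - 4 eta], at most [- 2 eta]
    for [eta <= 1 / 2]. *)
Lemma gn_decrease P K (eta : F) x : possemidefmx P -> posdefmx (V - P) ->
  0 < eta -> eta <= 1 / 2 ->
  qf (bell P (K - (2 * eta) *: (invmx (gw P) *m gf P K))) x
    + 2 * eta * qf (invmx (gw P)) (gf P K *m x) <= qf (bell P K) x.
Proof.
move=> pP gP e0 e1; have sP := possemidef_sym pP.
have pG := gw_posdef B pV pR pP gP.
rewrite (qf_bell_diff A B C pV pR K _ x sP); set y := gf P K *m x.
have -> : (K - (2 * eta) *: (invmx (gw P) *m gf P K) - K) *m x
    = (- (2 * eta)) *: (invmx (gw P) *m y).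
  by rewrite addrAC subrr add0r mulNmx -scalemxAl scaleNr mulmxA.
rewrite qfs dotZl -qf_invmx // (dotC _ y) -/(qf (invmx (gw P)) y).
have q0 := posdef_ge0 y (posdef_inv pG); set w := qf (invmx _) y in q0 *.
have h12 : 0 <= 1 - 2 * eta by lra.
have : 0 <= (1 - 2 * eta) * eta * w by rewrite !mulr_ge0 // ltW.
lra.
Qed.

End Steps.

(** * Both iterations in terms of the original problem *)

Section PolicyIteration.
Variables (F : realType) (m d l n : nat).
Variables (A : 'M[F]_m) (B : 'M[F]_(m, d)) (C : 'M[F]_(l, m)).
Variables (D : 'M[F]_(m, n)) (R : 'M[F]_d) (gamma : F).
Hypothesis pR : posdefmx R.
Hypothesis g0 : 0 < gamma.
Hypothesis pDD : posdefmx (D *m D^T).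

Local Notation V := (dweight D gamma).
Local Notation gw := (gain_mx V B R).
Local Notation gf := (grad_mx V A B R).
Local Notation bell := (bellman V A B C R).
Local Notation ric := (riccati A B C D R gamma).
Local Notation feas := (feasible A B C D R gamma).
Local Notation costJ := (cost A B C D R gamma).

Let pV : posdefmx V := posdef_dweight g0 pDD.

(** Feasibility excludes the default value of [riccati]. *)
Lemma riccati_stabsol K : feas K ->
  stabsol V (A - B *m K) (stage_cost C R K) (ric K).
Proof.
move=> /(feasibleP A B C pR g0 pDD)[U hU].
have [P hP] := strict_super_stabsol pV (stage_cost_possemidef C pR K) hU.
apply/(stabilizing_solutionP A B C R g0 pDD); rewrite /riccati.
case: xgetP => [Q _ //|/(_ P)[]].
exact/(stabilizing_solutionP A B C R g0 pDD).
Qed.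

Lemma gain_weightE K : feas K -> gain_weight A B C D R gamma K = gw (ric K).
Proof.
move=> /riccati_stabsol[pP gP _ _].
by rewrite /gain_weight tildeP_tp //; exact: possemidef_sym.
Qed.

Lemma grad_factorE K : feas K -> grad_factor A B C D R gamma K = gf (ric K) K.
Proof.
move=> fK; have [pP gP _ _] := riccati_stabsol fK.
rewrite /grad_factor (gain_weightE fK) tildeP_tp //; exact: possemidef_sym.
Qed.

Lemma costE K : feas K ->
  costJ K = gamma ^+ 2 * (ln (\det V) - ln (\det (V - ric K))).
Proof. by move=> /riccati_stabsol[_ gP _ _]; apply: cost_gap. Qed.

Lemma cost_sub K K' : feas K -> feas K' ->
  costJ K - costJ K' = gamma ^+ 2 *
    (- ln (\det (V - ric K)) - - ln (\det (V - ric K'))).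
Proof.
move=> fK fK'; rewrite (costE fK) (costE fK') -mulrBr.
have e (x y z : F) : x - y - (x - z) = - y - - z by ring.
by rewrite e.
Qed.

(** Feasibility and the bound by the initial value matrix are carried together: the natural gradient
    stepsize is calibrated at the initial gain and stays admissible because the values do not
    grow. *)
Lemma iterates_feasible (K : nat -> 'M[F]_(d, m)) :
  feas (K 0%N) ->
  (forall k, feas (K k) -> (forall x, qf (ric (K k)) x <= qf (ric (K 0%N)) x) ->
    exists2 c : F, 0 < c & forall x,
      qf (bell (ric (K k)) (K k.+1)) x
        + c * dot ((K k.+1 - K k) *m x) ((K k.+1 - K k) *m x)
      <= qf (ric (K k)) x) ->
  forall k, feas (K k) /\ forall x, qf (ric (K k)) x <= qf (ric (K 0%N)) x.
Proof.
move=> f0 hstep; elim=> [//|k [fk lek]].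
have S := riccati_stabsol fk; have [pP gP _ _] := S.
have [c c0 hc] := hstep k fk lek.
have fk' : feas (K k.+1).
  by apply/feasibleP => //; apply: improve_strict S c0 hc.
split; first exact: fk'.
move=> x; apply: (le_trans _ (lek x)).
have hb y : qf (bell (ric (K k)) (K k.+1)) y <= qf (ric (K k)) y.
  by apply: (le_trans _ (hc y)); rewrite lerDl mulr_ge0 ?dot_ge0 // ltW.
apply: (le_trans _ (hb x)).
exact: (stabsol_le pV (possemidef_sym pP) gP (riccati_stabsol fk') hb).
Qed.

Section Convergence.
Variables (Kopt : 'M[F]_(d, m)) (K : nat -> 'M[F]_(d, m)) (c : F).
Hypothesis fopt : feas Kopt.
Hypothesis eopt : Kopt = invmx (gain_weight A B C D R gamma Kopt)
  *m B^T *m tildeP D gamma (ric Kopt) *m A.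
Hypothesis fK : forall k, feas (K k).
Hypothesis c0 : 0 < c.
Hypothesis hdec : forall k x,
  qf (bell (ric (K k)) (K k.+1)) x
    + c * dot (gf (ric (K k)) (K k) *m x) (gf (ric (K k)) (K k) *m x)
  <= qf (ric (K k)) x.

Let hS k := riccati_stabsol (fK k).
Let hs := riccati_stabsol fopt.

Lemma optimal_stationary : gf (ric Kopt) Kopt = 0.
Proof.
have [pP gP _ _] := hs; have sP := possemidef_sym pP.
have uG : gw (ric Kopt) \in unitmx by apply/posdef_unit/gw_posdef.
apply/eqP; rewrite subr_eq0 {2}eopt (gain_weightE fopt) tildeP_tp //.
by rewrite -!mulmxA mulKVmx.
Qed.

Lemma policy_cvg : [/\ K @ \oo --> Kopt,
  (fun k => costJ (K k)) @ \oo --> costJ Kopt &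
  locally_linear (fun k => costJ (K k)) (costJ Kopt)].
Proof.
have [cP cK] := iterates_cvg pV pR hS hs optimal_stationary c0 hdec.
split; first exact: mcvg_cvg.
  rewrite (costE fopt); under eq_fun => k do rewrite (costE (fK k)).
  apply: cvgMr; apply: cvgB; first exact: cvg_cst.
  have [_ gP _ _] := hs.
  apply: (@cvg_comp _ _ _ (fun k => \det (V - ric (K k))) (@ln F)); last first.
    exact/continuous_ln/posdef_det_gt0.
  by apply: mcvg_det; apply: mcvgB => //; apply: mcvg_cst.
have [n0 [rho [hrho h]]] :=
  values_locally_linear pV pR hS hs optimal_stationary c0 hdec.
exists n0, rho; split; first exact: hrho.
have scale (g r a b x y : F) : 0 < g -> x = g * a -> y = g * b -> a <= r * b ->
    x <= r * y by move=> gp -> -> ab; rewrite mulrCA ler_pM2l.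
move=> k kn.
exact: (scale _ _ _ _ _ _ (exprn_gt0 2 g0) (cost_sub (fK k.+1) fopt)
  (cost_sub (fK k) fopt) (h k kn)).
Qed.

Lemma policy_quadratic : (forall k, gf (ric (K k)) (K k.+1) = 0) ->
  locally_quadratic (fun k => costJ (K k)) (costJ Kopt).
Proof.
move=> hgn; have [n0 [a [a0 h]]] :=
  values_locally_quadratic pV pR hS hs optimal_stationary c0 hdec hgn.
have g2 : 0 < gamma ^+ 2 by rewrite exprn_gt0.
(* A gap in [cost] is [gamma ^+ 2] times a gap in [- ln \det], and the square brings this factor
   twice. *)
exists n0, (a / gamma ^+ 2); split; first by rewrite divr_gt0.
have scale (g u v x y : F) : 0 < g -> x = g * u -> y = g * v -> u <= a * v ^+ 2 ->
    x <= a / g * y ^+ 2.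
  move=> gp -> -> uv; have -> : a / g * (g * v) ^+ 2 = g * (a * v ^+ 2).
    by field; rewrite gt_eqF.
  by rewrite ler_pM2l.
move=> k kn.
exact: (scale _ _ _ _ _ g2 (cost_sub (fK k.+1) fopt) (cost_sub (fK k) fopt) (h k kn)).
Qed.

End Convergence.

Lemma npg_iterates (K : nat -> 'M[F]_(d, m)) (eta : F) : feas (K 0%N) -> 0 < eta ->
  eta <= 1 / (2 * opnorm (gain_weight A B C D R gamma (K 0%N))) ->
  (forall k, K k.+1 = npg_step A B C D R gamma eta (K k)) ->
  (forall k, feas (K k)) /\ exists2 c : F, 0 < c & forall k x,
    qf (bell (ric (K k)) (K k.+1)) x
      + c * dot (gf (ric (K k)) (K k) *m x) (gf (ric (K k)) (K k) *m x)
    <= qf (ric (K k)) x.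
Proof.
move=> f0 e0; rewrite (gain_weightE f0); set g := opnorm _ => eg hK.
(* Otherwise [1 / (2 * g)] would not be positive, the inverse of 0 being 0, against [0 < eta]. *)
have gg0 : 0 < g.
  have : 0 < 1 / (2 * g) by apply: lt_le_trans eg.
  by rewrite div1r invr_gt0 pmulr_rgt0.
have {}eg : eta * g <= 1 / 2.
  move: eg; rewrite ler_pdivlMr ?mulr_gt0 //; lra.
have [_ gP0 _ _] := riccati_stabsol f0.
have key k : feas (K k) -> (forall x, qf (ric (K k)) x <= qf (ric (K 0%N)) x) ->
    forall x, qf (bell (ric (K k)) (K k.+1)) x
      + 2 * eta * dot (gf (ric (K k)) (K k) *m x) (gf (ric (K k)) (K k) *m x)
      <= qf (ric (K k)) x.
  move=> fk lek x; have [pP gP eP _] := riccati_stabsol fk.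
  rewrite hK /npg_step (grad_factorE fk) -[in leRHS]eP.
  apply: (npg_decrease A C pV pR _ x (possemidef_sym pP) e0 _ eg) => y.
  by apply: le_trans (gw_mono B R pV y gP0 gP lek) (qf_opnorm _ _).
have hf : forall k, feas (K k) /\ forall x, qf (ric (K k)) x <= qf (ric (K 0%N)) x.
  (* The step is [- (2 * eta)] times the gradient, so [2 * eta] times the squared gradient is
     [(2 * eta)^-1] times the squared step. *)
  apply: iterates_feasible => // k fk lek; exists (2 * eta)^-1 => [|x].
    by rewrite invr_gt0 mulr_gt0.
  apply: (le_trans _ (key k fk lek x)); rewrite lerD2l hK /npg_step (grad_factorE fk).
  rewrite addrAC subrr add0r mulNmx -scalemxAl dotNl dotNr opprK dotZl dotZr.
  by rewrite le_eqVlt; apply/orP; left; apply/eqP; field; rewrite gt_eqF.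
split=> [k|]; first by case: (hf k).
exists (2 * eta) => [|k x]; first by rewrite mulr_gt0.
by have [fk lek] := hf k; apply: key.
Qed.

Lemma gn_iterates (K : nat -> 'M[F]_(d, m)) (eta : F) : feas (K 0%N) -> 0 < eta ->
  eta <= 1 / 2 ->
  (forall k, K k.+1 = gn_step A B C D R gamma eta (K k)) ->
  (forall k, feas (K k)) /\ exists2 c : F, 0 < c & forall k x,
    qf (bell (ric (K k)) (K k.+1)) x
      + c * dot (gf (ric (K k)) (K k) *m x) (gf (ric (K k)) (K k) *m x)
    <= qf (ric (K k)) x.
Proof.
move=> f0 e0 e1 hK.
have [pP0 gP0 _ _] := riccati_stabsol f0.
have pG0 := gw_posdef B pV pR pP0 gP0.
(* Since the values decrease, so does [gw], and its inverse stays above the initial one; this makes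
   the final constant independent of [k]. *)
have [b b0 hb] := posdef_lb (posdef_inv pG0).
have [r r0 hr] := posdef_lb pR.
have h2e : 0 < 2 * eta by rewrite mulr_gt0.
have key k : feas (K k) -> forall x, qf (bell (ric (K k)) (K k.+1)) x
      + 2 * eta * qf (invmx (gw (ric (K k)))) (gf (ric (K k)) (K k) *m x)
      <= qf (ric (K k)) x.
  move=> fk x; have [pP gP eP _] := riccati_stabsol fk.
  rewrite hK /gn_step (grad_factorE fk) (gain_weightE fk) -[in leRHS]eP.
  exact: gn_decrease.
have hf : forall k, feas (K k) /\ forall x, qf (ric (K k)) x <= qf (ric (K 0%N)) x.
  (* Written in terms of the step, the decrease is [(2 * eta)^-1] times the form of [gw], which
     dominates [R] and hence [r]. *)
  apply: iterates_feasible => // k fk _; exists (r / (2 * eta)) => [|x].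
    by rewrite divr_gt0 // mulr_gt0.
  have [pP gP eP _] := riccati_stabsol fk; have pG := gw_posdef B pV pR pP gP.
  apply: (le_trans _ (key k fk x)); rewrite lerD2l hK /gn_step (grad_factorE fk).
  rewrite (gain_weightE fk) addrAC subrr add0r mulNmx -scalemxAl dotNl dotNr opprK.
  rewrite dotZl dotZr -mulmxA; set y := gf _ _ *m x.
  rewrite [leRHS](_ : _ = 2 * eta * qf (gw (ric (K k))) (invmx (gw (ric (K k))) *m y)).
    have -> (t : F) : r / (2 * eta) * (2 * eta * (2 * eta * t)) = 2 * eta * (r * t).
      by field; rewrite gt_eqF.
    rewrite ler_pM2l ?mulr_gt0 //; apply: le_trans (hr _) _.
    exact: gw_ge.
  by rewrite qf_invmx.
split=> [k|]; first by case: (hf k).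
exists (2 * eta * b) => [|k x]; first by rewrite !mulr_gt0.
have [fk lek] := hf k; apply: (le_trans _ (key k fk x)).
have [pP gP _ _] := riccati_stabsol fk; have pG := gw_posdef B pV pR pP gP.
rewrite lerD2l -(mulrA (2 * eta)) (ler_pM2l h2e).
apply: (le_trans (hb _)); apply: qf_invmx_anti; [exact: pG|exact: pG0|] => y.
exact: (gw_mono B R pV y gP0 gP lek).
Qed.

(** With [eta = 1 / 2] the step minimises [bellman] at [ric K] exactly, as in policy iteration. *)
Lemma gn_half_stationary K : feas K ->
  gf (ric K) (gn_step A B C D R gamma (1 / 2) K) = 0.
Proof.
move=> fK; have [pP gP _ _] := riccati_stabsol fK.
have uG : gw (ric K) \in unitmx by apply/posdef_unit/gw_posdef.
rewrite /gn_step (grad_factorE fK) (gain_weightE fK).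
have -> : 2 * (1 / 2) = 1 :> F by field.
by rewrite scale1r {1}/grad_mx mulmxBr mulKVmx // /grad_mx subKr subrr.
Qed.

End PolicyIteration.

Unset Implicit Arguments.

Theorem theorem4p6 (F : realType) (m d l n : nat)
    (A : 'M[F]_m) (B : 'M[F]_(m, d)) (C : 'M[F]_(l, m)) (D : 'M[F]_(m, n))
    (E : 'M[F]_(l, d)) (R : 'M[F]_d) (gamma : F)
    (Kopt K0 : 'M[F]_(d, m)) (eta : F) (K : nat -> 'M[F]_(d, m)) :
  posdefmx R ->
  E^T *m row_mx C E = row_mx 0 R ->
  0 < gamma ->
  feasible A B C D R gamma Kopt ->
  (forall K', feasible A B C D R gamma K' ->
     cost A B C D R gamma Kopt <= cost A B C D R gamma K') ->
  Kopt = invmx (gain_weight A B C D R gamma Kopt)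
         *m B^T *m tildeP D gamma (riccati A B C D R gamma Kopt) *m A ->
  feasible A B C D R gamma K0 ->
  ((opnorm K0)%:E < +oo)%E ->
  posdefmx (D *m D^T) ->
  0 < eta ->
  K 0%N = K0 ->
  let npg := (forall k, K k.+1 = npg_step A B C D R gamma eta (K k)) /\
             eta <= 1 / (2 * opnorm (gain_weight A B C D R gamma K0)) in
  let gn := (forall k, K k.+1 = gn_step A B C D R gamma eta (K k)) /\
            eta <= 1 / 2 in
  let costs := fun k : nat => cost A B C D R gamma (K k) in
  (npg \/ gn ->
    [/\ forall k, feasible A B C D R gamma (K k),
        K @ \oo --> Kopt,
        costs @ \oo --> cost A B C D R gamma Kopt &
        locally_linear costs (cost A B C D R gamma Kopt)]) /\
  (gn -> eta = 1 / 2 ->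
    locally_quadratic costs (cost A B C D R gamma Kopt)).
Proof.
move=> pR _ g0 fopt _ eopt f0 _ pDD e0 K00; subst K0; move=> npg gn costs.
split=> [step|[stepgn e1] e12].
  have [fK [c c0 hdec]] : (forall k, feasible A B C D R gamma (K k)) /\
      exists2 c : F, 0 < c & forall k x,
      qf (bellman (dweight D gamma) A B C R (riccati A B C D R gamma (K k)) (K k.+1)) x
      + c * dot (grad_mx (dweight D gamma) A B R (riccati A B C D R gamma (K k)) (K k) *m x)
                (grad_mx (dweight D gamma) A B R (riccati A B C D R gamma (K k)) (K k) *m x)
      <= qf (riccati A B C D R gamma (K k)) x.
    case: step => -[hK he]; first exact: (npg_iterates pR g0 pDD f0 e0 he hK).
    exact: (gn_iterates pR g0 pDD f0 e0 he hK).
  have [h1 h2 h3] := policy_cvg pR g0 pDD fopt eopt fK c0 hdec.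
  by split.
have [fK [c c0 hdec]] := gn_iterates pR g0 pDD f0 e0 e1 stepgn.
apply: (policy_quadratic pR g0 pDD fopt eopt fK c0 hdec) => k.
have -> : K k.+1 = gn_step A B C D R gamma (1 / 2) (K k) by rewrite -e12; exact: stepgn.
exact: (gn_half_stationary pR g0 pDD (fK k)).
Qed.
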